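(* Let $0<\alpha<\pi$ and let $w(u)=e^{i\beta}\bigl[\prod_{j=1}^k(u-u_j)\bigr]^{-1}$ with $|u_j|>1$ for $j=1,\dots,k$ and $\beta\in[0,2\pi)$ chosen so that $w(0)>0$. Then for any point $u_0\in\Omega_\alpha$, $$\lim_{n\to\infty}e^{n g_{\Omega_\alpha}(u_0,\infty)}\,\|wT_n^{\Gamma_\alpha,w}(\cdot,u_0)\|_{\Gamma_\alpha}=k_{\Omega_\alpha}(u_0,u_0)^{-1}\exp\left(\int_{\Gamma_\alpha}\log|w(x)|\,\omega(u_0,dx,\Omega_\alpha)\right),$$ where for $u_0=\infty$ the factor $e^{n g_{\Omega_\alpha}(u_0,\infty)}$ is read as $\operatorname{Cap}(\Gamma_\alpha)^{-n}$.
   Context: Notation: $\overline{\mathbb{C}}$ is the Riemann sphere, $\Gamma_\alpha=\{e^{it}:-\alpha\le t\le\alpha\}$, $\Omega_\alpha=\overline{\mathbb{C}}\setminus\Gamma_\alpha$, $\|f\|_{\Gamma_\alpha}=\sup_{\Gamma_\alpha}|f|$, $\operatorname{Cap}$ is logarithmic capacity, $g_{\Omega_\alpha}(\cdot,\infty)$ is the Green's function of $\Omega_\alpha$ with pole at $\infty$, and $\omega(u_0,\cdot,\Omega_\alpha)$ is harmonic measure of $\Omega_\alpha$ at $u_0$. $T_n^{\Gamma_\alpha,w}(\cdot,u_0)$ is the polynomial that minimizes $\|wP\|_{\Gamma_\alpha}$ among all polynomials $P$ of degree at most $n$ with $P(u_0)=1$, where for $u_0=\infty$ the value $P(\infty)$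 means the coefficient of $u^n$ (so $P$ is monic of degree $n$). The kernel is $$k_{\Omega_\alpha}(u,u_0)=\frac{2\lambda(u)\overline{\lambda(u_0)}}{\bigl(\lambda(u)+\overline{\lambda(u_0)}\bigr)^2},\qquad \lambda(u)=\left(\frac{ue^{i\alpha}-1}{u-e^{i\alpha}}\right)^{1/4}$$ (principal branch), where $\lambda$ maps $\Omega_\alpha$ conformally onto $\{z:\operatorname{Re}z>0,\ |\arg z|<\pi/4\}$. *)

(* Defs.v *)
From HB Require Import structures.
From mathcomp Require Import all_boot all_order all_algebra.
From mathcomp Require Import complex.
From mathcomp Require Import all_classical all_reals all_analysis.

Set Implicit Arguments.
Unset Strict Implicit.
Unset Printing Implicit Defensive.

Import Order.TTheory GRing.Theory Num.Theory.
Import numFieldNormedType.Exports.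

Local Open Scope classical_set_scope.
Local Open Scope ring_scope.

Section Plane.
Variable R : realType.

(* The topology, the Borel sets and the partial derivatives are those of R * R;
   complex arithmetic is that of R[i]. *)
Definition C_of (p : R * R) : R[i] := Complex p.1 p.2.

Definition cnorm (z : R[i]) : R := Normc.normc z.

(* The Riemann sphere: None is the point at infinity. *)
Definition sphere : Type := option R[i].

(* The chart z |-> 1/z around infinity. *)
Definition chart_infty (p : R * R) : sphere :=
  if C_of p == 0 then None else Some (C_of p)^-1.

Definition finite_part (U : set sphere) : set (R * R) :=
  [set p | U (Some (C_of p))].

Definition axis (b : bool) : R * R := if b then (0, 1) else (1, 0).

(* Meant for open U: there, existence and continuity of all second partial
   derivatives make h of class C^2. *)
Definition harmonic_plane (U : set (R * R)) (h : R * R -> R) : Prop :=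
  forall p, U p ->
    (forall b c : bool,
      [/\ derivable h p (axis b),
          derivable ('D_(axis b) h) p (axis c) &
          {for p, continuous ('D_(axis c) ('D_(axis b) h))}]) /\
    'D_(axis false) ('D_(axis false) h) p +
      'D_(axis true) ('D_(axis true) h) p = 0.

Definition harmonic_sphere (U : set sphere) (h : sphere -> R) : Prop :=
  harmonic_plane (finite_part U) (fun p => h (Some (C_of p))) /\
  harmonic_plane (chart_infty @^-1` U) (h \o chart_infty).

(* The boundary of a domain of the sphere containing infinity is a subset of
   the plane. *)
Definition bdry (U : set sphere) : set (R * R) :=
  closure (finite_part U) `\` (finite_part U)°.

(* Green's function of U with pole at infinity, for a domain U containing
   infinity that is regular for the Dirichlet problem (limit 0 at every
   boundary point). *)
Definition is_green_infty (U : set sphere) (g : R[i] -> R) : Prop :=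
  [/\ harmonic_plane (finite_part U) (g \o C_of),
      (exists M r : R, forall z : R[i], r < cnorm z ->
         `|g z - ln (cnorm z)| <= M) &
      forall x, bdry U x ->
        g (C_of p) @[p --> within (finite_part U) (nbhs x)] --> (0 : R)].

(* Harmonic measure of U at u0, for U as above: the probability carried by the
   boundary which represents the evaluation at u0 of solutions of the Dirichlet
   problem with continuous boundary data. *)
Definition is_harmonic_measure (U : set sphere) (u0 : sphere)
    (omega : probability (measurableTypeR R * measurableTypeR R)%type R)
    : Prop :=
  omega (bdry U) = 1%E /\
  forall (f : R * R -> R) (h : sphere -> R),
    {within bdry U, continuous f} ->
    harmonic_sphere U h ->
    (forall x, bdry U x ->
       h (Some (C_of p)) @[p --> within (finite_part U) (nbhs x)] --> f x) ->
    \int[omega]_(x in bdry U) f x = h u0.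

Definition log_kernel (x y : R * R) : \bar R :=
  if x == y then +oo%E else (- ln (cnorm (C_of x - C_of y)))%:E.

Definition energy
    (mu : probability (measurableTypeR R * measurableTypeR R)%type R)
    : \bar R :=
  (\int[mu]_x \int[mu]_y log_kernel x y)%E.

(* Logarithmic capacity of a compact set K: exp (- V), where V is the infimum
   of the logarithmic energies of the probability measures carried by K. *)
Definition cap (K : set R[i]) : R :=
  fine (expeR (- ereal_inf [set energy mu | mu in
    [set mu : probability (measurableTypeR R * measurableTypeR R)%type R |
      mu (C_of @^-1` K) = 1%E]])%E).

Definition expi (t : R) : R[i] := Complex (cos t) (sin t).

Definition Gamma (alpha : R) : set R[i] :=
  [set expi t | t in `[- alpha, alpha]].

Definition Omega (alpha : R) : set sphere := ~` (Some @` Gamma alpha).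

Definition sup_norm (K : set R[i]) (f : R[i] -> R[i]) : R :=
  sup [set cnorm (f z) | z in K].

Definition value_at (n : nat) (P : {poly R[i]}) (u0 : sphere) : R[i] :=
  if u0 is Some z then P.[z] else P`_n.

Definition is_residual_poly (K : set R[i]) (w : R[i] -> R[i]) (n : nat)
    (u0 : sphere) (T : {poly R[i]}) : Prop :=
  [/\ (size T <= n.+1)%N, value_at n T u0 = 1 &
      forall P : {poly R[i]}, (size P <= n.+1)%N -> value_at n P u0 = 1 ->
        sup_norm K (fun z => w z * T.[z]) <= sup_norm K (fun z => w z * P.[z])].

(* Principal argument, with values in ]-pi, pi] for z != 0. *)
Definition Arg (z : R[i]) : R :=
  if 0 <= complex.Im z then acos (complex.Re z / cnorm z)
  else - acos (complex.Re z / cnorm z).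

Definition powC (z : R[i]) (s : R) : R[i] :=
  real_complex R (cnorm z `^ s) * expi (s * Arg z).

(* The value at infinity is the limit, the Moebius map sending infinity to
   exp (i alpha). *)
Definition lambda (alpha : R) (u : sphere) : R[i] :=
  powC (if u is Some z then (z * expi alpha - 1) / (z - expi alpha)
        else expi alpha) 4^-1.

(* On the diagonal this is a positive real number, 2 |l|^2 / (2 Re l)^2 with
   l = lambda alpha u, where |arg l| < pi / 4. *)
Definition kernel_Omega (alpha : R) (u u0 : sphere) : R[i] :=
  2 * lambda alpha u * conjc (lambda alpha u0) /
    (lambda alpha u + conjc (lambda alpha u0)) ^+ 2.

Definition weight (beta : R) (k : nat) (u : 'I_k -> R[i]) (z : R[i]) : R[i] :=
  expi beta * (\prod_(j < k) (z - u j))^-1.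

Definition growth (alpha : R) (g : R[i] -> R) (u0 : sphere) (n : nat) : R :=
  if u0 is Some z then expR (n%:R * g z) else cap (Gamma alpha) ^- n.

End Plane.

(* Main.v *)
Require Import Defs.
From HB Require Import structures.
From mathcomp Require Import all_boot all_order all_algebra.
From mathcomp Require Import complex.
From mathcomp Require Import ring lra zify.
From mathcomp Require Import all_classical all_reals all_analysis.
From mathcomp Require Import measurable_realfun.
Import Order.TTheory GRing.Theory Num.Theory.
Import numFieldNormedType.Exports.
Local Open Scope classical_set_scope.
Local Open Scope ring_scope.

Set Implicit Arguments.
Unset Strict Implicit.
Unset Printing Implicit Defensive.

(* Let [s] be the square root of [(u e - 1) / (u - e)], [e = exp (i alpha)], with
   positive real part: [lambda ^ 2 = s], so that [1 / k (u0, u0) = 1 + Re s0 / |s0|].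
   The variable [z = (s - |s0|) / (s + |s0|)] writes [u = A z / D z] with quadratic
   [A] and [D]; the unit circle covers the arc twice, polynomials of degree [n] in
   [u] become self-reciprocal polynomials [Q] of degree [2 n] in [z], and [|w P|]
   becomes a multiple of [|Q / W|] on the circle, with [W] free of zeros in the
   closed disc.  It remains to minimize [max |Q / W|] over the self-reciprocal [Q]
   with [Q z0 = W z0], where [z0] is purely imaginary; the infimum tends to
   [2 / (1 + |z0| ^ 2) = 1 + Re s0 / |s0|].  The upper bound comes from
   [Q = R + R*] with [R z] close to [W z (1 - z0 z) ^ 2 / (1 + |z0| ^ 2) ^ 2], the
   lower bound from integrating [Q / W] against a Fejer kernel in the unimodular
   function relating the values of [Q / W] at [z] and at [conjc z].

   The normalizing factors are explicit.  By the maximum principle the Green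
   function is [ln |(s + conjc b) / (s - b)|], [b = exp (i alpha / 2)]; the harmonic
   extension of [ln |w|] is a sum of logarithms of rational functions of [s]; and
   the capacity is [sin (alpha / 2)]: the image of the uniform measure of the circle
   under [t |-> (t + S) / (t (1 + S t))], [S = sin (alpha / 2)], has potential at most
   [- ln S], by Jensen's formula, while any measure on the arc has energy at least
   [- ln S] because [- ln |1 - r x (conjc y)|] is a positive definite kernel. *)

(** * Complex modulus and averages over roots of unity *)

(** Where the factor 2 in the infimum comes from: the two halves [R] and [R*] of a self-reciprocal
    [Q] oscillate on the circle with phases that decouple as the degree grows, so in the limit one
    minimizes the maximum of [|R / W| + |R* / W|], while [R*] contributes nothing at [z0]. For
    [R / W] proportional to [(1 - z0 z) ^ 2] with [z0] imaginary, this sum is a multiple of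
    [|1 - z0 z| ^ 2 + |1 + z0 z| ^ 2], which the parallelogram identity makes constant on the
    circle; hence the scaling of [z] by [|s0|].

    The obstacle in both bounds is the degree. [W] contains the [m]th power of a fixed quadratic,
    and fixed factors such as [(1 - z0 z) ^ 2] or [(conjc z) ^ 2] have to be absorbed without
    raising the degree or leaving the analytic functions. For this [z] is approximated by a
    polynomial of degree [p] in the Blaschke factor of [a], the point that represents
    [u = infinity]; its denominators are paid for by [2 p] of the [m] factors in [W].

    Integrals over the circle are replaced there by means over roots of unity. For the capacity,
    logarithmic singularities are avoided by moving points of the arc to radius [r < 1]. *)

Arguments cnorm : simpl never.
Arguments expi : simpl never.

Section ComplexModulus.
Variable R : realType.
Implicit Types (x y z : R[i]).

Lemma cnorm_ge0 z : 0 <= cnorm z.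
Proof. by case: z => a b; exact: sqrtr_ge0. Qed.

Lemma cnorm0 : cnorm (0 : R[i]) = 0. Proof. exact: Normc.normc0. Qed.
Lemma cnorm1 : cnorm (1 : R[i]) = 1. Proof. exact: Normc.normc1. Qed.

Lemma cnorm_eq0 z : (cnorm z == 0) = (z == 0).
Proof.
apply/eqP/eqP => [/Normc.eq0_normc//|->]; exact: cnorm0.
Qed.

Lemma cnorm_gt0 z : (0 < cnorm z) = (z != 0).
Proof. by rewrite lt_neqAle cnorm_ge0 andbT eq_sym cnorm_eq0. Qed.

Lemma cnormM x y : cnorm (x * y) = cnorm x * cnorm y.
Proof. exact: Normc.normcM. Qed.

Lemma cnormV x : cnorm x^-1 = (cnorm x)^-1.
Proof. exact: Normc.normcV. Qed.

Lemma cnormf x y : cnorm (x / y) = cnorm x / cnorm y.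
Proof. by rewrite cnormM cnormV. Qed.

Lemma cnormX x n : cnorm (x ^+ n) = cnorm x ^+ n.
Proof.
by elim: n => [|n IH]; rewrite ?expr0 ?cnorm1// !exprS cnormM IH.
Qed.

Lemma cnormN x : cnorm (- x) = cnorm x.
Proof. exact: normcN. Qed.

Lemma cnormB x y : cnorm (x - y) = cnorm (y - x).
Proof. by rewrite -cnormN opprB. Qed.

Lemma ler_cnormD x y : cnorm (x + y) <= cnorm x + cnorm y.
Proof. exact: le_normcD. Qed.

Lemma ler_cnormB x y : cnorm (x - y) <= cnorm x + cnorm y.
Proof. by rewrite -[cnorm y]cnormN; exact: ler_cnormD. Qed.

Lemma lerB_cnorm x y : cnorm x - cnorm y <= cnorm (x - y).
Proof. by rewrite lerBlDr -{1}(subrK y x) ler_cnormD. Qed.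

Lemma ler_cnorm_dist x y : `|cnorm x - cnorm y| <= cnorm (x - y).
Proof.
by rewrite ler_norml lerB_cnorm andbT lerNl opprB cnormB lerB_cnorm.
Qed.

Lemma cnormJ z : cnorm (conjc z) = cnorm z.
Proof. by case: z => a b; rewrite /cnorm /= sqrrN. Qed.

Lemma cnorm_real (a : R) : cnorm (real_complex R a) = `|a|.
Proof. by rewrite /cnorm /= expr0n addr0 sqrtr_sqr. Qed.

Lemma cnorm_sqr z : cnorm z ^+ 2 = complex.Re z ^+ 2 + complex.Im z ^+ 2.
Proof. by case: z => a b; rewrite /cnorm /= sqr_sqrtr // addr_ge0 // sqr_ge0. Qed.

Lemma mulcJ z : z * conjc z = real_complex R (cnorm z ^+ 2).
Proof.
rewrite cnorm_sqr; case: z => a b; apply/eqP; rewrite eq_complex /=.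
by apply/andP; split; apply/eqP; ring.
Qed.

Lemma cnorm_Re z : `|complex.Re z| <= cnorm z.
Proof.
case: z => a b; rewrite /cnorm /= -sqrtr_sqr ler_sqrt ?lerDl ?sqr_ge0 //.
by rewrite addr_ge0 ?sqr_ge0.
Qed.

Lemma cnorm_Im z : `|complex.Im z| <= cnorm z.
Proof.
case: z => a b; rewrite /cnorm /= -sqrtr_sqr ler_sqrt ?lerDr ?sqr_ge0 //.
by rewrite addr_ge0 ?sqr_ge0.
Qed.

Lemma Re_le_cnorm z : complex.Re z <= cnorm z.
Proof. exact: le_trans (ler_norm _) (cnorm_Re z). Qed.

Lemma cnorm_le_ReIm z : cnorm z <= `|complex.Re z| + `|complex.Im z|.
Proof.
have h : z = real_complex R (complex.Re z) + Complex 0 1 * real_complex R (complex.Im z).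
  exact: complexE.
rewrite {1}h (le_trans (ler_cnormD _ _)) // cnormM !cnorm_real lerD2l.
by rewrite /cnorm /= expr0n add0r expr1n sqrtr1 mul1r.
Qed.

Lemma ler_cnorm_sum (I : Type) (r : seq I) (P : pred I) (F : I -> R[i]) :
  cnorm (\sum_(i <- r | P i) F i) <= \sum_(i <- r | P i) cnorm (F i).
Proof.
elim/big_ind2 : _ => [|x a y b h1 h2|//]; first by rewrite cnorm0.
by rewrite (le_trans (ler_cnormD _ _)) // lerD.
Qed.

Lemma cnorm_prod (I : Type) (r : seq I) (P : pred I) (F : I -> R[i]) :
  cnorm (\prod_(i <- r | P i) F i) = \prod_(i <- r | P i) cnorm (F i).
Proof.
by elim/big_ind2 : _ => [|x a y b <- <-|//]; rewrite ?cnorm1 ?cnormM.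
Qed.

Lemma conjc_unit z : cnorm z = 1 -> conjc z = z^-1.
Proof.
move=> h; have z0 : z != 0 by rewrite -cnorm_gt0 h.
apply: (mulfI z0); rewrite mulcJ h expr1n divff //.
Qed.

Lemma conjcM x y : conjc (x * y) = conjc x * conjc y. Proof. exact: rmorphM. Qed.
Lemma conjcD x y : conjc (x + y) = conjc x + conjc y. Proof. exact: rmorphD. Qed.
Lemma conjcN x : conjc (- x) = - conjc x. Proof. exact: rmorphN. Qed.
Lemma conjcX x n : conjc (x ^+ n) = conjc x ^+ n. Proof. exact: rmorphXn. Qed.
Lemma conjcV x : conjc x^-1 = (conjc x)^-1. Proof. exact: fmorphV. Qed.
Lemma conjcR (t : R) : conjc (real_complex R t) = real_complex R t.
Proof. exact: conjc_real. Qed.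
Definition conjcE := (conjcX, conjcV, conjcN, conjcM, conjcD, conjc1, conjcR, @conjcK R).

Lemma rcM (s t : R) : real_complex R (s * t) = real_complex R s * real_complex R t.
Proof. exact: rmorphM. Qed.
Lemma rcD (s t : R) : real_complex R (s + t) = real_complex R s + real_complex R t.
Proof. exact: rmorphD. Qed.
Lemma rcN (t : R) : real_complex R (- t) = - real_complex R t.
Proof. exact: rmorphN. Qed.
Lemma rcX (t : R) n : real_complex R (t ^+ n) = real_complex R t ^+ n.
Proof. exact: rmorphXn. Qed.
Lemma rcV (t : R) : real_complex R t^-1 = (real_complex R t)^-1.
Proof. exact: fmorphV. Qed.
Lemma rc1 : real_complex R 1 = 1. Proof. by []. Qed.
Lemma rc_eq0 (t : R) : (real_complex R t == 0) = (t == 0).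
Proof. exact: fmorph_eq0. Qed.
Lemma rc_nat (n : nat) : real_complex R n%:R = n%:R. Proof. exact: rmorph_nat. Qed.
Definition rcE := (rcX, rcV, rcN, rcM, rcD, rc1, rc_nat).

Lemma addrJ z : z + conjc z = real_complex R (2 * complex.Re z).
Proof. by case: z => a b; apply/eqP; rewrite eq_complex /= subrr mulr_natl mulr2n !eqxx. Qed.

Lemma cnorm_ne x y : cnorm x != cnorm y -> x != y.
Proof. by apply: contra_neq => ->. Qed.

Lemma one_sub_neq0 a z : cnorm a < 1 -> cnorm z <= 1 -> 1 - a * z != 0.
Proof.
move=> ha hz; rewrite subr_eq0; apply: cnorm_ne; rewrite cnorm1 cnormM.
by rewrite gt_eqF // (le_lt_trans _ ha) // ler_piMr ?cnorm_ge0.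
Qed.

End ComplexModulus.

(** * Means over roots of unity and the disc algebra *)

Section RootsOfUnity.
Variable R : realType.
Implicit Types (z : R[i]) (t : R).

Lemma expi0 : expi (0 : R) = 1.
Proof. by rewrite /expi cos0 sin0. Qed.

Lemma expiD (s t : R) : expi (s + t) = expi s * expi t.
Proof.
rewrite /expi cosD sinD; apply/eqP; rewrite eq_complex /=.
by apply/andP; split; apply/eqP; ring.
Qed.

Lemma conjc_expi t : conjc (expi t) = expi (- t).
Proof. by rewrite /expi /= cosN sinN. Qed.

Lemma cnorm_expi t : cnorm (expi t) = 1.
Proof. by rewrite /cnorm /= cos2Dsin2 sqrtr1. Qed.

Lemma expiX t n : expi t ^+ n = expi (n%:R * t).
Proof.
elim: n => [|n IH]; first by rewrite mul0r expi0 expr0.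
by rewrite exprS IH -expiD -addn1 natrD mulrDl mul1r addrC.
Qed.

Lemma expi_2pi : expi (2 * pi : R) = 1.
Proof. by rewrite /expi mulrC mulr_natr cos2pi sin2pi. Qed.

Lemma expi_neq1 t : 0 < t < 2 * pi -> expi t != 1.
Proof.
move=> /andP[t0 t1]; rewrite eq_complex /= negb_and; apply/orP; left.
have h : cos t = 1 - 2 * sin (t / 2) ^+ 2.
  have -> : cos t = cos (t / 2 + t / 2) by congr cos; lra.
  rewrite cosD -!expr2 cos2sin2; ring.
have s0 : 0 < sin (t / 2) by apply: sin_gt0_pi; apply/andP; split; lra.
by rewrite h lt_eqF//; have := exprn_gt0 2 s0; lra.
Qed.

(** Stands for the normalized integral over the circle; it is exact on polynomials of degree less
    than [N]. *)
Definition avg (N : nat) (f : R[i] -> R[i]) : R[i] :=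
  (N%:R)^-1 * \sum_(j < N) f (expi (2 * pi * j%:R / N%:R)).

Lemma avgD N f g : avg N (fun z => f z + g z) = avg N f + avg N g.
Proof. by rewrite /avg big_split mulrDr. Qed.

Lemma avgZ N (c : R[i]) f : avg N (fun z => c * f z) = c * avg N f.
Proof. by rewrite /avg -big_distrr /= mulrCA. Qed.

Lemma avg_sum N (I : Type) (r : seq I) (P : pred I) (f : I -> R[i] -> R[i]) :
  avg N (fun z => \sum_(i <- r | P i) f i z) = \sum_(i <- r | P i) avg N (f i).
Proof. by rewrite /avg exchange_big big_distrr. Qed.

Lemma eq_avg N f g : (forall z, cnorm z = 1 -> f z = g z) -> avg N f = avg N g.
Proof. by move=> h; congr (_ * _); apply: eq_bigr => i _; rewrite h ?cnorm_expi. Qed.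

Lemma avg_conj N f : avg N (fun z => conjc (f z)) = conjc (avg N f).
Proof.
by rewrite /avg rmorphM fmorphV rmorph_nat rmorph_sum.
Qed.

Lemma cnorm_nat (n : nat) : cnorm (n%:R : R[i]) = n%:R.
Proof.
have -> : (n%:R : R[i]) = real_complex R n%:R by rewrite rmorph_nat.
by rewrite cnorm_real normr_nat.
Qed.

Lemma le_cnorm_avg N f (g : R[i] -> R) :
  (forall z, cnorm z = 1 -> cnorm (f z) <= g z) ->
  cnorm (avg N f) <= complex.Re (avg N (fun z => real_complex R (g z))).
Proof.
move=> h; rewrite /avg -rmorph_sum /= cnormM.
have -> : (N%:R : R[i])^-1 = real_complex R N%:R^-1 by rewrite fmorphV rmorph_nat.
rewrite -rmorphM /= cnorm_real ger0_norm ?invr_ge0//.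
rewrite ler_wpM2l ?invr_ge0// (le_trans (ler_cnorm_sum _ _ _))//.
by apply: ler_sum => i _; apply: h; rewrite cnorm_expi.
Qed.

Lemma avg_cst N (c : R[i]) : (0 < N)%N -> avg N (fun=> c) = c.
Proof.
move=> N0; rewrite /avg sumr_const card_ord -[c *+ N]mulr_natl mulrA mulVf ?mul1r//.
by rewrite pnatr_eq0 -lt0n.
Qed.

Lemma le_cnorm_avg_cst N f (c : R) : (0 < N)%N ->
  (forall z, cnorm z = 1 -> cnorm (f z) <= c) -> cnorm (avg N f) <= c.
Proof.
by move=> N0 /le_cnorm_avg h; have := h N; rewrite avg_cst.
Qed.

(** Conjugation permutes the roots of unity: the index [j] becomes [- j] modulo [N]. *)
Lemma avg_refl N f : avg N (fun z => f (conjc z)) = avg N f.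
Proof.
case: N => [|N]; first by rewrite /avg !big_ord0.
congr (_ * _); rewrite (reindex_inj (@oppr_inj 'I_N.+1)); apply: eq_bigr => i _.
rewrite conjc_expi; congr (f _).
have -> : (- i)%R = ((N.+1 - i) %% N.+1)%N :> nat by [].
have [->|i1] := posnP i.
  by rewrite subn0 modnn mulr0 mul0r oppr0.
rewrite modn_small; last by rewrite ltn_subrL i1.
rewrite natrB ?(ltnW (ltn_ord i))//.
rewrite -[LHS]mulr1 -expi_2pi -expiD; congr expi.
by field; rewrite addrC natr1 pnatr_eq0.
Qed.

(** A geometric sum with ratio different from 1. The bound on [i] excludes aliasing, since
    [z ^+ N.+1] is 1 at every node. *)
Lemma avgX N i : (i <= N)%N -> avg N.+1 (fun z => z ^+ i) = (i == 0%N)%:R.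
Proof.
move=> iN; have [->|i0] := eqVneq i 0%N.
  by rewrite (eq_avg _ (g := fun=> 1)) ?avg_cst// => z; rewrite expr0.
set w : R[i] := expi (2 * pi * i%:R / N.+1%:R).
have N0 : N.+1%:R != 0 :> R by rewrite pnatr_eq0.
have w1 : w != 1.
  apply: expi_neq1; rewrite divr_gt0 ?mulr_gt0 ?pi_gt0 ?ltr0n ?lt0n//=.
  rewrite ltr_pdivrMr ?ltr0n// ltr_pM2l ?ltr_nat ?mulr_gt0 ?pi_gt0//.
have wN : w ^+ N.+1 = 1.
  rewrite expiX mulrCA divff// mulr1 mulrC -expiX expi_2pi expr1n //.
rewrite /avg (eq_bigr (fun j : 'I_N.+1 => w ^+ j)); last first.
  by move=> j _; rewrite !expiX; congr expi; ring.
have /eqP := subrX1 w N.+1; rewrite wN subrr eq_sym mulf_eq0 subr_eq0 (negPf w1) /=.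
by move=> /eqP ->; rewrite mulr0.
Qed.

(** Convergence of the means to [v]; the index [N.+1] keeps the number of nodes positive. *)
Definition mean_value (f : R[i] -> R[i]) (v : R[i]) :=
  forall e : R, 0 < e -> exists N0 : nat, forall N, (N0 <= N)%N ->
    cnorm (avg N.+1 f - v) <= e.

Lemma eq_mean_value f g v : (forall z, cnorm z = 1 -> f z = g z) ->
  mean_value f v -> mean_value g v.
Proof.
by move=> fg h e /h[N0 H]; exists N0 => N /H; rewrite (eq_avg _ fg).
Qed.

Lemma mean_valueD f g v w : mean_value f v -> mean_value g w ->
  mean_value (fun z => f z + g z) (v + w).
Proof.
move=> hf hg e e0; have e2 : 0 < e / 2 by lra.
have [N1 H1] := hf _ e2; have [N2 H2] := hg _ e2.
exists (maxn N1 N2) => N; rewrite geq_max => /andP[/H1 h1 /H2 h2].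
rewrite avgD opprD addrACA (le_trans (ler_cnormD _ _))//; lra.
Qed.

Lemma mean_valueZ c f v : mean_value f v ->
  mean_value (fun z => c * f z) (c * v).
Proof.
move=> hf e e0; have c0 := cnorm_ge0 c.
have e1 : 0 < e / (cnorm c + 1) by rewrite divr_gt0//; lra.
have [N1 H1] := hf _ e1; exists N1 => N /H1 h.
rewrite avgZ -mulrBr cnormM (le_trans (ler_wpM2l c0 h))//.
by rewrite mulrCA ler_piMr ?(ltW e0)// ler_pdivrMr; lra.
Qed.

Lemma mean_value_conj f v : mean_value f v ->
  mean_value (fun z => conjc (f z)) (conjc v).
Proof.
by move=> h e /h[N0 H]; exists N0 => N /H; rewrite avg_conj -rmorphB cnormJ.
Qed.

Lemma mean_value_cst c : mean_value (fun=> c) c.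
Proof. by move=> e e0; exists 0%N => N _; rewrite avg_cst// subrr cnorm0 ltW. Qed.

Lemma mean_value_approx f v :
  (forall e : R, 0 < e -> exists g w,
    [/\ forall z, cnorm z = 1 -> cnorm (f z - g z) <= e,
        cnorm (w - v) <= e & mean_value g w]) -> mean_value f v.
Proof.
move=> h e e0; have e3 : 0 < e / 3 by lra.
have [g [w [fg wv gw]]] := h _ e3; have [N0 H] := gw _ e3.
exists N0 => N /H hN.
have d : cnorm (avg N.+1 f - avg N.+1 g) <= e / 3.
  rewrite -[avg _ g]mul1r -mulNr -avgZ -avgD; apply: le_cnorm_avg_cst => // z z1.
  by rewrite mulN1r fg.
have -> : avg N.+1 f - v = (avg N.+1 f - avg N.+1 g) + (avg N.+1 g - w) + (w - v).
  by ring.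
apply: le_trans (ler_cnormD _ _) _.
have := ler_cnormD (avg N.+1 f - avg N.+1 g) (avg N.+1 g - w); lra.
Qed.

Lemma mean_value_poly (p : {poly R[i]}) : mean_value (fun z => p.[z]) p`_0.
Proof.
move=> e e0; exists (size p) => N hN.
have -> : avg N.+1 (fun z => p.[z]) = \sum_(i < size p) p`_i * (i == 0%N :> nat)%:R.
  rewrite (eq_avg _ (g := fun z => \sum_(i < size p) p`_i * z ^+ i)); last first.
    by move=> z _; rewrite horner_coef.
  rewrite avg_sum; apply: eq_bigr => i _; rewrite avgZ avgX//.
  by rewrite (leq_trans _ hN)// ltnW.
case: (ltnP 0 (size p)) => [s0|]; last first.
  by rewrite leqn0 => /eqP s0; rewrite nth_default s0 // big_ord0 subrr cnorm0 ltW.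
rewrite (bigD1 (Ordinal s0)) //= mulr1 big1 ?addr0 ?subrr ?cnorm0 ?ltW// => i.
by rewrite -val_eqE /= => /negPf ->; rewrite mulr0.
Qed.

(** The disc algebra, as the uniform limits of polynomials on the closed disc: the mean value
    property passes from polynomials to such limits, and products and inverses of linear factors
    stay inside by elementary estimates. *)
Definition disc_alg (f : R[i] -> R[i]) :=
  forall e : R, 0 < e -> exists p : {poly R[i]}, forall z, cnorm z <= 1 ->
    cnorm (f z - p.[z]) <= e.

Lemma eq_disc_alg f g : (forall z, cnorm z <= 1 -> f z = g z) ->
  disc_alg f -> disc_alg g.
Proof. by move=> fg h e /h[p H]; exists p => z z1; rewrite -fg// H. Qed.

Lemma disc_alg_poly (p : {poly R[i]}) : disc_alg (fun z => p.[z]).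
Proof. by move=> e e0; exists p => z _; rewrite subrr cnorm0 ltW. Qed.

Lemma disc_alg_cst c : disc_alg (fun=> c).
Proof. by apply: eq_disc_alg (disc_alg_poly c%:P) => z _; rewrite hornerC. Qed.

Lemma disc_alg_id : disc_alg id.
Proof. by apply: eq_disc_alg (disc_alg_poly 'X) => z _; rewrite hornerX. Qed.

Lemma poly_disc_bounded (p : {poly R[i]}) :
  exists2 B : R, 0 <= B & forall z, cnorm z <= 1 -> cnorm p.[z] <= B.
Proof.
exists (\sum_(i < size p) cnorm p`_i); first by apply: sumr_ge0 => i _; exact: cnorm_ge0.
move=> z z1; rewrite horner_coef (le_trans (ler_cnorm_sum _ _ _))//.
apply: ler_sum => i _; rewrite cnormM cnormX ler_piMr ?cnorm_ge0//.
by rewrite exprn_ile1 ?cnorm_ge0.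
Qed.

Lemma disc_alg_bounded f : disc_alg f ->
  exists2 B : R, 0 <= B & forall z, cnorm z <= 1 -> cnorm (f z) <= B.
Proof.
move=> /(_ 1 ltr01)[p hp]; have [B B0 hB] := poly_disc_bounded p.
exists (B + 1) => [|z z1]; first by rewrite addr_ge0.
rewrite -(subrK p.[z] (f z)) (le_trans (ler_cnormD _ _))// addrC lerD ?hp ?hB//.
Qed.

Lemma disc_algD f g : disc_alg f -> disc_alg g -> disc_alg (fun z => f z + g z).
Proof.
move=> hf hg e e0; have e2 : 0 < e / 2 by lra.
have [p hp] := hf _ e2; have [q hq] := hg _ e2; exists (p + q) => z z1.
rewrite hornerD opprD addrACA (le_trans (ler_cnormD _ _))//.
have := hp _ z1; have := hq _ z1; lra.
Qed.

Lemma disc_algM f g : disc_alg f -> disc_alg g -> disc_alg (fun z => f z * g z).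
Proof.
move=> hf hg e e0; have [B B0 hB] := disc_alg_bounded hf.
have e1 : 0 < e / (2 * (B + 1)) by rewrite divr_gt0// mulr_gt0//; lra.
have [q hq] := hg _ e1; have [D D0 hD] := poly_disc_bounded q.
have e2 : 0 < e / (2 * (D + 1)) by rewrite divr_gt0// mulr_gt0//; lra.
have [p hp] := hf _ e2; exists (p * q) => z z1; rewrite hornerM.
have -> : f z * g z - p.[z] * q.[z] = f z * (g z - q.[z]) + (f z - p.[z]) * q.[z].
  by ring.
rewrite (le_trans (ler_cnormD _ _))// !cnormM.
have h1 : cnorm (f z) * cnorm (g z - q.[z]) <= (B + 1) * (e / (2 * (B + 1))).
  by apply: ler_pM; rewrite ?cnorm_ge0 ?hq//; have := hB _ z1; lra.
have h2 : cnorm (f z - p.[z]) * cnorm q.[z] <= (e / (2 * (D + 1))) * (D + 1).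
  by apply: ler_pM; rewrite ?cnorm_ge0 ?hp//; have := hD _ z1; lra.
have e3 : (B + 1) * (e / (2 * (B + 1))) = e / 2 by field; lra.
have e4 : (e / (2 * (D + 1))) * (D + 1) = e / 2 by field; lra.
lra.
Qed.

Lemma disc_algX f n : disc_alg f -> disc_alg (fun z => f z ^+ n).
Proof.
move=> hf; elim: n => [|n IH].
  by apply: eq_disc_alg (disc_alg_cst 1) => z _; rewrite expr0.
by apply: eq_disc_alg (disc_algM hf IH) => z _; rewrite exprS.
Qed.

Lemma disc_alg_prod (I : Type) (r : seq I) (f : I -> R[i] -> R[i]) :
  (forall i, disc_alg (f i)) -> disc_alg (fun z => \prod_(i <- r) f i z).
Proof.
move=> hf; elim: r => [|i r IH].
  by apply: eq_disc_alg (disc_alg_cst 1) => z _; rewrite big_nil.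
by apply: eq_disc_alg (disc_algM (hf i) IH) => z _; rewrite big_cons.
Qed.

Lemma expr_small (r e : R) : 0 <= r < 1 -> 0 < e ->
  exists N0 : nat, forall N, (N0 <= N)%N -> r ^+ N <= e.
Proof.
move=> /andP[r0 r1] e0.
have : r ^+ n @[n --> \oo] --> (0 : R) by apply: cvg_expr; rewrite ger0_norm.
move=> /cvgr0Pnorm_le /(_ _ e0)[N0 _ H]; exists N0 => N /H.
by rewrite ger0_norm ?exprn_ge0.
Qed.

Lemma geo_tail (x : R[i]) (r : R) n : cnorm x <= r -> r < 1 ->
  cnorm ((1 - x)^-1 - \sum_(i < n) x ^+ i) <= r ^+ n / (1 - r).
Proof.
move=> xr r1; have r0 : 0 <= r := le_trans (cnorm_ge0 x) xr.
have x1 : 1 - x != 0.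
  by have := @one_sub_neq0 R x 1 (le_lt_trans xr r1); rewrite cnorm1 mulr1; exact.
have -> : (1 - x)^-1 - \sum_(i < n) x ^+ i = x ^+ n / (1 - x).
  apply: (mulIf x1); rewrite mulrBl mulVf// mulfVK//.
  have := subrX1 x n; rewrite -[_ - x]opprB mulrN [_ * (x - 1)]mulrC => <-; ring.
rewrite cnormf cnormX; apply: ler_pM; rewrite ?exprn_ge0 ?invr_ge0 ?cnorm_ge0//.
  by rewrite lerXn2r ?nnegrE ?cnorm_ge0.
rewrite lef_pV2 ?posrE ?cnorm_gt0// ?subr_gt0//.
by have := lerB_cnorm 1 x; rewrite cnorm1; lra.
Qed.

Lemma disc_alg_inv a : cnorm a < 1 -> disc_alg (fun z => (1 - a * z)^-1).
Proof.
move=> a1 e e0; have a0 := cnorm_ge0 a.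
have e1 : 0 < e * (1 - cnorm a) by rewrite mulr_gt0// subr_gt0.
have /expr_small/(_ e1)[n /(_ n (leqnn n)) hn] : 0 <= cnorm a < 1 by rewrite a0 a1.
exists (\sum_(i < n) a ^+ i *: 'X^i) => z z1.
rewrite horner_sum (eq_bigr (fun i : 'I_n => (a * z) ^+ i)); last first.
  by move=> i _; rewrite hornerZ hornerXn exprMn.
apply: le_trans (geo_tail n (r := cnorm a) _ a1) _.
  by rewrite cnormM ler_piMr.
by rewrite ler_pdivrMr ?subr_gt0.
Qed.

Lemma mean_value_disc_alg f : disc_alg f -> mean_value f (f 0).
Proof.
move=> hf; apply: mean_value_approx => e e0; have [p hp] := hf _ e0.
exists (fun z => p.[z]), p`_0; split; last exact: mean_value_poly.
  by move=> z z1; apply: hp; rewrite z1.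
by rewrite cnormB -horner_coef0 hp// cnorm0.
Qed.

Lemma mean_value_mulz f : disc_alg f -> mean_value (fun z => z * f z) 0.
Proof.
by move=> hf; have := mean_value_disc_alg (disc_algM disc_alg_id hf); rewrite mul0r.
Qed.

(** Cauchy's formula. For [f = 1], the kernel is on the circle the conjugate of
    [(1 - conjc z0 * z)^-1], whose mean is its value 1 at the origin. A polynomial differs from its
    value at [z0] by a multiple of [z - z0], which cancels the pole and leaves [z] times a
    polynomial, of mean 0. *)
Lemma mean_value_cauchy f z0 : cnorm z0 < 1 -> disc_alg f ->
  mean_value (fun z => f z * (z / (z - z0))) (f z0).
Proof.
move=> z01 hf.
have K : mean_value (fun z => z / (z - z0)) 1.
  have h : disc_alg (fun z => (1 - conjc z0 * z)^-1).
    by apply: disc_alg_inv; rewrite cnormJ.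
  have := mean_value_conj (mean_value_disc_alg h).
  rewrite mulr0 subr0 invr1 conjc1; apply: eq_mean_value => z z1.
  have z0n : z != 0 by rewrite -cnorm_gt0 z1.
  rewrite fmorphV rmorphB rmorph1 rmorphM /= conjcK (conjc_unit z1).
  have h0 : z - z0 != 0.
    by rewrite subr_eq0; apply: cnorm_ne; rewrite z1 gt_eqF.
  by field; rewrite z0n h0.
apply: mean_value_approx => e e0.
(* On the circle [|z - z0|] is at least [1 - |z0|], so this tolerance for the polynomial survives
   division by [z - z0]. *)
have e1 : 0 < e * (1 - cnorm z0) by rewrite mulr_gt0// subr_gt0.
have [p hp] := hf _ e1.
exists (fun z => p.[z] * (z / (z - z0))), p.[z0]; split.
- move=> z z1; rewrite -mulrBl cnormM cnormf z1 mul1r.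
  have d : 1 - cnorm z0 <= cnorm (z - z0) by rewrite -{1}z1 lerB_cnorm.
  have d0 : 0 < cnorm (z - z0) by apply: lt_le_trans d; rewrite subr_gt0.
  by rewrite ler_pdivrMr// (le_trans (hp _ _)) ?z1// ler_wpM2l// ltW.
- rewrite (cnormB p.[z0]) (le_trans (hp _ (ltW z01)))// ler_piMr ?(ltW e0)//.
  by have := cnorm_ge0 z0; lra.
have /factor_theorem[q hq] : root (p - p.[z0]%:P) z0.
  by rewrite /root hornerD hornerN hornerC subrr.
have hz z : p.[z] = p.[z0] + q.[z] * (z - z0).
  have := congr1 (fun P : {poly R[i]} => P.[z]) hq.
  by rewrite hornerD hornerN hornerC hornerM hornerXsubC => <-; ring.
have := mean_valueD (mean_valueZ p.[z0] K) (mean_value_mulz (disc_alg_poly q)).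
rewrite mulr1 addr0; apply: eq_mean_value => z z1.
rewrite (hz z); have h0 : z - z0 != 0.
  by rewrite subr_eq0; apply: cnorm_ne; rewrite z1 gt_eqF.
by field.
Qed.

End RootsOfUnity.

(** * The extremal problem on the unit circle *)

Section Fejer.
Variable R : realType.

Lemma sum_ord_eq (J i : nat) : (i < J)%N ->
  \sum_(l < J) (i == l :> nat)%:R = 1 :> R.
Proof.
move=> iJ; rewrite (bigD1 (Ordinal iJ))//= eqxx big1 ?addr0// => l.
by rewrite -val_eqE eq_sym /= => /negPf ->.
Qed.

(** Counts the pairs on the diagonal ([J.+1] of them) and just beside it ([J] of them). Both kinds
    contribute the constant [c] in the next estimate, whereas only the diagonal contributes to the
    mass of the kernel: hence a gain of nearly 2. *)
Lemma sum_ord_succ (J : nat) :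
  \sum_(i < J.+1) \sum_(l < J.+1) ((i == l :> nat)%:R + (i.+1 == l :> nat)%:R)
    = 2 * J.+1%:R - 1 :> R.
Proof.
rewrite (eq_bigr (fun i : 'I_J.+1 => 1 + (i < J)%:R)); last first.
  move=> i _; rewrite big_split /= sum_ord_eq//; congr (_ + _).
  case: (ltnP i J) => h; first by rewrite sum_ord_eq.
  rewrite big1// => l _; case: eqP => // h2; have := ltn_ord l.
  by rewrite -h2 ltnS ltnNge h.
rewrite big_split /= sumr_const card_ord big_ord_recr /= ltnn addr0.
rewrite (eq_bigr (fun=> 1)); last by move=> i _; rewrite ltn_ord.
by rewrite sumr_const card_ord -[J.+1%:R]natr1; ring.
Qed.

Lemma unit_pow_split (v : R[i]) i l : cnorm v = 1 ->
  v ^+ i * conjc v ^+ l =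
    if (l <= i)%N then v ^+ (i - l) else conjc v ^+ (l - i).
Proof.
move=> v1; have vv : v * conjc v = 1 by rewrite mulcJ v1 expr1n.
case: ifP => [li|/negbT]; last rewrite -ltnNge => /ltnW il.
  by rewrite -{1}(subnK li) exprD -mulrA -exprMn vv expr1n mulr1.
by rewrite -{1}(subnK il) exprD mulrCA -exprMn vv expr1n mulr1.
Qed.

(* The test function is the Fejer kernel |1 + V + ... + V^(J-1)|^2 / J; the
   reflection [z |-> conjc z] turns the negative powers of V into nonnegative
   ones shifted by one, so the constant [c] is picked up from the powers 0 and
   -1. *)
Lemma fejer_bound N J (F V : R[i] -> R[i]) (sg : R[i] -> R) (L e1 e2 s : R)
    (c : R[i]) : 0 <= L -> 0 <= s ->
  (forall z, cnorm z = 1 -> cnorm (V z) = 1) ->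
  (forall z, cnorm z = 1 -> V (conjc z) = conjc (V z)) ->
  (forall z, cnorm z = 1 -> F (conjc z) = F z * conjc (V z)) ->
  (forall z, cnorm z = 1 -> cnorm (F z) <= L * sg z) ->
  cnorm (avg N F - c) <= e1 ->
  (forall j, (0 < j <= J)%N -> cnorm (avg N (fun z => F z * V z ^+ j)) <= e1) ->
  cnorm (avg N (fun z => real_complex R (sg z)) - real_complex R s) <= e2 ->
  (forall j, (0 < j <= J)%N ->
     cnorm (avg N (fun z => real_complex R (sg z) * V z ^+ j)) <= e2) ->
  (2 * J.+1%:R - 1) * cnorm c <=
    J.+1%:R ^+ 2 * e1 + L * (J.+1%:R * s + J.+1%:R ^+ 2 * e2).
Proof.
move=> L0 s0 hV1 hVc hFc hF h10 h1 h20 h2.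
pose S z := \sum_(i < J.+1) V z ^+ i.
have expand (G : R[i] -> R[i]) : avg N (fun z => G z * (S z * conjc (S z))) =
    \sum_(i < J.+1) \sum_(l < J.+1) avg N (fun z => G z * (V z ^+ i * conjc (V z) ^+ l)).
  rewrite -(eq_bigr _ (fun i _ => avg_sum _ _ _ _)) -avg_sum; apply: eq_avg => z z1.
  rewrite /S rmorph_sum mulr_suml mulr_sumr; apply: eq_bigr => i _.
  rewrite mulr_sumr mulr_sumr; apply: eq_bigr => l _; by rewrite rmorphXn.
have sum2 (x y : R) : \sum_(i < J.+1) \sum_(l < J.+1) (y * (i == l :> nat)%:R + x)
    = J.+1%:R * y + J.+1%:R ^+ 2 * x.
  rewrite (eq_bigr (fun=> y + J.+1%:R * x)); last first.
    move=> i _; rewrite big_split /= -mulr_sumr sum_ord_eq//.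
    by rewrite mulr1 sumr_const card_ord mulr_natl.
  by rewrite sumr_const card_ord -mulr_natl; ring.
have up : cnorm (avg N (fun z => F z * (S z * conjc (S z)))) <=
    L * (J.+1%:R * s + J.+1%:R ^+ 2 * e2).
  apply: le_trans (@le_cnorm_avg _ N _ (fun z => L * (sg z * cnorm (S z) ^+ 2)) _) _.
    move=> z z1; rewrite !cnormM cnormJ -expr2 mulrA ler_wpM2r ?sqr_ge0//.
    exact: hF.
  have -> : avg N (fun z => real_complex R (L * (sg z * cnorm (S z) ^+ 2))) =
      real_complex R L * avg N (fun z => real_complex R (sg z) * (S z * conjc (S z))).
    by rewrite -avgZ; apply: eq_avg => z z1; rewrite mulcJ !rmorphM.
  have ReZ (w : R[i]) : complex.Re (real_complex R L * w) = L * complex.Re w.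
    by case: w => a b /=; rewrite mul0r subr0.
  rewrite ReZ ler_wpM2l// (le_trans (Re_le_cnorm _))// expand.
  rewrite -(sum2 e2 s); apply: le_trans (ler_cnorm_sum _ _ _) _; apply: ler_sum => i _.
  apply: le_trans (ler_cnorm_sum _ _ _) _; apply: ler_sum => l _.
  rewrite (eq_avg _ (g := fun z => real_complex R (sg z) *
    if (l <= i)%N then V z ^+ (i - l) else conjc (V z) ^+ (l - i))); last first.
    by move=> z z1; rewrite unit_pow_split// hV1.
  have [li|il|il] := ltngtP l i.
  - rewrite mulr0 add0r; apply: h2.
    by rewrite subn_gt0 li /= (leq_trans (leq_subr _ _))// -ltnS.
  - rewrite mulr0 add0r.
    have -> : avg N (fun z => real_complex R (sg z) * conjc (V z) ^+ (l - i)) =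
        conjc (avg N (fun z => real_complex R (sg z) * V z ^+ (l - i))).
      rewrite -avg_conj; apply: eq_avg => z z1; rewrite rmorphM rmorphXn.
      by congr (_ * _); exact: esym (conjc_real _).
    rewrite cnormJ; apply: h2.
    by rewrite subn_gt0 il /= (leq_trans (leq_subr _ _))// -ltnS.
  - rewrite -il mulr1 subnn.
    have := ler_cnormD (avg N (fun z => real_complex R (sg z)) - real_complex R s)
      (real_complex R s).
    rewrite subrK cnorm_real ger0_norm// => h.
    rewrite (eq_avg _ (g := fun z => real_complex R (sg z))); first lra.
    by move=> z _; rewrite expr0 mulr1.
have low : cnorm (avg N (fun z => F z * (S z * conjc (S z))) -
    real_complex R (2 * J.+1%:R - 1) * c) <= J.+1%:R ^+ 2 * e1.
  rewrite expand -sum_ord_succ rmorph_sum mulr_suml -sumrB.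
  apply: le_trans (ler_cnorm_sum _ _ _) _.
  have := sum2 e1 0; rewrite mulr0 add0r => <-; apply: ler_sum => i _.
  rewrite rmorph_sum mulr_suml -sumrB.
  apply: le_trans (ler_cnorm_sum _ _ _) _; apply: ler_sum => l _.
  rewrite mul0r add0r rmorphD !rmorph_nat.
  rewrite (eq_avg _ (g := fun z => F z *
    if (l <= i)%N then V z ^+ (i - l) else conjc (V z) ^+ (l - i))); last first.
    by move=> z z1; rewrite unit_pow_split// hV1.
  have [li|il|il] := ltngtP l i.
  - rewrite (gtn_eqF (leqW li)) addr0 mul0r subr0; apply: h1.
    by rewrite subn_gt0 li /= (leq_trans (leq_subr _ _))// -ltnS.
  - rewrite add0r.
    have -> : avg N (fun z => F z * conjc (V z) ^+ (l - i)) =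
        avg N (fun z => F z * V z ^+ (l - i.+1)).
      rewrite -(avg_refl N (fun z => F z * V z ^+ (l - i.+1))); apply: eq_avg => z z1.
      by rewrite hFc// hVc// subnS -mulrA -exprS prednK// subn_gt0.
    have [<-|ne] := eqVneq i.+1 l.
      rewrite subnn mul1r (eq_avg _ (g := F))// => z _; by rewrite expr0 mulr1.
    rewrite mul0r subr0; apply: h1.
    have : (i.+1 < l)%N by rewrite ltn_neqAle ne il.
    by move=> h; rewrite subn_gt0 h /= (leq_trans (leq_subr _ _))// -ltnS.
  - rewrite -il (gtn_eqF (ltnSn _)) addr0 mul1r subnn.
    by rewrite (eq_avg _ (g := F))// => z _; rewrite expr0 mulr1.
set A := avg N _ in up low; set B := real_complex R _ * c in low.
have hB : cnorm B = (2 * J.+1%:R - 1) * cnorm c.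
  by rewrite cnormM cnorm_real ger0_norm// subr_ge0 -natrM ler1n.
have := lerB_cnorm B A; rewrite hB cnormB; lra.
Qed.

End Fejer.

(** * Blaschke factors and approximation of the identity by powers of one of them *)

Section Blaschke.
Variable R : realType.
Implicit Types a z : R[i].

Definition blaschke a z : R[i] := (z - a) / (1 - conjc a * z).

Lemma blaschke_den a z : cnorm a < 1 -> cnorm z <= 1 -> 1 - conjc a * z != 0.
Proof. by move=> a1 z1; apply: one_sub_neq0; rewrite ?cnormJ. Qed.

Lemma cnorm_sub_conj a z : cnorm z = 1 -> cnorm (1 - conjc a * z) = cnorm (z - a).
Proof.
move=> z1; have z0 : z != 0 by rewrite -cnorm_gt0 z1.
have -> : 1 - conjc a * z = z * conjc (z - a).
  rewrite rmorphB /= mulrBr mulcJ z1 expr1n [_ * conjc a]mulrC.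
  by congr (_ - _); rewrite rmorph1.
by rewrite cnormM z1 mul1r cnormJ.
Qed.

Lemma cnorm_blaschke1 a z : cnorm a < 1 -> cnorm z = 1 -> cnorm (blaschke a z) = 1.
Proof.
move=> a1 z1; rewrite /blaschke cnormf cnorm_sub_conj// divff//.
rewrite cnorm_eq0 subr_eq0; apply: cnorm_ne; by rewrite z1 gt_eqF.
Qed.

Lemma blaschke_sqr_defect a z : cnorm (1 - conjc a * z) ^+ 2 - cnorm (z - a) ^+ 2 =
  (1 - cnorm a ^+ 2) * (1 - cnorm z ^+ 2).
Proof.
by case: a => a b; case: z => x y; rewrite !cnorm_sqr /=; ring.
Qed.

Lemma cnorm_blaschke_lt1 a z : cnorm a < 1 -> cnorm z < 1 -> cnorm (blaschke a z) < 1.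
Proof.
move=> a1 z1; have h := blaschke_den a1 (ltW z1).
rewrite /blaschke cnormf ltr_pdivrMr ?cnorm_gt0// mul1r.
rewrite -(@ltr_pXn2r _ 2%N) ?nnegrE ?cnorm_ge0// -subr_gt0 blaschke_sqr_defect.
by rewrite mulr_gt0// subr_gt0 expr_lt1// cnorm_ge0.
Qed.

Lemma cnorm_blaschke_le1 a z : cnorm a < 1 -> cnorm z <= 1 -> cnorm (blaschke a z) <= 1.
Proof.
move=> a1; rewrite le_eqVlt => /orP[/eqP z1|z1]; first by rewrite cnorm_blaschke1.
exact: ltW (cnorm_blaschke_lt1 _ _).
Qed.

Lemma disc_alg_aff a : disc_alg (fun z => z - a).
Proof.
by apply: eq_disc_alg (disc_alg_poly ('X - a%:P)) => z _; rewrite hornerXsubC.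
Qed.

Lemma disc_alg_blaschke a : cnorm a < 1 -> disc_alg (blaschke a).
Proof.
by move=> a1; apply: disc_algM; [exact: disc_alg_aff|apply: disc_alg_inv; rewrite cnormJ].
Qed.

Lemma disc_alg_comp_poly f (p : {poly R[i]}) : disc_alg f -> disc_alg (fun z => p.[f z]).
Proof.
move=> hf; elim/poly_ind: p => [|p c IH].
  by apply: eq_disc_alg (disc_alg_cst 0) => z _; rewrite horner0.
apply: eq_disc_alg (disc_algD (disc_algM IH hf) (disc_alg_cst c)) => z _.
by rewrite hornerD hornerM hornerX hornerC.
Qed.

(* Partial sums of the expansion of [z] in powers of [blaschke a z]. *)
Definition unblaschke a p : {poly R[i]} :=
  ('X + a%:P) * \sum_(i < p) (- conjc a) ^+ i *: 'X^i.

Lemma unblaschkeE a p z : (unblaschke a p).[z] = (z + a) * \sum_(i < p) (- conjc a * z) ^+ i.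
Proof.
rewrite /unblaschke hornerM hornerD hornerX hornerC horner_sum; congr (_ * _).
by apply: eq_bigr => i _; rewrite hornerZ hornerXn exprMn.
Qed.

(** For [b = blaschke a z] one has [z = (b + a) / (1 + conjc a * b)], and the geometric series of
    the denominator converges uniformly on the closed disc because [|b| <= 1]. *)
Lemma unblaschke_approx a (d : R) : cnorm a < 1 -> 0 < d ->
  exists p, forall z, cnorm z <= 1 ->
    cnorm (z - (unblaschke a p).[blaschke a z]) <= d.
Proof.
move=> a1 d0; have a0 := cnorm_ge0 a.
(* The 2 pays for [|b + a| <= 2], the factor [1 - |a|] for the tail of the geometric series. *)
have e1 : 0 < d * (1 - cnorm a) / 2 by rewrite divr_gt0// mulr_gt0// subr_gt0.
have /expr_small/(_ e1)[p /(_ p (leqnn p)) hp] : 0 <= cnorm a < 1 by rewrite a0 a1.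
exists p => z z1; have hd := blaschke_den a1 z1.
have b1 := cnorm_blaschke_le1 a1 z1; set b := blaschke a z in b1 *.
have hb : 1 - (- conjc a * b) != 0 by apply: one_sub_neq0; rewrite ?cnormN ?cnormJ.
have -> : z - (unblaschke a p).[b] =
    (b + a) * ((1 - (- conjc a * b))^-1 - \sum_(i < p) (- conjc a * b) ^+ i).
  rewrite unblaschkeE mulrBr; congr (_ - _).
  apply: (mulIf hb); rewrite mulfVK//.
  by rewrite /b /blaschke; field.
rewrite cnormM.
have h1 : cnorm (b + a) <= 2 by have := ler_cnormD b a; lra.
have h2 := @geo_tail _ (- conjc a * b) (cnorm a) p.
have {}h2 := h2 _ a1.
apply: le_trans (ler_pM (cnorm_ge0 _) (cnorm_ge0 _) h1 (h2 _)) _.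
  by rewrite cnormM cnormN cnormJ ler_piMr.
rewrite mulrA ler_pdivrMr ?subr_gt0//; lra.
Qed.

(** The reversal of [unblaschke a p] in degree [p]. On the circle it is [b ^+ p] times the
    conjugate, so it is an analytic substitute for [b ^+ p * conjc z]. *)
Definition unblaschke_rev a p : {poly R[i]} :=
  (1 + conjc a *: 'X) * \sum_(i < p) (- a) ^+ i *: 'X^(p - i.+1).

Lemma unblaschke_revE a p b : cnorm b = 1 ->
  (unblaschke_rev a p).[b] = b ^+ p * conjc (unblaschke a p).[b].
Proof.
move=> b1; rewrite unblaschkeE /unblaschke_rev hornerM hornerD hornerZ hornerX hornerC.
have bb : b * conjc b = 1 by rewrite mulcJ b1 expr1n.
case: p => [|p]; first by rewrite big_ord0 [X in _ = _ * conjc (_ * X)]big_ord0 mulr0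
  rmorph0 mulr0 horner0 mulr0.
rewrite rmorphM rmorphD /= exprS.
have -> : b * b ^+ p * ((conjc b + conjc a) * conjc (\sum_(i < p.+1) (- conjc a * b) ^+ i))
  = (b * conjc b + conjc a * b) * (b ^+ p * conjc (\sum_(i < p.+1) (- conjc a * b) ^+ i)).
  by ring.
rewrite bb; congr (_ * _); rewrite horner_sum rmorph_sum mulr_sumr.
apply: eq_bigr => i _; rewrite hornerZ hornerXn rmorphXn rmorphM rmorphN /= conjcK.
rewrite subSS exprMn mulrCA; congr (_ * _).
have ip : (i <= p)%N by rewrite -ltnS.
have -> : b ^+ p = b ^+ (p - i) * b ^+ i by rewrite -exprD subnK.
by rewrite -mulrA -exprMn bb expr1n mulr1.
Qed.

Lemma cnorm_exprB_le (x y : R[i]) (d : R) j : cnorm x = 1 -> cnorm (x - y) <= d ->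
  d <= 1 -> cnorm (x ^+ j - y ^+ j) <= 2 ^+ j * d.
Proof.
move=> x1 xy d1; have d0 : 0 <= d := le_trans (cnorm_ge0 _) xy.
have y2 : cnorm y <= 2 by have := ler_cnormB x (x - y); rewrite subKr; lra.
elim: j => [|j IH]; first by rewrite !expr0 subrr cnorm0 mul1r.
have -> : x ^+ j.+1 - y ^+ j.+1 = x * (x ^+ j - y ^+ j) + (x - y) * y ^+ j.
  by rewrite !exprS; ring.
rewrite (le_trans (ler_cnormD _ _))// !cnormM x1 mul1r cnormX.
have h : cnorm (x - y) * cnorm y ^+ j <= d * 2 ^+ j.
  by apply: ler_pM; rewrite ?cnorm_ge0 ?exprn_ge0 ?cnorm_ge0// lerXn2r ?nnegrE ?cnorm_ge0.
by rewrite exprS; lra.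
Qed.

End Blaschke.

(** * Lower bound for the extremal problem *)

Section Lower.
Variable R : realType.
Variables (z0 a : R[i]) (d : nat) (W0 W0r : {poly R[i]}).
Hypothesis z0J : conjc z0 = - z0.
Hypothesis z0_lt1 : cnorm z0 < 1.
Hypothesis a_lt1 : cnorm a < 1.
Hypothesis W0J : forall z, conjc W0.[z] = W0.[conjc z].
Hypothesis W0rE : forall z, cnorm z = 1 -> W0r.[z] = z ^+ d * conjc W0.[z].
Hypothesis W0_neq0 : forall z, cnorm z <= 1 -> W0.[z] != 0.
Hypothesis W0_inv : disc_alg (fun z => W0.[z]^-1).

(** The function [W] of the overview. Its [m]th power will come from the denominators of
    [u = A / D], moved so that all zeros lie outside the closed disc. *)
Definition outer m z : R[i] := ((1 - a * z) * (1 - conjc a * z)) ^+ m * W0.[z].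

Lemma outerJ m z : conjc (outer m z) = outer m (conjc z).
Proof.
by rewrite /outer !conjcE W0J; congr (_ ^+ _ * _); rewrite mulrC.
Qed.

Lemma outer_neq0 m z : cnorm z <= 1 -> outer m z != 0.
Proof.
move=> z1; rewrite mulf_neq0 ?W0_neq0// expf_neq0// mulf_neq0//.
  exact: one_sub_neq0.
exact: blaschke_den.
Qed.

Lemma disc_alg_outer_inv m : disc_alg (fun z => (outer m z)^-1).
Proof.
have h1 := disc_alg_inv a_lt1.
have h2 : disc_alg (fun z => (1 - conjc a * z)^-1) by apply: disc_alg_inv; rewrite cnormJ.
apply: eq_disc_alg (disc_algM (disc_algX m (disc_algM h1 h2)) W0_inv) => z _.
by rewrite /outer invfM -exprVn invfM.
Qed.

Definition zblaschke z := blaschke z0 z * blaschke (- z0) z.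
(** The unimodular function relating [test_fun] at [z] and at [conjc z]. The quotient with [outer]
    comes from self-reciprocity and is an inner function; the last two factors come from the
    rational factors of [test_fun]. Only [conjc z ^+ 2] fails to be analytic. *)
Definition phase m z := z ^+ (2 * m + d) * conjc (outer m z) / outer m z * conjc z ^+ 2 * zblaschke z.

(** The inner factor of [phase] contains [blaschke a z ^+ m]. Spending [2 * p] of these powers turns
    the approximation of [conjc z ^+ 2] into the square of [unblaschke_rev], and the result is
    analytic in the disc. *)
Definition phase_approx m p z := blaschke (conjc a) z ^+ m * blaschke a z ^+ (m - 2 * p) *
  (unblaschke_rev a p).[blaschke a z] ^+ 2 * (W0r.[z] / W0.[z]) * zblaschke z.

Let Nz0_lt1 : cnorm (- z0) < 1. Proof. by rewrite cnormN. Qed.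
Let aJ_lt1 : cnorm (conjc a) < 1. Proof. by rewrite cnormJ. Qed.

Lemma zblaschkeE z : cnorm z <= 1 -> zblaschke z = (z ^+ 2 - z0 ^+ 2) / (1 - z0 ^+ 2 * z ^+ 2).
Proof.
move=> z1; have := blaschke_den z0_lt1 z1; have := blaschke_den Nz0_lt1 z1.
rewrite /zblaschke /blaschke conjcN z0J !opprK => h1 h2.
have -> : 1 - z0 ^+ 2 * z ^+ 2 = (1 - z0 * z) * (1 - - z0 * z) by ring.
by field; rewrite h1 h2.
Qed.

Lemma zblaschkeJ z : cnorm z = 1 -> zblaschke (conjc z) = conjc (zblaschke z).
Proof.
move=> z1; by rewrite !zblaschkeE ?cnormJ ?z1// !conjcE z0J sqrrN.
Qed.

Lemma cnorm_zblaschke z : cnorm z = 1 -> cnorm (zblaschke z) = 1.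
Proof. by move=> z1; rewrite cnormM !cnorm_blaschke1// mulr1. Qed.

Lemma cnorm_phase m z : cnorm z = 1 -> cnorm (phase m z) = 1.
Proof.
move=> z1; rewrite /phase cnormM cnorm_zblaschke// mulr1 cnormM cnormX cnormJ z1 expr1n mulr1.
rewrite cnormf cnormM cnormX cnormJ z1 expr1n mul1r.
by rewrite divff// cnorm_eq0 outer_neq0// z1.
Qed.

Lemma phaseJ m z : cnorm z = 1 -> phase m (conjc z) = conjc (phase m z).
Proof. by move=> z1; rewrite /phase zblaschkeJ// -outerJ !conjcE. Qed.

Lemma inner_outer m z : cnorm z = 1 ->
  z ^+ (2 * m + d) * conjc (outer m z) / outer m z =
  (blaschke a z * blaschke (conjc a) z) ^+ m * (W0r.[z] / W0.[z]).
Proof.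
move=> z1; have z0n : z != 0 by rewrite -cnorm_gt0 z1.
rewrite W0rE// exprD exprM /outer !conjcE.
have h1 : 1 - a * z != 0 by apply: one_sub_neq0; rewrite ?z1.
have h2 : 1 - conjc a * z != 0 by apply: blaschke_den; rewrite ?z1.
have h3 : W0.[z] != 0 by apply: W0_neq0; rewrite z1.
have -> : blaschke a z * blaschke (conjc a) z =
   (z ^+ 2 * ((1 - conjc a * conjc z) * (1 - a * conjc z))) /
   ((1 - a * z) * (1 - conjc a * z)).
  rewrite /blaschke conjcK (conjc_unit z1); field.
  by rewrite z0n h1 h2.
rewrite !exprMn exprVn !exprMn; field.
by rewrite h3 !expf_neq0.
Qed.

(** The zeros at [z0] and [- z0], inherited from [zblaschke], will cancel the pole of the Cauchy
    kernel in [test_fun] and the poles of [sigma]. *)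
Lemma disc_alg_phase_approx m p : exists2 G, disc_alg G &
  forall z, cnorm z <= 1 -> phase_approx m p z = (z ^+ 2 - z0 ^+ 2) * G z.
Proof.
have h1 : disc_alg (fun z => (1 - conjc z0 * z)^-1) by apply: disc_alg_inv; rewrite cnormJ.
have h2 : disc_alg (fun z => (1 - conjc (- z0) * z)^-1) by apply: disc_alg_inv; rewrite cnormJ.
have hb := disc_alg_blaschke a_lt1; have hb' := disc_alg_blaschke aJ_lt1.
exists (fun z => (blaschke (conjc a) z ^+ m * blaschke a z ^+ (m - 2 * p) *
  (unblaschke_rev a p).[blaschke a z] ^+ 2 * (W0r.[z] * W0.[z]^-1)) *
  ((1 - conjc z0 * z)^-1 * (1 - conjc (- z0) * z)^-1)).
  apply: disc_algM (disc_algM h1 h2); apply: disc_algM.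
    apply: disc_algM; last by apply: disc_algX; exact: disc_alg_comp_poly.
    by apply: disc_algM; exact: disc_algX.
  exact: disc_algM (disc_alg_poly _) W0_inv.
move=> z z1; rewrite /phase_approx /zblaschke /blaschke; ring.
Qed.

Lemma phase_approxP m p z (e : R) : (2 * p <= m)%N -> cnorm z = 1 -> 0 <= e <= 1 ->
  cnorm (z - (unblaschke a p).[blaschke a z]) <= e ->
  cnorm (phase m z - phase_approx m p z) <= 3 * e.
Proof.
move=> pm z1 /andP[e0 e1] he; have b1 := cnorm_blaschke1 a_lt1 z1.
set b := blaschke a z in b1 he *; set t := (unblaschke a p).[b] in he *.
rewrite /phase /phase_approx inner_outer// unblaschke_revE// -/b -/t.
have -> : (b * blaschke (conjc a) z) ^+ m * (W0r.[z] / W0.[z]) * conjc z ^+ 2 * zblaschke z -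
    blaschke (conjc a) z ^+ m * b ^+ (m - 2 * p) *
      (b ^+ p * conjc t) ^+ 2 * (W0r.[z] / W0.[z]) * zblaschke z =
    (b * blaschke (conjc a) z) ^+ m * (W0r.[z] / W0.[z]) * zblaschke z *
      conjc ((z - t) * (z + t)).
  rewrite !conjcE.
  have -> : (b * blaschke (conjc a) z) ^+ m =
     b ^+ (m - 2 * p) * b ^+ (2 * p) * blaschke (conjc a) z ^+ m.
    by rewrite -exprD subnK// exprMn.
  rewrite mulnC [b ^+ (p * 2)]exprM; ring.
rewrite cnormM cnormJ [cnorm (_ * zblaschke z)]cnormM cnorm_zblaschke// mulr1.
rewrite [cnorm (_ ^+ m * _)]cnormM cnormX cnormM b1 cnorm_blaschke1// mulr1 expr1n mul1r.
rewrite cnormf W0rE// cnormM cnormX z1 expr1n mul1r cnormJ divff ?mul1r; last first.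
  by rewrite cnorm_eq0 W0_neq0// z1.
rewrite cnormM [leRHS]mulrC; apply: ler_pM; rewrite ?cnorm_ge0//.
(* The error is [|z - t| * |z + t|], and [|z + t| <= 2 + e <= 3]. *)
have -> : z + t = 2 * z - (z - t) by ring.
rewrite (le_trans (ler_cnormB _ _))// cnormM z1 mulr1 cnorm_nat; lra.
Qed.

Let s0 : R := cnorm z0 ^+ 2.
(** A Poisson kernel in the variable [z ^+ 2], up to the factor [1 - s0 ^+ 2]. *)
Definition sigma z : R := (cnorm (1 - z0 ^+ 2 * z ^+ 2) ^+ 2)^-1.

Let z0sq : z0 ^+ 2 = - real_complex R s0.
Proof. by rewrite /s0 -mulcJ z0J mulrN opprK expr2. Qed.

Let s0_ge0 : 0 <= s0. Proof. exact: sqr_ge0. Qed.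
Let s0_lt1 : s0 < 1. Proof. by rewrite /s0 expr_lt1// cnorm_ge0. Qed.

Lemma sigmaE z : cnorm z = 1 ->
  real_complex R (sigma z) = z ^+ 2 / ((1 - z0 ^+ 2 * z ^+ 2) * (z ^+ 2 - z0 ^+ 2)).
Proof.
move=> z1; have zn : z != 0 by rewrite -cnorm_gt0 z1.
have h0 : cnorm (z0 ^+ 2) < 1 by rewrite cnormX.
have h1 : 1 - z0 ^+ 2 * z ^+ 2 != 0 by apply: one_sub_neq0; rewrite // cnormX z1 expr1n.
have hJ : conjc (1 - z0 ^+ 2 * z ^+ 2) = (z ^+ 2 - z0 ^+ 2) / z ^+ 2.
  rewrite !conjcE z0J (conjc_unit z1).
  by field.
rewrite /sigma fmorphV /= -mulcJ hJ.
have h2 : z ^+ 2 - z0 ^+ 2 != 0.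
  by have : conjc (1 - z0 ^+ 2 * z ^+ 2) != 0 by [rewrite conjc_eq0];
     rewrite hJ mulf_eq0 negb_or => /andP[].
by field; rewrite exprMn zn h1 h2.
Qed.

Lemma sigma_le z : cnorm z = 1 -> sigma z <= (1 - s0)^-2.
Proof.
move=> z1; have h : 1 - s0 <= cnorm (1 - z0 ^+ 2 * z ^+ 2).
  have := lerB_cnorm 1 (z0 ^+ 2 * z ^+ 2).
  by rewrite cnorm1 cnormM !cnormX z1 expr1n mulr1.
rewrite /sigma -exprVn -[X in _ <= X]exprVn lerXn2r ?nnegrE ?invr_ge0 ?cnorm_ge0 ?subr_ge0 ?(ltW s0_lt1)//.
by rewrite lef_pV2 ?posrE ?subr_gt0//; apply: lt_le_trans h; rewrite subr_gt0.
Qed.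

(** With [h = (1 - z0 ^+ 2 * z ^+ 2)^-1], of mean 1, one has
    [(1 - s0 ^+ 2) * sigma = h + conjc h - 1] on the circle. *)
Lemma mean_value_sigma :
  mean_value (fun z => real_complex R (sigma z)) (real_complex R (1 - s0 ^+ 2)^-1).
Proof.
have h0 : cnorm (z0 ^+ 2) < 1 by rewrite cnormX.
have hs : 1 - real_complex R s0 ^+ 2 != 0.
  rewrite -rmorphXn -(rmorph1 (real_complex R)) -rmorphB /= fmorph_eq0.
  by rewrite subr_eq0 eq_sym lt_eqF// expr_lt1.
have h : mean_value (fun z => (1 - z0 ^+ 2 * z ^+ 2)^-1) 1.
  have := @disc_alg_inv R _ h0 => hi.
  have hc : disc_alg (fun z => (1 - z0 ^+ 2 * z ^+ 2)^-1).
    move=> e /hi[p hp]; exists (p \Po 'X^2) => z z1.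
    rewrite horner_comp hornerXn; apply: hp.
    by rewrite cnormX exprn_ile1 ?cnorm_ge0.
  have := mean_value_disc_alg hc.
  by rewrite expr0n mulr0 subr0 invr1.
have := mean_valueZ (1 - real_complex R s0 ^+ 2)^-1
  (mean_valueD (mean_valueD h (mean_value_conj h)) (mean_value_cst (-1))).
rewrite rmorph1 addrK mulr1.
have -> : real_complex R (1 - s0 ^+ 2)^-1 = (1 - real_complex R s0 ^+ 2)^-1.
  by rewrite fmorphV rmorphB rmorph1 rmorphXn.
apply: eq_mean_value => z z1; rewrite sigmaE//.
have zn : z != 0 by rewrite -cnorm_gt0 z1.
have h1 : 1 - z0 ^+ 2 * z ^+ 2 != 0 by apply: one_sub_neq0; rewrite // cnormX z1 expr1n.
have hJ : conjc (1 - z0 ^+ 2 * z ^+ 2) = (z ^+ 2 - z0 ^+ 2) / z ^+ 2.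
  rewrite !conjcE z0J (conjc_unit z1).
  by field.
have h2 : z ^+ 2 - z0 ^+ 2 != 0.
  by have : conjc (1 - z0 ^+ 2 * z ^+ 2) != 0 by [rewrite conjc_eq0];
     rewrite hJ mulf_eq0 negb_or => /andP[].
rewrite fmorphV /= hJ; move: h1 h2; rewrite z0sq opprK mulNr opprK => h1 h2.
by field; rewrite ?exprMn zn h1 h2 hs.
Qed.

(** One factor [phase_approx] cancels the denominator [z ^+ 2 - z0 ^+ 2] of [sigma]; a multiple of
    [z] by an analytic function remains. *)
Lemma mean_value_sigma_phase m p j : (0 < j)%N ->
  mean_value (fun z => real_complex R (sigma z) * phase_approx m p z ^+ j) 0.
Proof.
case: j => // j _; have [G hG hVt] := disc_alg_phase_approx m p.
have h0 : cnorm (z0 ^+ 2) < 1 by rewrite cnormX.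
have hc : disc_alg (fun z => (1 - z0 ^+ 2 * z ^+ 2)^-1).
  move=> e /(@disc_alg_inv R _ h0)[q hq]; exists (q \Po 'X^2) => z z1.
  by rewrite horner_comp hornerXn; apply: hq; rewrite cnormX exprn_ile1 ?cnorm_ge0.
have hsub : disc_alg (fun z => z ^+ 2 - z0 ^+ 2).
  apply: eq_disc_alg (disc_alg_poly ('X^2 - (z0 ^+ 2)%:P)) => z _.
  by rewrite !hornerE.
have := mean_value_mulz (disc_algM (@disc_alg_id R) (disc_algM hc
  (disc_algM hG (disc_algX j (disc_algM hsub hG))))).
apply: eq_mean_value => z z1; rewrite sigmaE// [phase_approx m p z ^+ _]exprS hVt ?z1//.
have h1 : 1 - z0 ^+ 2 * z ^+ 2 != 0 by apply: one_sub_neq0; rewrite // cnormX z1 expr1n.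
have h2 : z ^+ 2 - z0 ^+ 2 != 0.
  rewrite subr_eq0; apply: cnorm_ne; rewrite !cnormX z1 expr1n gt_eqF//.
by rewrite exprMn; field; rewrite ?exprMn h1 h2.
Qed.

Section Fixed.
Variables (m : nat) (Q : {poly R[i]}) (L : R).
Hypothesis QJ : forall z, cnorm z = 1 -> Q.[conjc z] = conjc z ^+ (2 * m + d) * Q.[z].
Hypothesis L_ge0 : 0 <= L.
Hypothesis QL : forall z, cnorm z = 1 -> cnorm Q.[z] <= L * cnorm (outer m z).

(** The square [(1 - z0 * z) ^+ 2] is the shape of the extremal function. The factor [1 + z0 * z]
    has on the circle the modulus of [z - z0], so that [|test_fun|] is exactly
    [|Q / outer| * sigma]. *)
Definition cauchy_num z := Q.[z] / outer m z / ((1 - z0 * z) ^+ 2 * (1 + z0 * z)).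
Definition test_fun z := cauchy_num z * (z / (z - z0)).

Let dp z : cnorm z <= 1 -> 1 + z0 * z != 0.
Proof. by move=> z1; have := blaschke_den z0_lt1 z1; rewrite z0J mulNr opprK. Qed.
Let dm z : cnorm z <= 1 -> 1 - z0 * z != 0.
Proof. exact: one_sub_neq0. Qed.

Lemma disc_alg_cauchy_num : disc_alg cauchy_num.
Proof.
have h1 : disc_alg (fun z => (1 - z0 * z)^-1) by apply: disc_alg_inv.
have h2 : disc_alg (fun z => (1 - - z0 * z)^-1) by apply: disc_alg_inv.
apply: eq_disc_alg (disc_algM (disc_algM (disc_alg_poly Q) (disc_alg_outer_inv m))
  (disc_algM (disc_algX 2 h1) h2)) => z _.
by rewrite /cauchy_num exprVn -invfM mulNr opprK.
Qed.

Lemma test_fun_le z : cnorm z = 1 -> cnorm (test_fun z) <= L * sigma z.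
Proof.
move=> z1; have hd : cnorm (z - z0) = cnorm (1 + z0 * z).
  by rewrite -cnorm_sub_conj// z0J mulNr opprK.
have n1 : cnorm (1 + z0 * z) != 0 by rewrite cnorm_eq0 dp// z1.
have n2 : cnorm (1 - z0 * z) != 0 by rewrite cnorm_eq0 dm// z1.
have n3 : cnorm (outer m z) != 0 by rewrite cnorm_eq0 outer_neq0// z1.
have -> : cnorm (test_fun z) = cnorm Q.[z] / cnorm (outer m z) * sigma z.
  have -> : sigma z = ((cnorm (1 - z0 * z) * cnorm (1 + z0 * z)) ^+ 2)^-1.
    rewrite /sigma -cnormM; congr ((cnorm _ ^+ _)^-1); ring.
  rewrite /test_fun /cauchy_num; move: (outer m z) n3 => w n3.
  rewrite !(cnormf, cnormM, cnormX) hd z1; field.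
  by rewrite n1 n2 n3.
rewrite ler_wpM2r ?invr_ge0 ?sqr_ge0// ler_pdivrMr ?QL//.
by rewrite lt_neqAle eq_sym n3 cnorm_ge0.
Qed.

Lemma test_funJ z : cnorm z = 1 -> test_fun (conjc z) = test_fun z * conjc (phase m z).
Proof.
move=> z1; have zn : z != 0 by rewrite -cnorm_gt0 z1.
have z1' : cnorm z <= 1 by rewrite z1.
have zJ1 : cnorm (conjc z) <= 1 by rewrite cnormJ.
have n1 := dp z1'; have n2 := dm z1'; have n3 := dp zJ1; have n4 := dm zJ1.
have n5 : z - z0 != 0 by rewrite subr_eq0; apply: cnorm_ne; rewrite z1 gt_eqF.
have n6 : conjc z - z0 != 0.
  by rewrite subr_eq0; apply: cnorm_ne; rewrite cnormJ z1 gt_eqF.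
have n7 := outer_neq0 m z1'; have n8 : conjc (outer m z) != 0 by rewrite conjc_eq0.
rewrite /phase /test_fun /cauchy_num zblaschkeE// QJ// -outerJ.
move: (outer m z) n7 n8 => w n7 n8; rewrite !conjcE z0J sqrrN; move: n3 n4 n6; rewrite (conjc_unit z1) => n3 n4 n6.
set w' := conjc w in n8 *.
have n3' : z + z0 != 0.
  by move: n3; apply: contra_neq => h; rewrite -(divff zn) -mulrDl h mul0r.
have n4' : z - z0 != 0 by [].
have n9 : 1 - z0 ^+ 2 / z ^+ 2 != 0.
  have -> : 1 - z0 ^+ 2 / z ^+ 2 = (1 - z0 * z^-1) * (1 + z0 * z^-1) by field.
  by rewrite mulf_neq0.
have n10 : z ^+ (2 * m + d) != 0 by rewrite expf_neq0.
rewrite exprVn; set Z := z ^+ (2 * m + d) in n10 *.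
have n11 : 1 - z0 * z != 0 by [].
have e1 : 1 - z0 * z^-1 = (z - z0) / z by field.
have e2 : 1 + z0 * z^-1 = (z + z0) / z by field.
have e3 : z^-1 - z0 = (1 - z0 * z) / z by field.
have e4 : 1 - z0 ^+ 2 * z^-1 ^+ 2 = (z - z0) * (z + z0) / z ^+ 2 by field.
have e5 : z^-1 ^+ 2 - z0 ^+ 2 = (1 - z0 * z) * (1 + z0 * z) / z ^+ 2 by field.
rewrite e1 e2 e3 e4 e5; field.
by rewrite ?zn ?n1 ?n2 ?n3' ?n4' ?n5 ?n7 ?n8 ?n10.
Qed.

Let c : R[i] := cauchy_num z0.

(** [fejer_bound] for [test_fun], [phase] and [sigma]. The means against powers of [phase_approx]
    tend to 0, and passing to [phase] costs at most [2 ^+ J * (3 * e)] times a bound for the other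
    factor. *)
Lemma fejer_outer J (e : R) p : (2 * p <= m)%N -> 0 <= e -> 3 * e <= 1 ->
  (forall z, cnorm z <= 1 -> cnorm (z - (unblaschke a p).[blaschke a z]) <= e) ->
  (2 * J.+1%:R - 1) * cnorm c <=
  L * (J.+1%:R / (1 - s0 ^+ 2) + 2 * J.+1%:R ^+ 2 * (2 ^+ J * (3 * e) * (1 - s0) ^- 2)).
Proof.
move=> pm e0 e1 he.
have [S0 S0E] : {S0 : R | S0 = (1 - s0) ^- 2} by exists ((1 - s0) ^- 2).
rewrite -S0E; have S0_ge0 : 0 <= S0 by rewrite S0E invr_ge0 sqr_ge0.
have [C CE] : {C | C = 2 ^+ J * (3 * e) * S0} by exists (2 ^+ J * (3 * e) * S0).
have C0 : 0 <= C by rewrite CE !mulr_ge0// exprn_ge0.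
rewrite -CE.
have s1 : 0 <= (1 - s0 ^+ 2)^-1 by rewrite invr_ge0 subr_ge0 exprn_ile1// ltW.
(* Finite means reach their limits only up to [eta]; it is sent to 0 at the end, with [J], [e] and
   [p] fixed. *)
have key (eta : R) : 0 < eta -> (2 * J.+1%:R - 1) * cnorm c <=
    J.+1%:R ^+ 2 * (L * C + eta) +
    L * (J.+1%:R * (1 - s0 ^+ 2)^-1 + J.+1%:R ^+ 2 * (C + eta)).
  move=> eta0.
  have [NF hNF] := mean_value_cauchy z0_lt1 disc_alg_cauchy_num eta0.
  have [NS hNS] := mean_value_sigma eta0.
  have hFj j : exists N0 : nat, forall N, (N0 <= N)%N -> (0 < j)%N ->
      cnorm (avg N.+1 (fun z => test_fun z * phase_approx m p z ^+ j)) <= eta.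
    case: j => [|j]; first by exists 0%N.
    have [G hG hVt] := disc_alg_phase_approx m p.
    have hsub : disc_alg (fun z => z ^+ 2 - z0 ^+ 2).
      apply: eq_disc_alg (disc_alg_poly ('X^2 - (z0 ^+ 2)%:P)) => z _.
      by rewrite !hornerE.
    have hadd : disc_alg (fun z => z + z0).
      by apply: eq_disc_alg (disc_alg_poly ('X + z0%:P)) => z _; rewrite !hornerE.
    have := mean_value_mulz (disc_algM disc_alg_cauchy_num (disc_algM hadd
      (disc_algM hG (disc_algX j (disc_algM hsub hG))))).
    move=> /(_ _ eta0)[N0 H]; exists N0 => N /H; rewrite subr0 => hN _.
    apply: le_trans hN; rewrite le_eqVlt; apply/orP; left; apply/eqP; congr cnorm.
    apply: eq_avg => z z1; rewrite [phase_approx m p z ^+ _]exprS hVt ?z1// /test_fun.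
    have n5 : z - z0 != 0 by rewrite subr_eq0; apply: cnorm_ne; rewrite z1 gt_eqF.
    by rewrite subr_sqr; field.
  have hSj j : exists N0 : nat, forall N, (N0 <= N)%N -> (0 < j)%N ->
      cnorm (avg N.+1 (fun z => real_complex R (sigma z) * phase_approx m p z ^+ j)) <= eta.
    case: j => [|j]; first by exists 0%N.
    have [N0 H] := mean_value_sigma_phase m p (ltn0Sn j) eta0.
    by exists N0 => N /H; rewrite subr0.
  pose NF' j := projT1 (cid (hFj j)); pose NS' j := projT1 (cid (hSj j)).
  (* One number of nodes must serve all exponents up to [J]: the sum of the finitely many thresholds
     is large enough. *)
  have [N [NF1 NS1 NF1' NS1']] : exists N, [/\ (NF <= N)%N, (NS <= N)%N,
      forall j, (j <= J)%N -> (NF' j <= N)%N & forall j, (j <= J)%N -> (NS' j <= N)%N].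
    exists (NF + NS + \sum_(j < J.+1) NF' j + \sum_(j < J.+1) NS' j)%N; split => [||j jJ|j jJ].
    - by rewrite -!addnA leq_addr.
    - by rewrite -!addnA addnCA leq_addr.
    - have : (NF' j <= \sum_(j < J.+1) NF' j)%N.
        by rewrite (bigD1 (Ordinal (leq_ltn_trans jJ (ltnSn J))))//= leq_addr.
      by move=> h; rewrite (leq_trans h)// addnAC leq_addl.
    - have : (NS' j <= \sum_(j < J.+1) NS' j)%N.
        by rewrite (bigD1 (Ordinal (leq_ltn_trans jJ (ltnSn J))))//= leq_addr.
      by move=> h; rewrite (leq_trans h)// leq_addl.
  have hpow z j : cnorm z = 1 -> (j <= J)%N ->
      cnorm (phase m z ^+ j - phase_approx m p z ^+ j) <= 2 ^+ J * (3 * e).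
    move=> z1 jJ; have z1' : cnorm z <= 1 by rewrite z1.
    have h3 : cnorm (phase m z - phase_approx m p z) <= 3 * e.
      by apply: phase_approxP => //; [lra|exact: he].
    apply: le_trans (cnorm_exprB_le j (cnorm_phase m z1) h3 e1) _.
    by rewrite ler_wpM2r ?mulr_ge0// ler_eXn2l// ltr1n.
  have split_avg (G : R[i] -> R[i]) (D : R) j : (j <= J)%N ->
      (forall z, cnorm z = 1 -> cnorm (G z) <= D * S0) -> 0 <= D ->
      cnorm (avg N.+1 (fun z => G z * phase_approx m p z ^+ j)) <= eta ->
      cnorm (avg N.+1 (fun z => G z * phase m z ^+ j)) <= D * C + eta.
    move=> jJ hG D0 hA.
    have -> : avg N.+1 (fun z => G z * phase m z ^+ j) =
        avg N.+1 (fun z => G z * (phase m z ^+ j - phase_approx m p z ^+ j)) +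
        avg N.+1 (fun z => G z * phase_approx m p z ^+ j).
      by rewrite -avgD; apply: eq_avg => z _; ring.
    rewrite (le_trans (ler_cnormD _ _))// lerD//.
    apply: le_cnorm_avg_cst => // z z1; rewrite cnormM.
    apply: le_trans (ler_pM (cnorm_ge0 _) (cnorm_ge0 _) (hG z z1) (hpow z j z1 jJ)) _.
    by rewrite CE; lra.
  apply: (@fejer_bound _ N.+1 J test_fun (phase m) sigma L) => //.
  - exact: cnorm_phase.
  - exact: phaseJ.
  - exact: test_funJ.
  - exact: test_fun_le.
  - apply: le_trans (hNF N NF1) _; by rewrite lerDr mulr_ge0.
  - move=> j /andP[j0 jJ]; apply: split_avg => //.
      move=> z z1; rewrite (le_trans (test_fun_le z1))// ler_wpM2l//.
      by rewrite S0E; exact: sigma_le.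
    by have := projT2 (cid (hFj j)) N; apply => //; exact: NF1'.
  - apply: le_trans (hNS N NS1) _; by rewrite lerDr.
  - move=> j /andP[j0 jJ]; rewrite -[C]mul1r; apply: split_avg => //.
      move=> z z1; rewrite cnorm_real mul1r S0E ger0_norm ?sigma_le//.
      by rewrite /sigma invr_ge0 sqr_ge0.
    by have := projT2 (cid (hSj j)) N; apply => //; exact: NS1'.
set A := _ * cnorm c; set B := J.+1%:R ^+ 2 : R.
have hB : 0 < B * (1 + L) by rewrite mulr_gt0 ?ltr_wpDr// exprn_gt0.
apply/ler_addgt0Pr => x x0.
have := key (x / (B * (1 + L))) (divr_gt0 x0 hB); rewrite -/A -/B => h.
apply: le_trans h _; rewrite le_eqVlt; apply/orP; left; apply/eqP.
field; move: hB; rewrite !lt_neqAle eq_sym mulf_eq0 negb_or.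
move=> /andP[/andP[-> ->] _]; rewrite !andbT subr_eq0 eq_sym lt_eqF// expr_lt1//.
Qed.

End Fixed.

(** Dividing [fejer_outer] by [2 J + 1], the main term tends to [L / (2 (1 - s0 ^+ 2))], while
    [cauchy_num] at [z0] has the denominator [(1 + s0) ^+ 2 * (1 - s0)]; the quotient leaves
    [L (1 + s0) / 2]. The error contains [2 ^+ J * e] and [p] depends on [e], so the choices are
    made in the order [J], [e], [p], and [m] is at least [2 * p]. *)
Lemma outer_lower_bound (eps : R) : 0 < eps ->
  exists m0, forall m (Q : {poly R[i]}) (L : R), (m0 <= m)%N ->
    (forall z, cnorm z = 1 -> Q.[conjc z] = conjc z ^+ (2 * m + d) * Q.[z]) ->
    0 <= L -> (forall z, cnorm z = 1 -> cnorm Q.[z] <= L * cnorm (outer m z)) ->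
  cnorm Q.[z0] <= L * cnorm (outer m z0) * ((1 + cnorm z0 ^+ 2) / 2 + eps).
Proof.
move=> eps0; rewrite -/s0.
have [J hJ] : exists J : nat, 2 <= J.+1%:R * eps.
  exists (Num.truncn (2 / eps)); rewrite -ler_pdivrMr// ltW//.
  by rewrite truncnS_gt// divr_ge0// ltW.
set S0 := (1 - s0) ^- 2.
have S0_gt0 : 0 < S0 by rewrite invr_gt0 exprn_gt0// subr_gt0.
(* Chosen so that the error term of [fejer_outer] is [L * (E * e / 2)]. *)
pose E := 12 * J.+1%:R ^+ 2 * 2 ^+ J * S0.
have E0 : 0 < E by rewrite !mulr_gt0 ?exprn_gt0.
have [e [e0 e3 eE]] : exists e, [/\ 0 < e, 3 * e <= 1 & E * e <= eps / 2].
  exists (Num.min (1 / 3) (eps / (2 * E))); split.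
  - by rewrite lt_min; apply/andP; split; [lra|rewrite divr_gt0// mulr_gt0].
  - have : Num.min (1 / 3) (eps / (2 * E)) <= 1 / 3 by rewrite ge_min lexx.
    lra.
  - have : Num.min (1 / 3) (eps / (2 * E)) <= eps / (2 * E) by rewrite ge_min lexx orbT.
    rewrite ler_pdivlMr ?mulr_gt0//; lra.
have [p hp] := unblaschke_approx a_lt1 e0.
exists (2 * p)%N => m Q L pm QJ L0 QL.
have := fejer_outer (m := m) QJ L0 QL J pm (ltW e0) e3 hp.
have z01 := ltW z0_lt1.
have on : cnorm (outer m z0) != 0 by rewrite cnorm_eq0 outer_neq0.
have -> : cnorm (cauchy_num m Q z0) = cnorm Q.[z0] / cnorm (outer m z0) /
    ((1 + s0) ^+ 2 * (1 - s0)).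
  rewrite /cauchy_num cnormf cnormf; congr (_ / _).
  have -> : (1 - z0 * z0) ^+ 2 * (1 + z0 * z0) =
      real_complex R ((1 + s0) ^+ 2 * (1 - s0)).
    by rewrite -expr2 z0sq !rcE opprK.
  rewrite cnorm_real ger0_norm// mulr_ge0 ?sqr_ge0// subr_ge0 ltW//.
rewrite -/S0.
set q := cnorm Q.[z0] / _; set j : R := J.+1%:R in hJ E E0 eE *.
have j1 : 1 <= j by rewrite ler1n.
have -> : cnorm Q.[z0] = q * cnorm (outer m z0) by rewrite /q mulfVK.
move=> h; rewrite [leRHS]mulrAC ler_wpM2r ?cnorm_ge0//.
have s1 : 0 < 1 - s0 by rewrite subr_gt0.
have h1 : q <= L * ((j / (1 - s0 ^+ 2) + E * e / 2) / (2 * j - 1) * ((1 + s0) ^+ 2 * (1 - s0))).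
  have D0 : 0 < (1 + s0) ^+ 2 * (1 - s0) by rewrite mulr_gt0// exprn_gt0// ltr_wpDr.
  rewrite mulrA -ler_pdivrMr// mulrA ler_pdivlMr ?[_ * (2 * j - 1)]mulrC; last lra.
  apply: le_trans h _; rewrite ler_wpM2l// lerD2l /E le_eqVlt; apply/orP; left.
  by apply/eqP; field.
apply: le_trans h1 _; rewrite ler_wpM2l//.
have -> : (j / (1 - s0 ^+ 2) + E * e / 2) / (2 * j - 1) * ((1 + s0) ^+ 2 * (1 - s0)) =
   (1 + s0) / 2 + (1 + s0) / (2 * (2 * j - 1)) +
   E * e / 2 * ((1 + s0) ^+ 2 * (1 - s0)) / (2 * j - 1).
  move: (E * e) s1 => E'; move: (j) j1 (s0) s0_ge0 => j' j1' s sg0 s1.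
  have s2 : 1 - s ^+ 2 != 0.
    by rewrite subr_eq0 eq_sym lt_eqF// expr_lt1//; lra.
  have s3 : 2 * j' - 1 != 0 by apply/eqP; lra.
  by field; rewrite s2 s3.
have h2 : (1 + s0) / (2 * (2 * j - 1)) <= eps / 2.
  rewrite ler_pdivrMr; last lra.
  nra.
have h3 : E * e / 2 * ((1 + s0) ^+ 2 * (1 - s0)) / (2 * j - 1) <= eps / 2.
  rewrite ler_pdivrMr; last lra.
  have h4 : (1 + s0) ^+ 2 * (1 - s0) <= 2.
    have -> : (1 + s0) ^+ 2 * (1 - s0) = 1 + s0 - s0 ^+ 2 - s0 ^+ 3 by ring.
    have := exprn_ge0 3 s0_ge0; have := sqr_ge0 s0; lra.
  have h5 : E * e / 2 * ((1 + s0) ^+ 2 * (1 - s0)) <= E * e / 2 * 2.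
    by rewrite ler_wpM2l// divr_ge0// mulr_ge0// ltW.
  nra.
lra.
Qed.

End Lower.

(** * Degree bounds for polynomials *)

Section Degree.
Variable R : nzRingType.
Implicit Types P Q : {poly R}.

Lemma size_mul_deg m n P Q : (size P <= m.+1)%N -> (size Q <= n.+1)%N ->
  (size (P * Q)%R <= (m + n).+1)%N.
Proof.
move=> hP hQ; apply: leq_trans (size_polyMleq _ _) _.
by move: hP hQ; case: (size P) (size Q) => [|p] [|q] /=; lia.
Qed.

Lemma size_exp_deg m n P : (size P <= m.+1)%N -> (size (P ^+ n)%R <= (m * n).+1)%N.
Proof.
move=> hP; elim: n => [|n IH]; first by rewrite expr0 size_poly1 muln0.
by rewrite exprS mulnS; exact: size_mul_deg.
Qed.

Lemma size_add_deg n P Q : (size P <= n)%N -> (size Q <= n)%N -> (size (P + Q)%R <= n)%N.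
Proof. by move=> hP hQ; rewrite (leq_trans (size_polyD _ _))// geq_max hP. Qed.

Lemma size_lin (b c : R) : (size (b *: 'X + c%:P)%R <= 2)%N.
Proof.
apply: size_add_deg; last by rewrite (leq_trans (size_polyC_leq1 _)).
by rewrite (leq_trans (size_scale_leq _ _))// size_polyX.
Qed.

End Degree.

(** * Competitors for the upper bound *)

Section Upper.
Variable R : realType.
Variables (z0 a : R[i]) (d : nat) (W0 W0r : {poly R[i]}).
Hypothesis z0J : conjc z0 = - z0.
Hypothesis z0_lt1 : cnorm z0 < 1.
Hypothesis a_lt1 : cnorm a < 1.
Hypothesis W0J : forall z, conjc W0.[z] = W0.[conjc z].
Hypothesis W0rE : forall z, z != 0 -> W0r.[z] = z ^+ d * W0.[z^-1].
Hypothesis W0_neq0 : forall z, cnorm z <= 1 -> W0.[z] != 0.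
Hypothesis W0_size : (size W0 <= d.+1)%N.

(* Kept abstract, so that [ring] and [field] treat them as atoms. *)
Variables (x y v w : {poly R[i]}) (kp : R[i]).
Hypotheses (xE : forall z, x.[z] = 1 - conjc a * z) (yE : forall z, y.[z] = 1 - a * z)
  (vE : forall z, v.[z] = z - a) (wE : forall z, w.[z] = z - conjc a).
Hypotheses (xsz : (size x <= 2)%N) (ysz : (size y <= 2)%N) (vsz : (size v <= 2)%N).
Hypothesis kp_def : kp = ((1 - z0 ^+ 2) ^+ 2)^-1.

(** [unblaschke a p] made homogeneous of degree [p], so that substituting the quotient [s / t]
    leaves a polynomial. *)
Definition unblaschke_hom p (s t : {poly R[i]}) : {poly R[i]} :=
  (s + a *: t) * \sum_(i < p) (- conjc a) ^+ i *: (s ^+ i * t ^+ (p - i.+1)).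

Let eval_half (A B D U : {poly R[i]}) z m n p :
  (kp *: (A ^+ m * B * D ^+ n * (D ^+ p - z0 *: U) ^+ 2)).[z] =
  kp * (A.[z] ^+ m * B.[z] * D.[z] ^+ n * (D.[z] ^+ p - z0 * U.[z]) ^+ 2).
Proof. by rewrite hornerZ !hornerM !horner_exp hornerD hornerN hornerZ horner_exp. Qed.

Let expr_split (s : R[i]) m p : (2 * p <= m)%N ->
  s ^+ m = s ^+ (m - 2 * p) * (s ^+ p) ^+ 2.
Proof. by move=> pm; rewrite -exprM -exprD; congr (_ ^+ _); lia. Qed.

Lemma unblaschke_homE p s t z : t.[z] != 0 ->
  (unblaschke_hom p s t).[z] = t.[z] ^+ p * (unblaschke a p).[s.[z] / t.[z]].
Proof.
move=> t0; rewrite unblaschkeE /unblaschke_hom hornerM hornerD hornerZ horner_sum.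
case: p => [|p]; first by rewrite !big_ord0 !mulr0.
have -> : s.[z] + a * t.[z] = t.[z] * (s.[z] / t.[z] + a) by field.
rewrite exprS -!mulrA [_ ^+ p * _]mulrCA; congr (_ * (_ * _)).
rewrite mulr_sumr; apply: eq_bigr => i _.
rewrite hornerZ hornerM !horner_exp subSS !exprMn.
have ip : (i <= p)%N by rewrite -ltnS.
have -> : t.[z] ^+ p = t.[z] ^+ (p - i) * t.[z] ^+ i by rewrite -exprD subnK.
have ti : t.[z] ^+ i != 0 by rewrite expf_neq0.
by rewrite exprVn; field.
Qed.

Lemma size_unblaschke_hom p (s t : {poly R[i]}) : (size s <= 2)%N -> (size t <= 2)%N ->
  (size (unblaschke_hom p s t)%R <= p.+1)%N.
Proof.
move=> hs ht; case: p => [|p].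
  by rewrite /unblaschke_hom big_ord0 mulr0 size_poly0.
have h1 : (size (s + a *: t)%R <= 2)%N.
  by apply: size_add_deg => //; rewrite (leq_trans (size_scale_leq _ _)).
have h2 : (size (\sum_(i < p.+1) (- conjc a) ^+ i *: (s ^+ i * t ^+ (p.+1 - i.+1)))%R <= p.+1)%N.
  elim/big_rec : _ => [|i q _ hq]; first by rewrite size_poly0.
  apply: size_add_deg => //; rewrite (leq_trans (size_scale_leq _ _))//.
  have := size_mul_deg (size_exp_deg i hs) (size_exp_deg (p.+1 - i.+1) ht).
  by rewrite !mul1n subSS subnKC// -ltnS.
exact: size_mul_deg h1 h2.
Qed.

(** This is [outer] times [kp * (1 - z0 * t) ^+ 2], where [t] is the approximation of [z] by powers
    of [blaschke a z]. The denominators [x ^+ p] of [t], squared, are taken from [x ^+ m], which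
    keeps the degree at [2 * m + d]. *)
Definition half_comp m p : {poly R[i]} :=
  kp *: (y ^+ m * W0 * x ^+ (m - 2 * p) * (x ^+ p - z0 *: unblaschke_hom p v x) ^+ 2).

Definition half_comp_rev m p : {poly R[i]} :=
  kp *: (v ^+ m * W0r * w ^+ (m - 2 * p) * (w ^+ p - z0 *: unblaschke_hom p y w) ^+ 2).

Lemma size_half_comp m p : (2 * p <= m)%N -> (size (half_comp m p)%R <= (2 * m + d).+1)%N.
Proof.
move=> pm; rewrite (leq_trans (size_scale_leq _ _))//.
have hu : (size (x ^+ p - z0 *: unblaschke_hom p v x)%R <= p.+1)%N.
  apply: size_add_deg; first by have := size_exp_deg p xsz; rewrite mul1n.
  by rewrite size_polyN (leq_trans (size_scale_leq _ _))// size_unblaschke_hom.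
have h1 := size_mul_deg (size_exp_deg m ysz) W0_size.
have h2 := size_mul_deg h1 (size_exp_deg (m - 2 * p) xsz).
have h3 := size_mul_deg h2 (size_exp_deg 2 hu).
by apply: leq_trans h3 _; lia.
Qed.

(** Reversal exchanges [x] with [w] and [y] with [v], because [z * x.[z^-1] = w.[z]] and so on. *)
Lemma half_comp_revE m p z : (2 * p <= m)%N -> z != 0 ->
  (half_comp_rev m p).[z] = z ^+ (2 * m + d) * (half_comp m p).[z^-1].
Proof.
move=> pm zn.
have hx : z * x.[z^-1] = w.[z] by rewrite xE wE; field.
have hy : z * y.[z^-1] = v.[z] by rewrite yE vE; field.
have hv : z * v.[z^-1] = y.[z] by rewrite vE yE; field.
have hu : (unblaschke_hom p y w).[z] = z ^+ p * (unblaschke_hom p v x).[z^-1].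
  rewrite /unblaschke_hom !(hornerM, hornerD, hornerZ, horner_sum).
  case: p {pm} => [|p]; first by rewrite !big_ord0 !mulr0.
  rewrite -hv -hx exprS.
  have -> : z * v.[z^-1] + a * (z * x.[z^-1]) = z * (v.[z^-1] + a * x.[z^-1]) by ring.
  rewrite -!mulrA [z ^+ p * _]mulrCA; congr (_ * (_ * _)); rewrite mulr_sumr.
  apply: eq_bigr => i _.
  rewrite !hornerZ !hornerM !horner_exp -hx -hv !exprMn subSS.
  have ip : (i <= p)%N by rewrite -ltnS.
  have -> : z ^+ p = z ^+ (p - i) * z ^+ i by rewrite -exprD subnK.
  by ring.
rewrite /half_comp_rev /half_comp !eval_half hu W0rE// -hx -hy.
have -> : z ^+ (2 * m + d) = z ^+ m * z ^+ d * (z ^+ (m - 2 * p) * (z ^+ p) ^+ 2).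
  by rewrite -expr_split// -!exprD; congr (_ ^+ _); lia.
by rewrite !exprMn; ring.
Qed.

Let dx z : cnorm z <= 1 -> x.[z] != 0.
Proof. by move=> z1; rewrite xE blaschke_den. Qed.
Let dy z : cnorm z <= 1 -> y.[z] != 0.
Proof. by move=> z1; rewrite yE one_sub_neq0. Qed.

Lemma half_comp_outer m p z : (2 * p <= m)%N -> cnorm z <= 1 ->
  (half_comp m p).[z] = outer a W0 m z *
    (kp * (1 - z0 * (unblaschke a p).[blaschke a z]) ^+ 2).
Proof.
move=> pm z1; rewrite /half_comp eval_half.
rewrite unblaschke_homE ?dx// /outer vE /blaschke -xE -yE exprMn (expr_split x.[z] pm).
by move: (unblaschke a p).[_] => u; ring.
Qed.

Lemma cnorm_parallelogram (s : R[i]) :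
  cnorm (1 - s) ^+ 2 + cnorm (1 + s) ^+ 2 = 2 + 2 * cnorm s ^+ 2.
Proof. by case: s => s t; rewrite !cnorm_sqr /=; ring. Qed.

(** At [z0], the first half divided by [outer] is close to 1 by the choice of [kp], and the reversed
    half carries the factor [blaschke a z0 ^+ m], which tends to 0. On the circle the two halves add
    up to at most [kp] times [|1 - z0 z| ^ 2 + |1 + z0 z| ^ 2], that is [2 + 2 * s0], up to the
    approximation error. *)
Lemma outer_competitor (eps : R) : 0 < eps ->
  exists m0, forall m, (m0 <= m)%N -> exists P Pr : {poly R[i]},
    [/\ (size P <= (2 * m + d).+1)%N,
        forall z, z != 0 -> Pr.[z] = z ^+ (2 * m + d) * P.[z^-1],
        cnorm ((P + Pr).[z0] - outer a W0 m z0) <= eps * cnorm (outer a W0 m z0) &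
        forall z, cnorm z = 1 -> cnorm (P + Pr).[z] <=
          (2 / (1 + cnorm z0 ^+ 2) + eps) * cnorm (outer a W0 m z)].
Proof.
move=> eps0; set s0 := cnorm z0 ^+ 2.
have s0_ge0 : 0 <= s0 := sqr_ge0 _.
have z0sq : z0 ^+ 2 = - real_complex R s0 by rewrite /s0 -mulcJ z0J mulrN opprK expr2.
have z01 : cnorm z0 <= 1 := ltW z0_lt1.
have kpE : cnorm kp = ((1 + s0) ^+ 2)^-1.
  rewrite kp_def z0sq opprK -rc1 -rcD -rcX cnormV cnorm_real ger0_norm// sqr_ge0//.
have kp1 : cnorm kp <= 1.
  by rewrite kpE invf_le1 ?exprn_gt0 ?ltr_wpDr// exprn_ege1// lerDl.
(* The error is at most [5 * e] at [z0], where half of [eps] is available, and [5 * e] for each half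
   on the circle. *)
have [e [e0 e1 eE]] : exists e : R, [/\ 0 < e, e <= 1 & 10 * e <= eps].
  exists (Num.min 1 (eps / 10)); split; first by rewrite lt_min ltr01 divr_gt0.
    by rewrite ge_min lexx.
  have : Num.min 1 (eps / 10) <= eps / 10 by rewrite ge_min lexx orbT.
  lra.
have [p hp] := unblaschke_approx a_lt1 e0.
pose t z := (unblaschke a p).[blaschke a z].
have b1 := cnorm_blaschke_lt1 a_lt1 z0_lt1.
(* The part of the quotient of the reversed half by [outer] at [z0] that does not depend on [m]. *)
pose K := cnorm (kp * (W0r.[z0] / W0.[z0]) *
  ((w.[z0] ^+ p - z0 * (unblaschke_hom p y w).[z0]) / y.[z0] ^+ p) ^+ 2).
have K0 : 0 <= K by exact: cnorm_ge0.
have e2 : 0 < eps / (2 * (K + 1)) by rewrite divr_gt0// mulr_gt0// ltr_wpDl.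
have [m1 hm1] := @expr_small R (cnorm (blaschke a z0)) _ (introT andP (conj (cnorm_ge0 _) b1)) e2.
exists (m1 + 2 * p)%N => m hm; have pm : (2 * p <= m)%N by rewrite (leq_trans _ hm)// leq_addl.
have hmm1 : (m1 <= m)%N by rewrite (leq_trans _ hm)// leq_addr.
exists (half_comp m p), (half_comp_rev m p); split; first exact: size_half_comp.
- by move=> z zn; exact: half_comp_revE.
- rewrite hornerD half_comp_outer//.
  have on : outer a W0 m z0 != 0 by apply: outer_neq0.
  have -> : outer a W0 m z0 * (kp * (1 - z0 * (unblaschke a p).[blaschke a z0]) ^+ 2) +
      (half_comp_rev m p).[z0] - outer a W0 m z0 =
    outer a W0 m z0 * ((kp * (1 - z0 * t z0) ^+ 2 - 1) +
      (half_comp_rev m p).[z0] / outer a W0 m z0).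
    rewrite -/(t z0); move: (outer a W0 m z0) on => O O0; by field.
  rewrite cnormM mulrC ler_wpM2r ?cnorm_ge0//.
  have h1 : cnorm (kp * (1 - z0 * t z0) ^+ 2 - 1) <= eps / 2.
    have k0 : 1 - z0 ^+ 2 != 0 by apply: one_sub_neq0 => //; rewrite ?cnormX ?exprn_ile1 ?expr_lt1 ?cnorm_ge0// .
    have -> : kp * (1 - z0 * t z0) ^+ 2 - 1 =
        kp * ((z0 * (z0 - t z0)) * ((1 - z0 * t z0) + (1 - z0 ^+ 2))).
      by rewrite kp_def; field.
    have tz := hp _ z01; rewrite -/(t z0) in tz.
    have t2 : cnorm (t z0) <= 2.
      by have := ler_cnormB z0 (z0 - t z0); rewrite subKr; lra.
    have h3 : cnorm ((1 - z0 * t z0) + (1 - z0 ^+ 2)) <= 5.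
      have := ler_cnormD (1 - z0 * t z0) (1 - z0 ^+ 2).
      have := ler_cnormB 1 (z0 * t z0); have := ler_cnormB 1 (z0 ^+ 2).
      rewrite cnorm1 cnormX cnormM.
      have : cnorm z0 * cnorm (t z0) <= 1 * 2 by apply: ler_pM; rewrite ?cnorm_ge0.
      have : cnorm z0 ^+ 2 <= 1 by rewrite exprn_ile1 ?cnorm_ge0.
      lra.
    rewrite cnormM; apply: (@le_trans _ _ (1 * (1 * e * 5))); last lra.
    apply: ler_pM; rewrite ?cnorm_ge0// !cnormM.
    apply: ler_pM; rewrite ?mulr_ge0 ?cnorm_ge0//.
    by apply: ler_pM; rewrite ?cnorm_ge0.
  have h2 : cnorm ((half_comp_rev m p).[z0] / outer a W0 m z0) <= eps / 2.
    have -> : (half_comp_rev m p).[z0] / outer a W0 m z0 =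
        blaschke a z0 ^+ m * (blaschke (conjc a) z0 ^+ (m - 2 * p)) *
        (kp * (W0r.[z0] / W0.[z0]) *
  ((w.[z0] ^+ p - z0 * (unblaschke_hom p y w).[z0]) / y.[z0] ^+ p) ^+ 2).
      rewrite /half_comp_rev eval_half; move: (unblaschke_hom p y w).[z0] => u.
      have hx := dx z01; have hy := dy z01; have hW := W0_neq0 z01.
      rewrite /outer /blaschke conjcK -vE -wE -yE -xE !exprMn !exprVn.
      rewrite (expr_split y.[z0] pm).
      move: (W0.[z0]) hW => W W_0; move: (x.[z0] ^+ m) (expf_neq0 m hx) => X X0.
      move: (y.[z0] ^+ p) (expf_neq0 p hy) => Y Y0.
      move: (y.[z0] ^+ (m - 2 * p)) (expf_neq0 (m - 2 * p) hy) => Z Z0.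
      by field; rewrite W_0 X0 Y0 Z0.
    rewrite cnormM -/K cnormM !cnormX.
    have hb : cnorm (blaschke (conjc a) z0) ^+ (m - 2 * p) <= 1.
      by rewrite exprn_ile1 ?cnorm_ge0// cnorm_blaschke_le1// cnormJ.
    have hh : cnorm (blaschke a z0) ^+ m * cnorm (blaschke (conjc a) z0) ^+ (m - 2 * p) <=
       eps / (2 * (K + 1)) * 1.
      by apply: ler_pM; rewrite ?exprn_ge0 ?cnorm_ge0// hm1.
    apply: le_trans (ler_wpM2r K0 hh) _.
    rewrite mulr1 mulrAC ler_pdivrMr ?mulr_gt0 ?ltr_wpDl//; nra.
  have := ler_cnormD (kp * (1 - z0 * t z0) ^+ 2 - 1) ((half_comp_rev m p).[z0] / outer a W0 m z0).
  lra.
move=> z z1; have z1' : cnorm z <= 1 by rewrite z1.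
have zn : z != 0 by rewrite -cnorm_gt0 z1.
have zJ : cnorm (conjc z) <= 1 by rewrite cnormJ.
have T (u : R[i]) : cnorm u = 1 -> cnorm (1 - z0 * t u) ^+ 2 <= cnorm (1 - z0 * u) ^+ 2 + 5 * e.
  move=> u1; have u1' : cnorm u <= 1 by rewrite u1.
  have h1 : cnorm (1 - z0 * t u) <= cnorm (1 - z0 * u) + e.
    have -> : 1 - z0 * t u = (1 - z0 * u) + z0 * (u - t u) by ring.
    rewrite (le_trans (ler_cnormD _ _))// lerD2l cnormM.
    by rewrite (le_trans _ (hp u u1'))// ler_piMl ?cnorm_ge0.
  have h2 : cnorm (1 - z0 * u) <= 2.
    have := ler_cnormB 1 (z0 * u); rewrite cnorm1 cnormM u1; lra.
  have h3 := cnorm_ge0 (1 - z0 * t u); have h4 := cnorm_ge0 (1 - z0 * u).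
  have h5 : cnorm (1 - z0 * t u) ^+ 2 <= (cnorm (1 - z0 * u) + e) ^+ 2.
    by rewrite lerXn2r ?nnegrE// addr_ge0// ltW.
  apply: le_trans h5 _; nra.
rewrite hornerD half_comp_revE// (le_trans (ler_cnormD _ _))//.
rewrite cnormM cnormX z1 expr1n mul1r -(conjc_unit z1) !half_comp_outer//.
rewrite -(outerJ _ W0J); move: (outer a W0 m z) => O.
rewrite !cnormM cnormJ -mulrDr mulrC ler_wpM2r ?cnorm_ge0//.
rewrite -!expr2 -mulrDr.
have hc : cnorm (1 - z0 * conjc z) = cnorm (1 + z0 * z).
  by rewrite -cnormJ !conjcE z0J mulNr opprK.
have := T z z1; have := T (conjc z) (etrans (cnormJ z) z1); rewrite hc => h1 h2.
have h3 := cnorm_parallelogram (z0 * z); rewrite cnormM z1 mulr1 -/s0 in h3.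
apply: (@le_trans _ _ (cnorm kp * (2 + 2 * s0 + 10 * e))).
  by rewrite ler_wpM2l ?cnorm_ge0//; rewrite /t in h1 h2 *; lra.
rewrite mulrDr; apply: lerD.
  rewrite kpE le_eqVlt; apply/orP; left; apply/eqP; field.
  by apply/eqP; lra.
apply: (@le_trans _ _ (1 * (10 * e))); last lra.
by rewrite ler_wpM2r// mulr_ge0// ltW.
Qed.

End Upper.

Lemma outer_upper_bound (R : realType) (z0 a : R[i]) (d : nat) (W0 W0r : {poly R[i]}) :
  conjc z0 = - z0 -> cnorm z0 < 1 -> cnorm a < 1 ->
  (forall z, conjc W0.[z] = W0.[conjc z]) ->
  (forall z, z != 0 -> W0r.[z] = z ^+ d * W0.[z^-1]) ->
  (forall z, cnorm z <= 1 -> W0.[z] != 0) -> (size W0 <= d.+1)%N ->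
  forall eps : R, 0 < eps ->
  exists m0, forall m, (m0 <= m)%N -> exists P Pr : {poly R[i]},
    [/\ (size P <= (2 * m + d).+1)%N,
        forall z, z != 0 -> Pr.[z] = z ^+ (2 * m + d) * P.[z^-1],
        cnorm ((P + Pr).[z0] - outer a W0 m z0) <= eps * cnorm (outer a W0 m z0) &
        forall z, cnorm z = 1 -> cnorm (P + Pr).[z] <=
          (2 / (1 + cnorm z0 ^+ 2) + eps) * cnorm (outer a W0 m z)].
Proof.
move=> z0J z01 a1 W0J W0rE W0n W0s eps eps0.
have lin (b c z : R[i]) : (b *: 'X + c%:P).[z] = b * z + c.
  by rewrite hornerD hornerZ hornerX hornerC.
apply: (@outer_competitor R z0 a d W0 W0r z0J z01 a1 W0J W0rE W0n W0s
  (- conjc a *: 'X + 1%:P) (- a *: 'X + 1%:P) (1 *: 'X + (- a)%:P)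
  (1 *: 'X + (- conjc a)%:P) _ _ _ _ _ _ _ _ erefl _ eps0);
  try (move=> z; rewrite lin; ring); exact: size_lin.
Qed.

(** * From the arc to the unit circle *)

Section Forms.
Variable K : numFieldType.
Variables (A D : {poly K}) (a1 a2 b1 b2 : K).
Hypothesis XE : a1 *: A + a2 *: D = 'X.
Hypothesis X2E : b1 *: A + b2 *: D = 1 + 'X^2.
Implicit Types P Q : {poly K}.

(** The numerator of [P (A / D)] over [D ^+ n]. The hypotheses say that [A] and [D] span ['X] and
    [1 + 'X^2], hence all self-reciprocal quadratics. *)
Definition hom_poly n P : {poly K} := \sum_(i < n.+1) P`_i *: (A ^+ i * D ^+ (n - i)).

Definition is_form n Q := exists2 P : {poly K}, (size P <= n.+1)%N & hom_poly n P = Q.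

Lemma is_form_cst : is_form 0 1.
Proof.
exists 1; first by rewrite size_poly1.
by rewrite /hom_poly big_ord1 !expr0 coef1 mulr1 scale1r.
Qed.

Lemma is_formD n P Q : is_form n P -> is_form n Q -> is_form n (P + Q).
Proof.
move=> [p ps <-] [q qs <-]; exists (p + q).
  by rewrite (leq_trans (size_polyD _ _))// geq_max ps.
by rewrite /hom_poly -big_split; apply: eq_bigr => i _; rewrite coefD scalerDl.
Qed.

Lemma is_formZ n c Q : is_form n Q -> is_form n (c *: Q).
Proof.
move=> [q qs <-]; exists (c *: q); first by rewrite (leq_trans (size_scale_leq _ _)).
by rewrite /hom_poly scaler_sumr; apply: eq_bigr => i _; rewrite coefZ scalerA.
Qed.

Lemma is_formMl n Q : is_form n Q -> is_form n.+1 (A * Q).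
Proof.
move=> [q qs <-]; exists (q * 'X).
  by rewrite (leq_trans (size_polyMleq _ _))// size_polyX addn2.
rewrite /hom_poly big_ord_recl coefMX eqxx scale0r add0r mulr_sumr.
apply: eq_bigr => i _; rewrite coefMX /= subSS -scalerAr; congr (_ *: _).
by rewrite mulrA -exprS.
Qed.

Lemma is_formMr n Q : is_form n Q -> is_form n.+1 (D * Q).
Proof.
move=> [q qs <-]; exists q; first by rewrite (leq_trans qs).
rewrite /hom_poly big_ord_recr /= nth_default// scale0r addr0 mulr_sumr.
apply: eq_bigr => i _; rewrite -scalerAr; congr (_ *: _).
have iln : (i <= n)%N by rewrite -ltnS.
by rewrite mulrCA subSn// exprS.
Qed.

Lemma is_formX n Q : is_form n Q -> is_form n.+1 ('X * Q).
Proof.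
move=> h; rewrite -XE mulrDl -!scalerAl; apply: is_formD; apply: is_formZ.
  exact: is_formMl.
exact: is_formMr.
Qed.

Lemma is_formX2 n Q : is_form n Q -> is_form n.+1 ((1 + 'X^2) * Q).
Proof.
move=> h; rewrite -X2E mulrDl -!scalerAl; apply: is_formD; apply: is_formZ.
  exact: is_formMl.
exact: is_formMr.
Qed.

(** The recursion of Chebyshev polynomials: [1 + 'X^(2 n + 4)] is [(1 + 'X^2) (1 + 'X^(2 n + 2))]
    minus ['X^2 (1 + 'X^(2 n))]. It has two steps, so two consecutive cases are carried through the
    induction. *)
Lemma is_form_sym n : is_form n (1 + 'X^(2 * n)).
Proof.
suff: is_form n (1 + 'X^(2 * n)) /\ is_form n.+1 (1 + 'X^(2 * n.+1)) by case.
elim: n => [|n [IH1 IH2]].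
  split; last by have := is_formX2 is_form_cst; rewrite mulr1.
  by have := is_formD is_form_cst is_form_cst; rewrite muln0 expr0.
split => //; have h1 := is_formX2 IH2; have h2 := is_formX (is_formX IH1).
have := is_formD h1 (is_formZ (-1) h2); congr is_form.
rewrite scaleN1r mulrA -expr2; have -> : (2 * n.+2 = 2 + (2 * n.+1))%N by lia.
have -> : 'X^(2 + 2 * n.+1) = 'X^2 * 'X^(2 * n.+1) :> {poly K} by rewrite exprD.
have -> : 'X^(2 * n.+1) = 'X^2 * 'X^(2 * n) :> {poly K} by rewrite -exprD; congr (_ ^+ _); lia.
by ring.
Qed.

Lemma is_form_mono n i : (i <= 2 * n)%N -> is_form n ('X^i + 'X^(2 * n - i)).
Proof.
wlog: i / (i <= n)%N => [h i2n|iln _].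
  have [iln|nlti] := leqP i n; first exact: h.
  have := h (2 * n - i)%N; rewrite subKn// addrC; apply; lia.
have step j Q m : is_form m Q -> is_form (j + m) ('X^j * Q).
  move=> h; elim: j => [|j IH]; first by rewrite expr0 mul1r.
  by rewrite exprS -mulrA addSn; exact: is_formX.
have := step i _ _ (is_form_sym (n - i)); rewrite subnKC// mulrDr mulr1 -exprD.
by congr (is_form _ (_ + 'X^_)); lia.
Qed.

Lemma is_form_recip n P : (size P <= (2 * n).+1)%N ->
  is_form n (P + \sum_(i < (2 * n).+1) P`_i *: 'X^(2 * n - i)).
Proof.
move=> Ps; have -> : P = \sum_(i < (2 * n).+1) P`_i *: 'X^i.
  rewrite -poly_def; apply/polyP => i; rewrite coef_poly; case: ltnP => // h.
  by rewrite nth_default// (leq_trans Ps).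
rewrite -big_split /=.
set c := fun i : nat => (\sum_(i < (2 * n).+1) P`_i *: 'X^i)`_i.
have -> : \sum_(i < (2 * n).+1) (P`_i *: 'X^i +
    (\sum_(i < (2 * n).+1) P`_i *: 'X^i)`_i *: 'X^(2 * n - i)) =
    \sum_(i < (2 * n).+1) P`_i *: ('X^i + 'X^(2 * n - i)).
  apply: eq_bigr => i _; rewrite scalerDr; congr (_ + _ *: _).
  by rewrite -poly_def coef_poly ltn_ord.
elim/big_rec: _ => [|i Q _ h].
  have := is_formZ 0 (is_form_sym n); by rewrite scale0r.
by apply: is_formD => //; apply: is_formZ; apply: is_form_mono; rewrite -ltnS.
Qed.

Lemma poly_eq_nonzero P Q : (forall z : K, z != 0 -> P.[z] = Q.[z]) -> P = Q.
Proof.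
move=> h; apply/eqP; rewrite -subr_eq0; apply/negPn/negP => pq0.
pose s := [seq (i.+1)%:R : K | i <- iota 0 (size (P - Q))].
have us : uniq s.
  rewrite map_inj_uniq ?iota_uniq// => i j /eqP; rewrite eqr_nat => /eqP; lia.
have rs : all (root (P - Q)) s.
  apply/allP => z /mapP[i _ ->]; have i0 : (i.+1%:R : K) != 0 by rewrite pnatr_eq0.
  by rewrite /root hornerD hornerN (h _ i0) subrr.
by have := max_poly_roots pq0 rs us; rewrite size_map size_iota ltnn.
Qed.

Lemma is_form_half n P Pr : (size P <= (2 * n).+1)%N ->
  (forall z : K, z != 0 -> Pr.[z] = z ^+ (2 * n) * P.[z^-1]) -> is_form n (P + Pr).
Proof.
move=> Ps h; have -> : Pr = \sum_(i < (2 * n).+1) P`_i *: 'X^(2 * n - i).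
  apply: poly_eq_nonzero => z z0; rewrite h// (horner_coef_wide _ Ps) mulr_sumr.
  rewrite horner_sum; apply: eq_bigr => i _.
  rewrite hornerZ hornerXn mulrCA; congr (_ * _).
  have iln : (i <= 2 * n)%N by rewrite -ltnS.
  have -> : z ^+ (2 * n) = z ^+ (2 * n - i) * z ^+ i by rewrite -exprD subnK.
  by rewrite -mulrA -exprMn divff// expr1n mulr1.
exact: is_form_recip.
Qed.

Lemma hom_polyE n P z : (size P <= n.+1)%N -> D.[z] != 0 ->
  (hom_poly n P).[z] = D.[z] ^+ n * P.[A.[z] / D.[z]].
Proof.
move=> Ps D0; rewrite /hom_poly horner_sum (horner_coef_wide _ Ps) mulr_sumr.
apply: eq_bigr => i _; rewrite hornerZ hornerM !horner_exp [RHS]mulrCA; congr (_ * _).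
have iln : (i <= n)%N by rewrite -ltnS.
have -> : D.[z] ^+ n = D.[z] ^+ (n - i) * D.[z] ^+ i by rewrite -exprD subnK.
by rewrite exprMn exprVn -mulrA [_ ^+ i * (_ / _)]mulrCA divff ?mulr1 ?expf_neq0// mulrC.
Qed.

(** A zero of [D] represents [u = infinity], and the form then reads off the coefficient by which
    polynomials are normalized there. *)
Lemma hom_polyE0 n P z : D.[z] = 0 -> (hom_poly n P).[z] = P`_n * A.[z] ^+ n.
Proof.
move=> D0; rewrite /hom_poly horner_sum big_ord_recr /= big1 ?add0r.
  by rewrite subnn expr0 mulr1 hornerZ horner_exp.
move=> i _; rewrite hornerZ hornerM !horner_exp D0 expr0n subn_eq0.
by rewrite leqNgt ltn_ord /= !mulr0.
Qed.

End Forms.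

(** * The arc, the Moebius map and its square root *)

Section Arc.
Variables (R : realType) (alpha : R).
Hypothesis halpha : 0 < alpha < pi.
Implicit Types (u z M : R[i]).

Let e : R[i] := expi alpha.

Definition nonpos_ray M := exists2 mu : R, 0 <= mu & M = - real_complex R mu.

(** The fourth power of [lambda]. It sends the ends [conjc e] and [e] of the arc to 0 and infinity,
    and the arc to the nonpositive ray, so that off the arc the square root has positive real
    part. *)
Definition mob u : R[i] := (u * e - 1) / (u - e).

Let e1 : cnorm e = 1. Proof. exact: cnorm_expi. Qed.

Let Re_e : complex.Re e = cos alpha. Proof. by []. Qed.

Let eJ : e * conjc e = 1. Proof. by rewrite mulcJ e1 expr1n. Qed.

Lemma cos_alpha_lt1 : cos alpha ^+ 2 < 1.
Proof.
have s0 : 0 < sin alpha by apply: sin_gt0_pi.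
by have := cos2Dsin2 alpha; have := exprn_gt0 2 s0; lra.
Qed.

Lemma GammaP u : Gamma alpha u <-> cnorm u = 1 /\ cos alpha <= complex.Re u.
Proof.
have [a0 ap] := andP halpha.
have apI : alpha \in `[0, pi] by rewrite in_itv /= (ltW a0) ltW.
split=> [[t /=]|[u1 hu]].
  rewrite in_itv /= => /andP[h1 h2] <-; split; first exact: cnorm_expi.
  rewrite /=; have -> : cos t = cos `|t| by case: (ger0P t) => // _; rewrite cosN.
  have hn : `|t| <= alpha by rewrite ler_norml h1.
  have [->//|ne] := eqVneq `|t| alpha.
  rewrite ltW// ltr_cos// ?lt_neqAle ?ne//.
  by rewrite in_itv /= normr_ge0 (le_trans hn)// ltW.
have h1 : -1 <= complex.Re u <= 1.
  by rewrite -ler_norml -u1 cnorm_Re.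
have hac : acos (complex.Re u) <= alpha.
  rewrite leNgt; apply/negP => lt; move: hu; apply/negP; rewrite -ltNge -[complex.Re u]acosK//.
  by rewrite ltr_cos// in_itv /= acos_ge0// acos_lepi.
have hs : sin (acos (complex.Re u)) ^+ 2 = complex.Im u ^+ 2.
  have := cnorm_sqr u; rewrite u1 expr1n sin2cos2 acosK// => ->; ring.
have sg := sin_ge0_pi (introT andP (conj (acos_ge0 h1) (acos_lepi h1))).
have [i0|i0] := leP 0 (complex.Im u).
- exists (acos (complex.Re u)).
    rewrite /= in_itv /= hac andbT (le_trans _ (acos_ge0 h1))//; lra.
  rewrite /expi acosK//; move/eqP: hs; rewrite eqrXn2// => /eqP ->.
  by case: (u).
- exists (- acos (complex.Re u)).
    rewrite /= in_itv /=; have := acos_ge0 h1; lra.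
  rewrite /expi cosN sinN acosK//; move/eqP: hs.
  rewrite -[complex.Im u ^+ 2]sqrrN eqrXn2// ?oppr_ge0 1?ltW// => /eqP ->.
  by rewrite opprK; case: (u).
Qed.

Lemma cnorm_Gamma u : Gamma alpha u -> cnorm u = 1.
Proof. by move=> /GammaP[]. Qed.

Lemma Gamma_e : Gamma alpha e.
Proof. by apply/GammaP; rewrite e1 Re_e. Qed.

Lemma sqrtc_Re_gt0 M : ~ nonpos_ray M -> 0 < complex.Re (sqrtc M).
Proof.
move=> nr; rewrite lt_neqAle; apply/andP; split; last first.
  by case: M {nr} => a b; rewrite /= sqrtr_ge0.
apply/negP => /eqP h; apply: nr.
have := sqr_sqrtc M; case: (sqrtc M) h => a b /= <- <-.
exists (b ^+ 2); first exact: sqr_ge0.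
by apply/eqP; rewrite eq_complex /=; apply/andP; split; apply/eqP; ring.
Qed.

Lemma arc_den_neq0 (p q : R) : 0 <= p -> 0 <= q -> 0 < p + q ->
  real_complex R p + real_complex R q * e != 0.
Proof.
move=> p0 q0 pq; rewrite -cnorm_eq0 -[cnorm _ == 0](expf_eq0 _ 2%N) /= cnorm_sqr /e /=.
rewrite !mul0r !subr0 !addr0 add0r.
have h := cos2Dsin2 alpha; have c2 := cos_alpha_lt1.
have -> : (p + q * cos alpha) ^+ 2 + (q * sin alpha) ^+ 2 =
    p ^+ 2 + q ^+ 2 * (cos alpha ^+ 2 + sin alpha ^+ 2) + 2 * (p * q) * cos alpha by ring.
rewrite h mulr1 gt_eqF//.
have c1 : -1 < cos alpha by nra.
have [q00|qn] := eqVneq q 0.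
  by move: pq; rewrite q00 expr0n !mulr0 !mul0r !addr0 => pq; rewrite exprn_gt0.
have q1 : 0 < q by rewrite lt_neqAle eq_sym qn.
have [->|pn] := eqVneq p 0.
  by rewrite expr0n !mul0r mulr0 mul0r addr0 add0r exprn_gt0.
have p1 : 0 < p by rewrite lt_neqAle eq_sym pn.
have := mulr_gt0 p1 q1; have := sqr_ge0 (p - q); nra.
Qed.

(** The inverse of [mob] at [- p / q]. Homogeneous coordinates include the end [e] of the arc, as
    the case [q = 0]. *)
Lemma arc_of_ray (p q : R) : 0 <= p -> 0 <= q -> 0 < p + q ->
  Gamma alpha ((real_complex R p * e + real_complex R q) /
               (real_complex R p + real_complex R q * e)).
Proof.
move=> p0 q0 pq; have dn := arc_den_neq0 p0 q0 pq.
set N := _ + real_complex R q; set d := _ + _ * e.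
have hNd : cnorm N = cnorm d.
  have -> : N = e * conjc d.
    rewrite /N /d !conjcE mulrDr [e * (_ * _)]mulrCA eJ mulr1 mulrC //.
  by rewrite cnormM e1 mul1r cnormJ.
have cd : cnorm d != 0 by rewrite cnorm_eq0.
apply/GammaP; split; first by rewrite cnormf hNd divff.
have -> : N / d = N * conjc d / real_complex R (cnorm d ^+ 2).
  by rewrite -mulcJ; field; rewrite conjc_eq0 dn.
have -> : N * conjc d = real_complex R (p ^+ 2) * e + real_complex R (q ^+ 2) * conjc e +
    real_complex R (2 * p * q).
  rewrite /N /d !conjcE.
  have -> : (real_complex R p * e + real_complex R q) * (real_complex R p + real_complex R q * conjc e) =
    real_complex R p ^+ 2 * e + real_complex R q ^+ 2 * conjc e + real_complex R p * real_complex R q * (e * conjc e)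
    + real_complex R p * real_complex R q by ring.
  by rewrite eJ !rcE; ring.
have -> : forall w (t : R), complex.Re (w / real_complex R t) = complex.Re w / t.
  by move=> [x y] t; rewrite -rcV /=; ring.
have -> : complex.Re (real_complex R (p ^+ 2) * e + real_complex R (q ^+ 2) * conjc e +
    real_complex R (2 * p * q)) = (p ^+ 2 + q ^+ 2) * cos alpha + 2 * p * q.
  by rewrite /e /=; ring.
have d2 : cnorm d ^+ 2 = p ^+ 2 + q ^+ 2 + 2 * (p * q) * cos alpha.
  rewrite cnorm_sqr /d /e /=; have := cos2Dsin2 alpha => h.
  rewrite (_ : p ^+ 2 + q ^+ 2 = p ^+ 2 + q ^+ 2 * (cos alpha ^+ 2 + sin alpha ^+ 2)); last by rewrite h mulr1.
  ring.
rewrite ler_pdivlMr; last by rewrite lt_neqAle eq_sym sqrf_eq0 cd sqr_ge0.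
rewrite d2; have := mulr_ge0 p0 q0; have := cos_alpha_lt1; nra.
Qed.

Lemma mob_on u : Gamma alpha u -> u != e -> nonpos_ray (mob u).
Proof.
move=> /GammaP[u1 hu] ue.
have d0 : u - e != 0 by rewrite subr_eq0.
exists (2 * (complex.Re u - cos alpha) / cnorm (u - e) ^+ 2).
  by rewrite divr_ge0 ?sqr_ge0// mulr_ge0// subr_ge0.
have uJ : u * conjc u = 1 by rewrite mulcJ u1 expr1n.
rewrite !rcE -rcX -mulcJ /mob.
have -> : real_complex R (complex.Re u) = (u + conjc u) / 2.
  by rewrite addrJ !rcE; field.
have -> : real_complex R (cos alpha) = (e + conjc e) / 2.
  by rewrite addrJ !rcE Re_e; field.
have d1 : conjc (u - e) != 0 by rewrite conjc_eq0.
have -> : (u * e - 1) / (u - e) = (u * e - 1) * (conjc u - conjc e) / ((u - e) * conjc (u - e)).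
  by move: d0 d1; rewrite !conjcE => d0 d1; field; rewrite d0 d1.
have -> : (u * e - 1) * (conjc u - conjc e) = (u * conjc u) * e - u * (e * conjc e) - conjc u + conjc e.
  by ring.
rewrite uJ eJ; move: d0 d1; move: (u - e) (conjc _) => d dJ d0 d1; field.
by rewrite d0 d1.
Qed.

Lemma mob_off u : ~ Gamma alpha u -> u != e /\ ~ nonpos_ray (mob u).
Proof.
move=> nu; have ue : u != e by apply/eqP => h; apply: nu; rewrite h; exact: Gamma_e.
split=> // -[mu mu0 h]; apply: nu.
have d0 : u - e != 0 by rewrite subr_eq0.
have mn := @arc_den_neq0 mu 1 mu0 ler01 (ltr_wpDl mu0 ltr01).
have -> : u = (real_complex R mu * e + real_complex R 1) / (real_complex R mu + real_complex R 1 * e).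
  apply: (mulIf mn); rewrite mulfVK// rc1 mul1r.
  have : (u * e - 1) = - real_complex R mu * (u - e) by rewrite -h /mob mulfVK.
  move=> h2; apply/eqP; rewrite -subr_eq0; apply/eqP.
  have -> : u * (real_complex R mu + e) - (real_complex R mu * e + 1) =
    (u * e - 1) - (- real_complex R mu * (u - e)) by ring.
  by rewrite h2 subrr.
exact: (@arc_of_ray mu 1 mu0 ler01 (ltr_wpDl mu0 ltr01)).
Qed.

Lemma mobK u : u != e -> u * (mob u - e) = mob u * e - 1.
Proof. by move=> ue; rewrite /mob; field; rewrite subr_eq0. Qed.

Lemma mob_neqe u : u != e -> mob u != e.
Proof.
move=> ue; apply/eqP => h; have := mobK ue; rewrite h subrr mulr0 => /esym/eqP.
rewrite subr_eq0 => /eqP e2.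
have h1 : complex.Re (e * e) = 1 by rewrite e2.
have : complex.Re (e * e) = 2 * cos alpha ^+ 2 - 1.
  by rewrite /e /= -!expr2; have := cos2Dsin2 alpha; lra.
by have := cos_alpha_lt1; lra.
Qed.

Definition sqrt_mob u := sqrtc (mob u).

Lemma sqrt_mob_sqr u : sqrt_mob u ^+ 2 = mob u.
Proof. exact: sqr_sqrtc. Qed.

Lemma Re_sqrt_mob u : ~ Gamma alpha u -> 0 < complex.Re (sqrt_mob u).
Proof. by move=> /mob_off[_ h]; exact: sqrtc_Re_gt0. Qed.

(** The value of [sqrt_mob] at infinity, where [mob] tends to [e]. *)
Definition sinf : R[i] := expi (alpha / 2).

Lemma sinf_sqr : sinf ^+ 2 = e.
Proof. by rewrite /sinf expiX /e; congr expi; field. Qed.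

Lemma Re_sinf : 0 < complex.Re sinf.
Proof.
have [a0 ap] := andP halpha; rewrite /=; apply: cos_gt0_pihalf.
apply/andP; split; have := pi_gt0 R; lra.
Qed.

Lemma cnorm_sinf : cnorm sinf = 1. Proof. exact: cnorm_expi. Qed.

End Arc.

(** * The disc variable and the quadratics [A] and [D] *)

Section Cayley.
Variables (R : realType) (alpha : R) (s0 : R[i]).
Hypothesis halpha : 0 < alpha < pi.
Hypothesis s0_gt0 : 0 < complex.Re s0.
Implicit Types (u z s : R[i]).

Let e : R[i] := expi alpha.
Let rho := cnorm s0.
Let rc := real_complex R rho.

Let rho_gt0 : 0 < rho.
Proof.
rewrite /rho cnorm_gt0; apply/eqP => h; move: s0_gt0; by rewrite h ltxx.
Qed.

(** The imaginary axis, covering the arc twice, goes to the unit circle. Scaling by [|s0|] makes the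
    image of [s0] purely imaginary, since [s0 * conjc s0 = rc ^+ 2]. *)
Definition cayley s : R[i] := (s - rc) / (s + rc).

Lemma rhp_add_neq0 s : 0 <= complex.Re s -> s + rc != 0.
Proof.
move=> h; apply/eqP => /(congr1 (@complex.Re R)); case: s h => a b /= h.
by move=> h2; have := rho_gt0; lra.
Qed.

Lemma cnorm_cayley_lt1 s : 0 < complex.Re s -> cnorm (cayley s) < 1.
Proof.
move=> h; have n := rhp_add_neq0 (ltW h).
rewrite /cayley cnormf ltr_pdivrMr ?cnorm_gt0// mul1r.
rewrite -(@ltr_pXn2r _ 2%N) ?nnegrE ?cnorm_ge0// !cnorm_sqr.
case: s h n => a b /= h _; rewrite oppr0 !addr0.
have -> : (a + rho) ^+ 2 + b ^+ 2 = (a - rho) ^+ 2 + b ^+ 2 + 4 * (a * rho) by ring.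
by rewrite ltrDl mulr_gt0// mulr_gt0.
Qed.

Lemma cayleyJ s : conjc (cayley s) = cayley (conjc s).
Proof. by rewrite /cayley !conjcE. Qed.

Lemma cayley_imag : conjc (cayley s0) = - cayley s0.
Proof.
rewrite cayleyJ /cayley; have n := rhp_add_neq0 (ltW s0_gt0).
have n' : conjc s0 + rc != 0.
  have -> : conjc s0 + rc = conjc (s0 + rc) by rewrite !conjcE.
  by rewrite conjc_eq0.
have h : s0 * conjc s0 = rc ^+ 2 by rewrite mulcJ -/rho rcX.
apply/eqP; rewrite -subr_eq0 opprK; apply/eqP.
have -> : (conjc s0 - rc) / (conjc s0 + rc) + (s0 - rc) / (s0 + rc) =
   2 * (s0 * conjc s0 - rc ^+ 2) / ((conjc s0 + rc) * (s0 + rc)).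
  by field; rewrite n n'.
by rewrite h subrr mulr0 mul0r.
Qed.

(** Identifies the constant of the extremal problem with the inverse of the kernel on the
    diagonal. *)
Lemma cayley_s0_norm : 2 / (1 + cnorm (cayley s0) ^+ 2) = 1 + complex.Re s0 / rho.
Proof.
have n := rhp_add_neq0 (ltW s0_gt0).
have r0 := rho_gt0.
have gen (s : R[i]) (r : R) : cnorm (s + real_complex R r) ^+ 2 =
    cnorm s ^+ 2 + 2 * r * complex.Re s + r ^+ 2.
  by rewrite !cnorm_sqr; case: s => a b /=; ring.
have h1 : cnorm (s0 + rc) ^+ 2 = 2 * rho * (rho + complex.Re s0).
  by rewrite gen -/rho; ring.
have h2 : cnorm (s0 - rc) ^+ 2 = 2 * rho * (rho - complex.Re s0).
  by rewrite /rc -rcN gen -/rho; ring.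
rewrite /cayley cnormf expr_div_n h1 h2; move: (complex.Re s0) s0_gt0 => x x0.
by field; rewrite !gt_eqF//; lra.
Qed.

(* [num_poly.[z] / den_poly.[z]] is the point [u] with [z = cayley (sqrt_mob u)]. *)
Definition num_poly : {poly R[i]} :=
  (e * rc ^+ 2) *: (1 + 'X) ^+ 2 - (1 - 'X) ^+ 2.
Definition den_poly : {poly R[i]} :=
  (rc ^+ 2) *: (1 + 'X) ^+ 2 - e *: (1 - 'X) ^+ 2.

Lemma num_polyE z : num_poly.[z] = e * rc ^+ 2 * (1 + z) ^+ 2 - (1 - z) ^+ 2.
Proof. by rewrite /num_poly !hornerE. Qed.
Lemma den_polyE z : den_poly.[z] = rc ^+ 2 * (1 + z) ^+ 2 - e * (1 - z) ^+ 2.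
Proof. by rewrite /den_poly !hornerE. Qed.

Let rc_neq0 : rc != 0.
Proof. by rewrite rc_eq0 gt_eqF. Qed.

Let e2_neq1 : e ^+ 2 - 1 != 0.
Proof.
apply/eqP => /(congr1 (@complex.Re R)); rewrite expr2 /e /= -!expr2.
have := cos2Dsin2 alpha; have := cos_alpha_lt1 halpha; lra.
Qed.

Lemma sqr_combination : exists a1 a2 b1 b2 : R[i],
  a1 *: num_poly + a2 *: den_poly = 'X /\ b1 *: num_poly + b2 *: den_poly = 1 + 'X^2.
Proof.
pose c := (rc ^+ 2 * (e ^+ 2 - 1))^-1; pose d := (e ^+ 2 - 1)^-1.
have c0 : rc ^+ 2 * (e ^+ 2 - 1) != 0 by rewrite mulf_neq0// expf_neq0.
exists ((c * e - d) / 4), ((- c + d * e) / 4), ((c * e + d) / 2), ((- c - d * e) / 2).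
split; apply: poly_eq_nonzero => z _.
- rewrite hornerD !hornerZ num_polyE den_polyE hornerX /c /d.
  by field; rewrite rc_neq0 e2_neq1.
- rewrite hornerD !hornerZ num_polyE den_polyE hornerD hornerC hornerXn /c /d.
  by field; rewrite rc_neq0 e2_neq1.
Qed.

(** The two roots in [z] are the images of the two square roots [s] and [- s] of [mob alpha u], and
    [cayley (- s)] is the inverse of [cayley s]. *)
Lemma cayley_factor u s z : u != e -> s ^+ 2 = mob alpha u -> 0 < complex.Re s ->
  num_poly.[z] - u * den_poly.[z] =
  (e - u) * (rc + s) ^+ 2 * ((z - cayley s) * (1 - cayley s * z)).
Proof.
move=> ue hs s1; have n := rhp_add_neq0 (ltW s1).
have -> : (e - u) * (rc + s) ^+ 2 * ((z - cayley s) * (1 - cayley s * z)) =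
    (e - u) * (rc ^+ 2 * (1 + z) ^+ 2 - s ^+ 2 * (1 - z) ^+ 2).
  by rewrite /cayley; field.
rewrite hs num_polyE den_polyE /mob -/e; field; by rewrite subr_eq0.
Qed.

(** The same factorization at [u = infinity], where [s] is [sinf alpha]. *)
Lemma cayley_den_factor z : den_poly.[z] =
  (rc + sinf alpha) ^+ 2 *
    ((z - cayley (sinf alpha)) * (1 - cayley (sinf alpha) * z)).
Proof.
have n := rhp_add_neq0 (ltW (Re_sinf halpha)).
have -> : (rc + sinf alpha) ^+ 2 * ((z - cayley (sinf alpha)) * (1 - cayley (sinf alpha) * z)) =
    rc ^+ 2 * (1 + z) ^+ 2 - sinf alpha ^+ 2 * (1 - z) ^+ 2.
  by rewrite /cayley; field.
by rewrite sinf_sqr den_polyE.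
Qed.

(** On the circle the numerator and the denominator thus share the factor [z], and what remains are
    the homogeneous coordinates of [arc_of_ray]. *)
Lemma circle_sqr z : cnorm z = 1 ->
  (1 + z) ^+ 2 = z * real_complex R (2 + 2 * complex.Re z) /\
  (1 - z) ^+ 2 = - z * real_complex R (2 - 2 * complex.Re z).
Proof.
move=> z1; have zz : z * conjc z = 1 by rewrite mulcJ z1 expr1n.
rewrite rcD [real_complex R (2 - _)]rcD rcN -!addrJ !rc_nat; split.
- have -> : z * (2 + (z + conjc z)) = z * conjc z + 2 * z + z ^+ 2 by ring.
  by rewrite zz; ring.
- have -> : - z * (2 - (z + conjc z)) = z * conjc z - 2 * z + z ^+ 2 by ring.
  by rewrite zz; ring.
Qed.

Lemma circle_Gamma z : cnorm z = 1 ->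
  den_poly.[z] != 0 /\ Gamma alpha (num_poly.[z] / den_poly.[z]).
Proof.
move=> z1; have zn : z != 0 by rewrite -cnorm_gt0 z1.
have [h1 h2] := circle_sqr z1; rewrite num_polyE den_polyE h1 h2.
have hz : -1 <= complex.Re z <= 1 by rewrite -ler_norml -z1 cnorm_Re.
set p := 2 + _; set q := 2 - _.
have q0 : 0 <= q by rewrite /q; lra.
have p0 : 0 <= rho ^+ 2 * p by rewrite mulr_ge0 ?sqr_ge0// /p; lra.
have pq : 0 < rho ^+ 2 * p + q.
  have r2 := exprn_gt0 2 rho_gt0.
  have q4 : q = 4 - p by rewrite /p /q; ring.
  have [p00|pn] := eqVneq p 0; first by rewrite q4 p00; lra.
  have : 0 < p by rewrite lt_neqAle eq_sym pn /p; lra.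
  by move=> pp; have := mulr_gt0 r2 pp; lra.
have dn := arc_den_neq0 halpha p0 q0 pq.
have G := arc_of_ray halpha p0 q0 pq.
have e1 : rc ^+ 2 * (z * real_complex R p) - e * (- z * real_complex R q) =
    z * (real_complex R (rho ^+ 2 * p) + real_complex R q * e).
  by rewrite !rcE; ring.
have e2 : e * rc ^+ 2 * (z * real_complex R p) - (- z * real_complex R q) =
    z * (real_complex R (rho ^+ 2 * p) * e + real_complex R q).
  by rewrite !rcE; ring.
rewrite e1 e2; split; first by rewrite mulf_neq0.
by rewrite -mulf_div divff// mul1r.
Qed.

Lemma Gamma_circle u : Gamma alpha u -> exists2 z, cnorm z = 1 &
  num_poly.[z] / den_poly.[z] = u.
Proof.
move=> hu; suff [z z1 hz] : exists2 z, cnorm z = 1 & num_poly.[z] = u * den_poly.[z].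
  by exists z => //; have [dn _] := circle_Gamma z1; rewrite hz mulfK.
have r2 := exprn_gt0 2 rho_gt0.
have [->|ue] := eqVneq u e.
  exists 1; first exact: cnorm1.
  by rewrite num_polyE den_polyE; ring.
have [mu mu0 hmu] := mob_on halpha hu ue.
(* The real part of the point sought: the solution of [rho ^+ 2 * (1 + c) = mu * (1 - c)]. *)
pose c := (mu - rho ^+ 2) / (mu + rho ^+ 2).
have d0 : 0 < mu + rho ^+ 2 by rewrite ltr_wpDl.
have c1 : -1 <= c <= 1.
  apply/andP; split; first by rewrite ler_pdivlMr//; lra.
  by rewrite ler_pdivrMr//; lra.
pose z : R[i] := Complex c (Num.sqrt (1 - c ^+ 2)).
have z1 : cnorm z = 1.
  apply/eqP; rewrite -(@eqrXn2 _ 2%N) ?cnorm_ge0// cnorm_sqr /= sqr_sqrtr; last nra.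
  by apply/eqP; ring.
exists z => //; have [h1 h2] := circle_sqr z1; rewrite num_polyE den_polyE h1 h2 /=.
apply/eqP; rewrite -subr_eq0; apply/eqP.
have hm : u * e - 1 = - real_complex R mu * (u - e).
  by rewrite -hmu /mob mulfVK// subr_eq0.
have hc : rho ^+ 2 * (2 + 2 * c) = mu * (2 - 2 * c).
  by rewrite /c; field; rewrite gt_eqF.
have -> : e * rc ^+ 2 * (z * real_complex R (2 + 2 * c)) -
   (- z * real_complex R (2 - 2 * c)) -
   u * (rc ^+ 2 * (z * real_complex R (2 + 2 * c)) - e * (- z * real_complex R (2 - 2 * c))) =
   z * (real_complex R (rho ^+ 2 * (2 + 2 * c)) * (e - u) - real_complex R (2 - 2 * c) * (u * e - 1)).
  by rewrite [in RHS]rcM rcX; ring.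
by rewrite hc hm rcM; ring.
Qed.

End Cayley.

Section SupNorm.
Variable R : realType.

Lemma le_sup_norm (K : set R[i]) (f : R[i] -> R[i]) (B : R) x :
  (forall y, K y -> cnorm (f y) <= B) -> K x -> cnorm (f x) <= sup_norm K f.
Proof.
move=> h Kx; apply: sup_upper_bound; last by exists x.
split; first by exists (cnorm (f x)); exists x.
by exists B => _ [y Ky <-]; exact: h.
Qed.

Lemma sup_norm_le (K : set R[i]) (f : R[i] -> R[i]) (B : R) x : K x ->
  (forall y, K y -> cnorm (f y) <= B) -> sup_norm K f <= B.
Proof.
move=> Kx h; apply: ge_sup; first by exists (cnorm (f x)); exists x.
by move=> _ [y Ky <-]; exact: h.
Qed.

End SupNorm.

(** * Convergence of the minimal norms, with abstract normalization at the base point *)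

Section Residual.
Variables (R : realType) (alpha beta : R) (k : nat) (u : 'I_k -> R[i]) (s0 : R[i]).
Hypothesis halpha : 0 < alpha < pi.
Hypothesis hu : forall j, 1 < cnorm (u j).
Hypothesis s0_gt0 : 0 < complex.Re s0.

Let e : R[i] := expi alpha.
Let rc := real_complex R (cnorm s0).
Let s j := sqrt_mob alpha (u j).
Let zj j := cayley s0 (s j).
Let a := cayley s0 (sinf alpha).
Let z0 := cayley s0 s0.
Let A := num_poly alpha s0.
Let D := den_poly alpha s0.

Let u_off j : ~ Gamma alpha (u j).
Proof. by move=> /(cnorm_Gamma halpha) h; have := hu j; rewrite h ltxx. Qed.

Let s_gt0 j : 0 < complex.Re (s j).
Proof. exact: Re_sqrt_mob. Qed.

Let zj_lt1 j : cnorm (zj j) < 1.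
Proof. exact: cnorm_cayley_lt1. Qed.

Let a_lt1 : cnorm a < 1.
Proof. by apply: cnorm_cayley_lt1 => //; exact: Re_sinf. Qed.

Let z0_lt1 : cnorm z0 < 1.
Proof. exact: cnorm_cayley_lt1. Qed.

Let z0J : conjc z0 = - z0.
Proof. exact: cayley_imag. Qed.

(** The numerator of [u - u j] vanishes at [zj j] and its inverse. On the circle [|z - zj j|] equals
    [|1 - conjc (zj j) * z|], so the inner zero can be reflected outside without changing the
    modulus; the resulting polynomial has real coefficients. *)
Definition weight_outer : {poly R[i]} :=
  \prod_(j < k) (((- zj j) *: 'X + 1%:P) * ((- conjc (zj j)) *: 'X + 1%:P)).

Definition weight_outer_rev : {poly R[i]} :=
  \prod_(j < k) (('X - (zj j)%:P) * ('X - (conjc (zj j))%:P)).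

Lemma weight_outerE z : weight_outer.[z] =
  \prod_(j < k) ((1 - zj j * z) * (1 - conjc (zj j) * z)).
Proof.
rewrite /weight_outer horner_prod; apply: eq_bigr => j _.
by rewrite hornerM !hornerD !hornerZ hornerX hornerC !(addrC _ 1) !mulNr.
Qed.

Lemma weight_outer_revE z : weight_outer_rev.[z] =
  \prod_(j < k) ((z - zj j) * (z - conjc (zj j))).
Proof.
rewrite /weight_outer_rev horner_prod; apply: eq_bigr => j _.
by rewrite hornerM !hornerXsubC.
Qed.

Lemma weight_outerJ z : conjc weight_outer.[z] = weight_outer.[conjc z].
Proof.
rewrite !weight_outerE rmorph_prod; apply: eq_bigr => j _.
by rewrite /= !conjcE mulrC.
Qed.

Lemma weight_outer_rev_inv z : z != 0 ->
  weight_outer_rev.[z] = z ^+ (2 * k) * weight_outer.[z^-1].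
Proof.
move=> zn; rewrite weight_outer_revE weight_outerE exprM.
have -> : (z ^+ 2) ^+ k = \prod_(j < k) z ^+ 2 by rewrite prodr_const card_ord.
rewrite -big_split /=; apply: eq_bigr => j _; by field.
Qed.

Lemma weight_outer_neq0 z : cnorm z <= 1 -> weight_outer.[z] != 0.
Proof.
move=> z1; rewrite weight_outerE; apply/prodf_neq0 => j _.
by rewrite mulf_neq0// one_sub_neq0// cnormJ.
Qed.

Lemma disc_alg_weight_outer_inv : disc_alg (fun z => weight_outer.[z]^-1).
Proof.
have h j : disc_alg (fun z => (1 - zj j * z)^-1 * (1 - conjc (zj j) * z)^-1).
  by apply: disc_algM; apply: disc_alg_inv; rewrite ?cnormJ.
apply: eq_disc_alg (disc_alg_prod (index_enum _) h) => z _.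
by rewrite weight_outerE -prodfV; apply: eq_bigr => j _; rewrite invfM.
Qed.

Lemma size_weight_outer : (size weight_outer <= (2 * k).+1)%N.
Proof.
rewrite /weight_outer.
have h (n : nat) (F : 'I_n -> {poly R[i]}) : (forall j, (size (F j) <= 3)%N) ->
    (size (\prod_(j < n) F j)%R <= (2 * n).+1)%N.
  elim: n F => [|n IH] F hF; first by rewrite big_ord0 size_poly1.
  rewrite big_ord_recr /=.
  have := size_mul_deg (IH _ (fun j => hF (widen_ord (leqnSn n) j))) (hF ord_max : (_ <= 2.+1)%N).
  by move=> h; apply: leq_trans h _; lia.
apply: h => j; exact: size_mul_deg (size_lin _ _) (size_lin _ _).
Qed.

Let W m z := outer a weight_outer m z.

Definition weight_scale m : R :=
  cnorm (rc + sinf alpha) ^+ (2 * m) *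
  \prod_(j < k) (cnorm (e - u j) * cnorm (rc + s j) ^+ 2).

Lemma weight_scale_gt0 m : 0 < weight_scale m.
Proof.
rewrite mulr_gt0//; last apply: prodr_gt0 => j _.
  rewrite exprn_gt0// cnorm_gt0 addrC; apply: (rhp_add_neq0 s0_gt0).
  exact: ltW (Re_sinf halpha).
rewrite mulr_gt0//.
  have [ue _] := mob_off halpha (@u_off j).
  by rewrite cnorm_gt0 subr_eq0 eq_sym.
by rewrite exprn_gt0// cnorm_gt0 addrC; apply: (rhp_add_neq0 s0_gt0); exact: ltW (s_gt0 j).
Qed.

(** In degree [m + k] the form has denominator [D ^+ (m + k)]. The weight, having [k] poles, cancels
    [k] of these factors, and the other [m] make up the power in [outer]. *)
Lemma weight_hom m (P : {poly R[i]}) z : (size P <= (m + k).+1)%N -> cnorm z = 1 ->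
  cnorm (weight beta u (A.[z] / D.[z]) * P.[A.[z] / D.[z]]) =
  cnorm (hom_poly A D (m + k) P).[z] / (weight_scale m * cnorm (W m z)).
Proof.
move=> Ps z1; have z1' : cnorm z <= 1 by rewrite z1.
have [D0 _] := circle_Gamma halpha s0_gt0 z1; rewrite -/D in D0.
have [NW NWE] : exists x, x = cnorm (W m z) by exists (cnorm (W m z)).
rewrite -NWE hom_polyE// /weight !cnormM cnorm_expi mul1r cnormV cnorm_prod cnormX.
have fac j : cnorm (A.[z] / D.[z] - u j) = cnorm (e - u j) * cnorm (rc + s j) ^+ 2 *
    (cnorm (1 - zj j * z) * cnorm (1 - conjc (zj j) * z)) / cnorm D.[z].
  have -> : A.[z] / D.[z] - u j = (A.[z] - u j * D.[z]) / D.[z] by field.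
  have [ue _] := mob_off halpha (@u_off j).
  rewrite (cayley_factor s0_gt0 z ue (sqrt_mob_sqr _ _) (s_gt0 j)) cnormf !(cnormX, cnormM).
  by rewrite -/(zj j) -(cnorm_sub_conj _ z1) [_ * cnorm (1 - zj j * z)]mulrC.
rewrite (eq_bigr _ (fun j _ => fac j)) prodf_div -/rc prodr_const card_ord.
rewrite big_split /=.
have hD : cnorm D.[z] = cnorm (rc + sinf alpha) ^+ 2 *
    (cnorm (1 - conjc a * z) * cnorm (1 - a * z)).
  by rewrite /D cayley_den_factor// !(cnormX, cnormM) -/a -(cnorm_sub_conj _ z1).
have hW : NW = (cnorm (1 - conjc a * z) * cnorm (1 - a * z)) ^+ m *
    \prod_(j < k) (cnorm (1 - zj j * z) * cnorm (1 - conjc (zj j) * z)).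
  rewrite NWE /W /outer cnormM cnormX cnormM weight_outerE cnorm_prod mulrC [in RHS]mulrC.
  by congr (_ * _ ^+ _); [apply: eq_bigr => j _; rewrite cnormM|rewrite mulrC].
have hDm : cnorm D.[z] ^+ m = cnorm (rc + sinf alpha) ^+ (2 * m) *
   (cnorm (1 - conjc a * z) * cnorm (1 - a * z)) ^+ m.
  by rewrite hD exprMn exprM.
have cD : cnorm D.[z] ^+ k != 0 by rewrite expf_neq0// cnorm_eq0.
have cW : NW != 0.
  by rewrite NWE cnorm_eq0 outer_neq0//; exact: weight_outer_neq0.
have cS : weight_scale m != 0 by rewrite gt_eqF// weight_scale_gt0.
move: cW cS; rewrite hW /weight_scale exprD hDm.
set x1 := _ ^+ (2 * m); set x2 := _ ^+ m; set x3 := \prod_(j < k) _; set x4 := \prod_(j < k) _.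
rewrite !mulf_eq0 !negb_or => /andP[x2n x3n] /andP[x1n x4n].
by field; rewrite x1n x2n x3n x4n cD.
Qed.

Let Nrm P := sup_norm (Gamma alpha) (fun z => weight beta u z * P.[z]).

Let Gamma_ne : Gamma alpha e. Proof. exact: Gamma_e. Qed.

Lemma weighted_norm_hom m (P : {poly R[i]}) z : (size P <= (m + k).+1)%N -> cnorm z = 1 ->
  cnorm (hom_poly A D (m + k) P).[z] <= Nrm P * weight_scale m * cnorm (W m z).
Proof.
move=> Ps z1; have z1' : cnorm z <= 1 by rewrite z1.
have [_ G] := circle_Gamma halpha s0_gt0 z1.
have cW y : cnorm y <= 1 -> 0 < cnorm (W m y).
  by move=> y1; rewrite cnorm_gt0 outer_neq0//; exact: weight_outer_neq0.
rewrite -mulrA -ler_pdivrMr; last by rewrite mulr_gt0 ?weight_scale_gt0 ?cW.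
rewrite -weight_hom//.
have [B B0 hB] := poly_disc_bounded (hom_poly A D (m + k) P).
have [B' B'0 hB'] := disc_alg_bounded (disc_alg_outer_inv a_lt1 disc_alg_weight_outer_inv m).
apply: (@le_sup_norm _ (Gamma alpha) (fun z => weight beta u z * P.[z])
  (B * (B' / weight_scale m))); last exact: G.
move=> x Gx; have [y y1 <-] := Gamma_circle halpha s0_gt0 Gx; rewrite -/A -/D.
have y1' : cnorm y <= 1 by rewrite y1.
rewrite (weight_hom Ps y1) invfM mulrCA [B * _]mulrA [leRHS]mulrC ler_wpM2l//.
  by rewrite invr_ge0 ltW// weight_scale_gt0.
by apply: ler_pM; rewrite ?invr_ge0 ?cnorm_ge0 ?hB// -cnormV hB'.
Qed.

Lemma hom_weighted_norm m (P : {poly R[i]}) (L : R) : (size P <= (m + k).+1)%N ->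
  (forall z, cnorm z = 1 ->
    cnorm (hom_poly A D (m + k) P).[z] <= L * weight_scale m * cnorm (W m z)) ->
  Nrm P <= L.
Proof.
move=> Ps h; apply: (sup_norm_le Gamma_ne) => x Gx.
have [y y1 <-] := Gamma_circle halpha s0_gt0 Gx; rewrite -/A -/D.
have y1' : cnorm y <= 1 by rewrite y1.
rewrite (weight_hom Ps y1) ler_pdivrMr; first by rewrite mulrA; exact: h.
rewrite mulr_gt0 ?weight_scale_gt0// cnorm_gt0 outer_neq0//; exact: weight_outer_neq0.
Qed.

Lemma hom_poly_recip m (P : {poly R[i]}) z : (size P <= (m + k).+1)%N -> cnorm z = 1 ->
  (hom_poly A D (m + k) P).[conjc z] =
    conjc z ^+ (2 * m + 2 * k) * (hom_poly A D (m + k) P).[z].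
Proof.
move=> Ps z1; have zn : z != 0 by rewrite -cnorm_gt0 z1.
have zz : z * conjc z = 1 by rewrite mulcJ z1 expr1n.
have hA : A.[conjc z] = conjc z ^+ 2 * A.[z].
  by rewrite /A !num_polyE (conjc_unit z1); field.
have hD : D.[conjc z] = conjc z ^+ 2 * D.[z].
  by rewrite /D !den_polyE (conjc_unit z1); field.
rewrite /hom_poly !horner_sum mulr_sumr; apply: eq_bigr => i _.
rewrite !hornerZ !hornerM !horner_exp hA hD [RHS]mulrCA; congr (_ * _).
rewrite exprMn [(_ * D.[z]) ^+ _]exprMn -!exprM.
have iln : (i <= m + k)%N by rewrite -ltnS.
have -> : conjc z ^+ (2 * m + 2 * k) = conjc z ^+ (2 * i) * conjc z ^+ (2 * (m + k - i)).
  by rewrite -exprD; congr (_ ^+ _); lia.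
by ring.
Qed.

(** Treats both kinds of base point at once: for a finite one [val] is the value there and [c0] is
    [D.[z0]]; for infinity [val] is the top coefficient and [c0] is [A.[z0]]. *)
Variables (c0 : R[i]) (val : nat -> {poly R[i]} -> R[i]) (T : nat -> {poly R[i]}).
Hypothesis c0_neq0 : c0 != 0.
Hypothesis val_hom : forall n (P : {poly R[i]}), (size P <= n.+1)%N ->
  (hom_poly A D n P).[z0] = val n P * c0 ^+ n.
Hypothesis valZ : forall n (P : {poly R[i]}) c, val n (c *: P) = c * val n P.
Hypothesis T_size : forall n, (size (T n) <= n.+1)%N.
Hypothesis T_val : forall n, val n (T n) = 1.
Hypothesis T_min : forall n (P : {poly R[i]}), (size P <= n.+1)%N -> val n P = 1 ->
  Nrm (T n) <= Nrm P.

Let l : R := 2 / (1 + cnorm z0 ^+ 2).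
Let X m := cnorm c0 ^+ (m + k) / (weight_scale m * cnorm (W m z0)).

Let W_gt0 m : 0 < cnorm (W m z0).
Proof. by rewrite cnorm_gt0 outer_neq0 ?ltW//; exact: weight_outer_neq0. Qed.

Let X_gt0 m : 0 < X m.
Proof.
rewrite /X divr_gt0//; first by rewrite exprn_gt0// cnorm_gt0.
by rewrite mulr_gt0// weight_scale_gt0.
Qed.

Let Nrm_ge0 P : 0 <= Nrm P.
Proof.
have Ps : (size P <= ((size P) + k).+1)%N by rewrite (leq_trans (leq_addr k _)).
have := weighted_norm_hom Ps (cnorm1 R).
move=> /(le_trans (cnorm_ge0 _)).
rewrite -mulrA pmulr_lge0// mulr_gt0 ?weight_scale_gt0// cnorm_gt0 outer_neq0 ?cnorm1//.
exact: weight_outer_neq0.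
Qed.

Lemma residual_lower (eps : R) : 0 < eps -> exists m0, forall m, (m0 <= m)%N ->
  1 <= Nrm (T (m + k)) / X m * (l^-1 + eps).
Proof.
move=> eps0.
have hrev z : cnorm z = 1 ->
    weight_outer_rev.[z] = z ^+ (2 * k) * conjc weight_outer.[z].
  move=> z1; have zn : z != 0 by rewrite -cnorm_gt0 z1.
  by rewrite weight_outer_rev_inv// weight_outerJ (conjc_unit z1).
have [m0 H] := outer_lower_bound z0J z0_lt1 a_lt1 weight_outerJ hrev
  weight_outer_neq0 disc_alg_weight_outer_inv eps0.
exists m0 => m hm; have Ts := T_size (m + k)%N.
have := H m (hom_poly A D (m + k) (T (m + k)%N)) (Nrm (T (m + k)%N) * weight_scale m) hm.
have h1 z : cnorm z = 1 -> _ := @hom_poly_recip m _ z Ts.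
move=> /(_ h1); rewrite mulr_ge0 ?Nrm_ge0 ?(ltW (weight_scale_gt0 _))//.
move=> /(_ isT (fun z => weighted_norm_hom Ts)).
rewrite val_hom// T_val mul1r cnormX => h.
have W0 := W_gt0 m; have S0 := weight_scale_gt0 m; have c0n : 0 < cnorm c0 ^+ (m + k).
  by rewrite exprn_gt0 ?cnorm_gt0.
have -> : l^-1 = (1 + cnorm z0 ^+ 2) / 2 by rewrite /l invf_div.
rewrite /X invf_div mulrA mulrAC ler_pdivlMr// mul1r.
by apply: le_trans h _; rewrite /W !mulrA.
Qed.

(** The competitor has the prescribed value at [z0] only up to a relative error [eps]; dividing by
    its true value costs the factor [1 - eps]. *)
Lemma residual_upper (eps : R) : 0 < eps < 1 -> exists m0, forall m, (m0 <= m)%N ->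
  Nrm (T (m + k)) / X m * (1 - eps) <= l + eps.
Proof.
move=> /andP[eps0 eps1].
have [m0 H] := outer_upper_bound z0J z0_lt1 a_lt1 weight_outerJ weight_outer_rev_inv
  weight_outer_neq0 size_weight_outer eps0.
exists m0 => m /H[P [Pr [Ps hPr hv hn]]].
have [a1 [a2 [b1 [b2 [XE X2E]]]]] := sqr_combination halpha s0_gt0.
have Ps' : (size P <= (2 * (m + k)).+1)%N by rewrite mulnDr.
have hPr' z : z != 0 -> Pr.[z] = z ^+ (2 * (m + k)) * P.[z^-1].
  by move=> zn; rewrite hPr// mulnDr.
have [Q Qs hQ] := is_form_half XE X2E Ps' hPr'.
set v := val (m + k) Q.
have hvQ : (P + Pr).[z0] = v * c0 ^+ (m + k) by rewrite -hQ val_hom.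
have W0 := W_gt0 m; have S0 := weight_scale_gt0 m.
have c0n : 0 < cnorm c0 ^+ (m + k) by rewrite exprn_gt0 ?cnorm_gt0.
have lowv : (1 - eps) * cnorm (W m z0) <= cnorm v * cnorm c0 ^+ (m + k).
  rewrite -cnormX -cnormM -hvQ.
  have := lerB_cnorm (W m z0) (W m z0 - (P + Pr).[z0]).
  by rewrite subKr cnormB; rewrite cnormB in hv *; rewrite -/(W m z0) in hv; lra.
have v0 : 0 < cnorm v.
  rewrite -(pmulr_lgt0 _ c0n); apply: lt_le_trans lowv; rewrite mulr_gt0// subr_gt0//.
have vn : v != 0 by rewrite -cnorm_gt0.
have Ns : (size (v^-1 *: Q) <= (m + k).+1)%N by rewrite (leq_trans (size_scale_leq _ _)).
have N1 : Nrm (T (m + k)) <= Nrm (v^-1 *: Q).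
  by apply: T_min => //; rewrite valZ mulVf.
have N2 : Nrm (v^-1 *: Q) <= (l + eps) / (cnorm v * weight_scale m).
  apply: hom_weighted_norm Ns _ => z z1.
  have -> : hom_poly A D (m + k) (v^-1 *: Q) = v^-1 *: hom_poly A D (m + k) Q.
    by rewrite /hom_poly scaler_sumr; apply: eq_bigr => i _; rewrite coefZ scalerA.
  rewrite hornerZ cnormM cnormV hQ.
  have -> : (l + eps) / (cnorm v * weight_scale m) * weight_scale m * cnorm (W m z) =
     (cnorm v)^-1 * ((l + eps) * cnorm (W m z)).
    by field; rewrite !gt_eqF.
  by rewrite ler_wpM2l ?invr_ge0 ?cnorm_ge0// hn.
have l0 : 0 <= l + eps by rewrite addr_ge0 ?(ltW eps0)// divr_ge0// addr_ge0// sqr_ge0.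
apply: (@le_trans _ _ ((l + eps) / (cnorm v * weight_scale m) / X m * (1 - eps))).
  rewrite ler_wpM2r ?subr_ge0 ?(ltW eps1)// ler_wpM2r ?invr_ge0 ?(ltW (X_gt0 m))//.
  exact: le_trans N1 N2.
have -> : (l + eps) / (cnorm v * weight_scale m) / X m * (1 - eps) =
    (l + eps) * (((1 - eps) * cnorm (W m z0)) / (cnorm v * cnorm c0 ^+ (m + k))).
  rewrite /X; field; by rewrite !gt_eqF.
by rewrite ler_piMr// ler_pdivrMr ?mul1r// mulr_gt0.
Qed.

Lemma residual_cvg :
  Nrm (T (m + k)) / X m @[m --> \oo] --> l.
Proof.
apply/cvgrPdist_le => eps eps0.
have l2 : l <= 2 by rewrite /l ler_pdivrMr ?ltr_wpDr ?sqr_ge0//; have := sqr_ge0 (cnorm z0); lra.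
have lpos : 0 < l by rewrite /l divr_gt0// ltr_wpDr ?sqr_ge0.
(* Since [l <= 2], both [l ^+ 2 * d <= eps] and [l + d <= (l + eps) * (1 - d)] follow. *)
pose d := eps / (4 + eps).
have d0 : 0 < d by rewrite divr_gt0// addr_gt0.
have d1 : d < 1 by rewrite ltr_pdivrMr ?addr_gt0//; lra.
have de : d * (4 + eps) = eps by rewrite mulfVK// gt_eqF// addr_gt0.
have [m1 H1] := residual_lower d0.
have [m2 H2] := residual_upper (introT andP (conj d0 d1)).
exists (maxn m1 m2) => // m /=; rewrite geq_max => /andP[/H1 h1 /H2 h2].
set r := Nrm _ / X m in h1 h2 *.
rewrite ler_distlC; apply/andP; split.
- have li : l * l^-1 = 1 by rewrite divff// gt_eqF.
  have i0 : 0 < l^-1 by rewrite invr_gt0.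
  have h3 : (l - l ^+ 2 * d) * (l^-1 + d) <= 1.
    have -> : (l - l ^+ 2 * d) * (l^-1 + d) = l * l^-1 - l * l^-1 * l * d + l * d - l ^+ 2 * d ^+ 2.
      by ring.
    by rewrite li mul1r subrK lerBlDr lerDl mulr_ge0 ?sqr_ge0.
  have h4 : l - l ^+ 2 * d <= r.
    rewrite -(@ler_pM2r _ (l^-1 + d)); last by rewrite addr_gt0.
    exact: le_trans h3 h1.
  have : l ^+ 2 * d <= 4 * d by rewrite ler_wpM2r ?(ltW d0)//; nra.
  nra.
- rewrite -(@ler_pM2r _ (1 - d)) ?subr_gt0//; apply: le_trans h2 _; nra.
Qed.

End Residual.

(** * Harmonic functions on the complement of the arc *)

Section Holomorphic.
Variable R : realType.
Implicit Types (f g : R[i] -> R[i]) (z d h : R[i]) (U : set R[i]).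

Definition cderiv f z d := forall eps : R, 0 < eps -> exists2 del : R, 0 < del &
  forall h, cnorm h <= del -> cnorm (f (z + h) - f z - d * h) <= eps * cnorm h.

Definition ccont f z := forall eps : R, 0 < eps -> exists2 del : R, 0 < del &
  forall h, cnorm h <= del -> cnorm (f (z + h) - f z) <= eps.

Definition copen U := forall z, U z -> exists2 del : R, 0 < del &
  forall h, cnorm h <= del -> U (z + h).

Lemma cderiv_ccont f z d : cderiv f z d -> ccont f z.
Proof.
move=> hf eps eps0; have [del del0 H] := hf 1 ltr01.
have d0 := cnorm_ge0 d.
have c0 : 0 < 1 + cnorm d by rewrite ltr_wpDr.
exists (Num.min del (eps / (1 + cnorm d))); first by rewrite lt_min del0 divr_gt0.
move=> h; rewrite le_min => /andP[/H h1 h2].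
have -> : f (z + h) - f z = (f (z + h) - f z - d * h) + d * h by rewrite subrK.
apply: le_trans (ler_cnormD _ _) _; rewrite cnormM.
move: h2; rewrite ler_pdivlMr//; lra.
Qed.

Lemma ccont_cst d z : ccont (fun=> d) z.
Proof. by move=> eps eps0; exists 1 => // h _; rewrite subrr cnorm0 ltW. Qed.

Lemma ccontD f g z : ccont f z -> ccont g z -> ccont (fun w => f w + g w) z.
Proof.
move=> hf hg eps eps0; have e2 : 0 < eps / 2 by lra.
have [d1 d10 H1] := hf _ e2; have [d2 d20 H2] := hg _ e2.
exists (Num.min d1 d2); first by rewrite lt_min d10.
move=> h; rewrite le_min => /andP[/H1 h1 /H2 h2].
rewrite opprD addrACA; apply: le_trans (ler_cnormD _ _) _; lra.
Qed.

Lemma ccontM f g z : ccont f z -> ccont g z -> ccont (fun w => f w * g w) z.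
Proof.
move=> hf hg eps eps0.
have f0 := cnorm_ge0 (f z); have g0 := cnorm_ge0 (g z).
have c0 : 0 < 1 + cnorm (f z) + cnorm (g z) by lra.
pose e := Num.min 1 (eps / (1 + cnorm (f z) + cnorm (g z))).
have e0 : 0 < e by rewrite lt_min ltr01 divr_gt0.
have [d1 d10 H1] := hf _ e0; have [d2 d20 H2] := hg _ e0.
exists (Num.min d1 d2); first by rewrite lt_min d10.
move=> h; rewrite le_min => /andP[/H1 h1 /H2 h2].
have -> : f (z + h) * g (z + h) - f z * g z = (f (z + h) - f z) * (g (z + h) - g z) +
  f z * (g (z + h) - g z) + (f (z + h) - f z) * g z by ring.
apply: le_trans (ler_cnormD _ _) _; rewrite !cnormM.
have := ler_cnormD ((f (z + h) - f z) * (g (z + h) - g z)) (f z * (g (z + h) - g z)).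
rewrite !cnormM => h3.
have e1 : e <= 1 by rewrite ge_min lexx.
have h4 : cnorm (f (z + h) - f z) * cnorm (g (z + h) - g z) <= 1 * e.
  by apply: ler_pM; rewrite ?cnorm_ge0//; apply: le_trans e1.
have h5 : cnorm (f z) * cnorm (g (z + h) - g z) <= cnorm (f z) * e by rewrite ler_wpM2l.
have h6 : cnorm (f (z + h) - f z) * cnorm (g z) <= e * cnorm (g z) by rewrite ler_wpM2r.
have h7 : e * (1 + cnorm (f z) + cnorm (g z)) <= eps.
  by rewrite -ler_pdivlMr// ge_min lexx orbT.
lra.
Qed.

Lemma ccont_neq0 f z : ccont f z -> f z != 0 -> exists2 del : R, 0 < del &
  forall h, cnorm h <= del -> cnorm (f z) / 2 <= cnorm (f (z + h)).
Proof.
move=> hf fz; have e0 : 0 < cnorm (f z) / 2 by rewrite divr_gt0// cnorm_gt0.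
have [d d0 H] := hf _ e0; exists d => // h /H h1.
by have := lerB_cnorm (f z) (f (z + h)); rewrite [cnorm (f z - _)]cnormB; lra.
Qed.

Lemma ccontV f z : ccont f z -> f z != 0 -> ccont (fun w => (f w)^-1) z.
Proof.
move=> hf fz eps eps0; have [d1 d10 H1] := ccont_neq0 hf fz.
have f0 : 0 < cnorm (f z) by rewrite cnorm_gt0.
have e0 : 0 < eps * (cnorm (f z) ^+ 2 / 2) by rewrite !mulr_gt0// exprn_gt0.
have [d2 d20 H2] := hf _ e0; exists (Num.min d1 d2); first by rewrite lt_min d10.
move=> h; rewrite le_min => /andP[/H1 h1 /H2 h2].
have fh : 0 < cnorm (f (z + h)) by apply: lt_le_trans h1; rewrite divr_gt0.
have fhn : f (z + h) != 0 by rewrite -cnorm_gt0.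
have -> : (f (z + h))^-1 - (f z)^-1 = - (f (z + h) - f z) / (f (z + h) * f z).
  by field; rewrite fz fhn.
rewrite cnormf cnormN cnormM ler_pdivrMr ?mulr_gt0//.
apply: le_trans h2 _; rewrite ler_pM2l// expr2 mulrAC ler_pM2r//.
Qed.

Lemma cderiv_cst c z : cderiv (fun=> c) z 0.
Proof.
by move=> eps eps0; exists 1 => // h _; rewrite subrr sub0r mul0r oppr0 cnorm0 mulr_ge0 ?cnorm_ge0 ?ltW.
Qed.

Lemma cderiv_id z : cderiv id z 1.
Proof.
move=> eps eps0; exists 1 => // h _.
have -> : z + h - z - 1 * h = 0 by ring.
by rewrite cnorm0 mulr_ge0 ?cnorm_ge0 ?ltW.
Qed.

Lemma cderivD f g z d e : cderiv f z d -> cderiv g z e ->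
  cderiv (fun w => f w + g w) z (d + e).
Proof.
move=> hf hg eps eps0; have e2 : 0 < eps / 2 by lra.
have [d1 d10 H1] := hf _ e2; have [d2 d20 H2] := hg _ e2.
exists (Num.min d1 d2); first by rewrite lt_min d10.
move=> h; rewrite le_min => /andP[/H1 h1 /H2 h2].
have -> : f (z + h) + g (z + h) - (f z + g z) - (d + e) * h =
  (f (z + h) - f z - d * h) + (g (z + h) - g z - e * h) by ring.
apply: le_trans (ler_cnormD _ _) _; lra.
Qed.

Lemma cderivM f g z d e : cderiv f z d -> cderiv g z e ->
  cderiv (fun w => f w * g w) z (d * g z + f z * e).
Proof.
move=> hf hg eps eps0.
have f0 := cnorm_ge0 (f z); have g0 := cnorm_ge0 (g z); have dd0 := cnorm_ge0 d.
have c0 : 0 < 1 + cnorm (f z) + cnorm (g z) + cnorm d by lra.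
pose a := eps / (1 + cnorm (f z) + cnorm (g z) + cnorm d).
have a0 : 0 < a by rewrite divr_gt0.
have aE : a * (1 + cnorm (f z) + cnorm (g z) + cnorm d) = eps by rewrite mulfVK// gt_eqF.
have m0 : 0 < Num.min a 1 by rewrite lt_min a0 ltr01.
have [d1 d10 H1] := hf _ a0; have [d2 d20 H2] := hg _ a0.
have [d3 d30 H3] := cderiv_ccont hg m0.
exists (Num.min d1 (Num.min d2 d3)); first by rewrite !lt_min d10 d20.
move=> h; rewrite !le_min => /andP[/H1 h1 /andP[/H2 h2 /H3]]; rewrite le_min => /andP[h3 h3'].
have -> : f (z + h) * g (z + h) - f z * g z - (d * g z + f z * e) * h =
   (f (z + h) - f z - d * h) * g z + f z * (g (z + h) - g z - e * h) +
   (f (z + h) - f z - d * h) * (g (z + h) - g z) + d * h * (g (z + h) - g z) by ring.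
set x1 := f (z + h) - f z - d * h in h1 *; set x2 := g (z + h) - g z - e * h in h2 *.
set x3 := g (z + h) - g z in h3 h3' *.
have h0 := cnorm_ge0 h.
have k1 : cnorm x1 * cnorm (g z) <= a * cnorm h * cnorm (g z) by rewrite ler_wpM2r.
have k2 : cnorm (f z) * cnorm x2 <= cnorm (f z) * (a * cnorm h) by rewrite ler_wpM2l.
have k3 : cnorm x1 * cnorm x3 <= a * cnorm h * 1 by apply: ler_pM; rewrite ?cnorm_ge0.
have k4 : cnorm d * cnorm h * cnorm x3 <= cnorm d * cnorm h * a.
  by rewrite ler_wpM2l// mulr_ge0.
apply: le_trans (ler_cnormD _ _) _.
have := ler_cnormD (x1 * g z + f z * x2) (x1 * x3).
have := ler_cnormD (x1 * g z) (f z * x2).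
rewrite !cnormM -aE; lra.
Qed.

Lemma cderivV f z d : cderiv f z d -> f z != 0 ->
  cderiv (fun w => (f w)^-1) z (- d * ((f z)^-1 * (f z)^-1)).
Proof.
move=> hf fz eps eps0; have [d1 d10 H1] := ccont_neq0 (cderiv_ccont hf) fz.
have f0 : 0 < cnorm (f z) by rewrite cnorm_gt0.
have dd0 := cnorm_ge0 d.
have e1 : 0 < eps * cnorm (f z) / 2 by rewrite divr_gt0// mulr_gt0.
have [d2 d20 H2] := ccontV (cderiv_ccont hf) fz (divr_gt0 e1 (ltr_wpDl dd0 ltr01)).
have e2 : 0 < eps * cnorm (f z) ^+ 2 / 4 by rewrite divr_gt0// mulr_gt0// exprn_gt0.
have [d3 d30 H3] := hf _ e2.
exists (Num.min d1 (Num.min d2 d3)); first by rewrite !lt_min d10 d20.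
move=> h; rewrite !le_min => /andP[/H1 h1 /andP[/H2 h2 /H3 h3]].
have fh : 0 < cnorm (f (z + h)) by apply: lt_le_trans h1; rewrite divr_gt0.
have fhn : f (z + h) != 0 by rewrite -cnorm_gt0.
have h0 := cnorm_ge0 h.
have -> : (f (z + h))^-1 - (f z)^-1 - - d * ((f z)^-1 * (f z)^-1) * h =
   - (f (z + h) - f z - d * h) / (f (z + h) * f z) -
   d * h * ((f (z + h))^-1 - (f z)^-1) / f z by field; rewrite fz fhn.
apply: le_trans (ler_cnormB _ _) _.
rewrite !cnormf !cnormM cnormN.
have k1 : cnorm (f (z + h) - f z - d * h) / (cnorm (f (z + h)) * cnorm (f z)) <= eps / 2 * cnorm h.
  rewrite ler_pdivrMr ?mulr_gt0//; apply: le_trans h3 _.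
  have -> : eps * cnorm (f z) ^+ 2 / 4 * cnorm h = eps / 2 * cnorm h * (cnorm (f z) / 2 * cnorm (f z)).
    by field.
  by rewrite ler_wpM2l ?mulr_ge0 ?divr_ge0 ?(ltW eps0)// ler_wpM2r// ltW.
have k2 : cnorm d * cnorm h * cnorm ((f (z + h))^-1 - (f z)^-1) / cnorm (f z) <= eps / 2 * cnorm h.
  rewrite ler_pdivrMr//.
  have h4 : (cnorm d + 1) * cnorm ((f (z + h))^-1 - (f z)^-1) <= eps * cnorm (f z) / 2.
    by rewrite mulrC -ler_pdivlMr// ltr_wpDl.
  have h5 := cnorm_ge0 ((f (z + h))^-1 - (f z)^-1).
  have -> : eps / 2 * cnorm h * cnorm (f z) = cnorm h * (eps * cnorm (f z) / 2) by field.
  rewrite mulrAC [leLHS]mulrC; apply: ler_wpM2l => //; lra.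
lra.
Qed.

(** A chain of [n] complex derivatives, the last one continuous. Harmonicity needs two, so closure
    under the operations by induction on [n] is enough, without power series. *)
Fixpoint holn n U f : Prop :=
  if n is m.+1 then exists2 f', (forall z, U z -> cderiv f z (f' z)) & holn m U f'
  else forall z, U z -> ccont f z.

Lemma holn_ccont n U f z : holn n U f -> U z -> ccont f z.
Proof. by case: n => [|n] /=; [exact|move=> [f' h _] /h /cderiv_ccont]. Qed.

Lemma holnS n U f : holn n.+1 U f -> holn n U f.
Proof.
elim: n f => [|n IH] f; first by move=> h z; exact: (holn_ccont h).
by move=> [f' h1 h2]; exists f' => //; exact: IH.
Qed.

Lemma holn_cst n U c : holn n U (fun=> c).
Proof.
elim: n c => [|n IH] c; first by move=> z _; exact: ccont_cst.
by exists (fun=> 0) => // z _; exact: cderiv_cst.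
Qed.

Lemma holn_id n U : holn n U id.
Proof.
case: n => [|n]; first by move=> z _; exact: cderiv_ccont (cderiv_id z).
by exists (fun=> 1); [move=> z _; exact: cderiv_id|exact: holn_cst].
Qed.

Lemma holnD n U f g : holn n U f -> holn n U g -> holn n U (fun z => f z + g z).
Proof.
elim: n f g => [|n IH] f g; first by move=> hf hg z Uz; exact: ccontD (hf z Uz) (hg z Uz).
move=> [f' hf hf'] [g' hg hg']; exists (fun z => f' z + g' z); last exact: IH.
by move=> z Uz; exact: cderivD (hf z Uz) (hg z Uz).
Qed.

Lemma holnM n U f g : holn n U f -> holn n U g -> holn n U (fun z => f z * g z).
Proof.
elim: n f g => [|n IH] f g; first by move=> hf hg z Uz; exact: ccontM (hf z Uz) (hg z Uz).
move=> hf0 hg0; have hfn := holnS hf0; have hgn := holnS hg0.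
case: hf0 => [f' hf hf']; case: hg0 => [g' hg hg'].
exists (fun z => f' z * g z + f z * g' z); last by apply: holnD; exact: IH.
by move=> z Uz; exact: cderivM (hf z Uz) (hg z Uz).
Qed.

Lemma holnV n U f : (forall z, U z -> f z != 0) -> holn n U f ->
  holn n U (fun z => (f z)^-1).
Proof.
move=> fn; elim: n => [|n IH]; first by move=> hf z Uz; exact: ccontV (hf z Uz) (fn z Uz).
move=> hf0; have hi := IH (holnS hf0); case: hf0 => [f' hf hf'].
exists (fun z => - f' z * ((f z)^-1 * (f z)^-1)).
  by move=> z Uz; exact: cderivV (hf z Uz) (fn z Uz).
apply: holnM; last exact: holnM.
have := holnM (holn_cst n U (-1)) hf'.
by congr (holn n U _); apply/funext => z; rewrite mulN1r.
Qed.

Lemma holn_prod n U (I : Type) (r : seq I) (F : I -> R[i] -> R[i]) :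
  (forall i, holn n U (F i)) -> holn n U (fun z => \prod_(i <- r) F i z).
Proof.
move=> h; elim: r => [|i r IH].
  by have := holn_cst n U 1; congr (holn n U _); apply/funext => z; rewrite big_nil.
by have := holnM (h i) IH; congr (holn n U _); apply/funext => z; rewrite big_cons.
Qed.

Section Sqrt.
Variables (U : set R[i]) (m s : R[i] -> R[i]).
Hypothesis Uo : copen U.
Hypothesis sE : forall z, U z -> s z ^+ 2 = m z.
Hypothesis s_gt0 : forall z, U z -> 0 < complex.Re (s z).

(** Values in the right half-plane cannot cancel, so [s w - s z] is controlled by the difference of
    squares [m w - m z]: positivity of the real part alone makes the square root continuous and
    differentiable. *)
Let add_s z w : U z -> U w -> complex.Re (s z) <= cnorm (s w + s z).
Proof.
move=> Uz Uw; apply: le_trans (Re_le_cnorm _); rewrite raddfD /= lerDr ltW//.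
exact: s_gt0.
Qed.

Let s_lip z w : U z -> U w -> cnorm (s w - s z) * complex.Re (s z) <= cnorm (m w - m z).
Proof.
move=> Uz Uw; rewrite -!sE// subr_sqr cnormM ler_wpM2l ?cnorm_ge0//; exact: add_s.
Qed.

Lemma ccont_sqrt z : U z -> ccont m z -> ccont s z.
Proof.
move=> Uz hm eps eps0; have r0 := s_gt0 Uz.
have [d1 d10 H1] := Uo Uz; have [d2 d20 H2] := hm _ (mulr_gt0 eps0 r0).
exists (Num.min d1 d2); first by rewrite lt_min d10.
move=> h; rewrite le_min => /andP[/H1 h1 /H2 h2].
by rewrite -(ler_pM2r r0); apply: le_trans h2; exact: s_lip.
Qed.

Lemma cderiv_sqrt z d : U z -> cderiv m z d -> cderiv s z (d * (2 * s z)^-1).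
Proof.
move=> Uz hm eps eps0; have r0 := s_gt0 Uz; set r := complex.Re _ in r0.
have dd0 := cnorm_ge0 d.
have sn : s z != 0 by apply/eqP => h0; move: r0; rewrite /r h0 ltxx.
have e1 : 0 < eps * r / 2 by rewrite divr_gt0// mulr_gt0.
have [d1 d10 H1] := Uo Uz; have [d2 d20 H2] := hm _ e1.
have e2 : 0 < eps * r ^+ 2 / (cnorm d + 1) by rewrite divr_gt0 ?mulr_gt0 ?exprn_gt0// ltr_wpDl.
have [d3 d30 H3] := ccont_sqrt Uz (cderiv_ccont hm) e2.
exists (Num.min d1 (Num.min d2 d3)); first by rewrite !lt_min d10 d20.
move=> h; rewrite !le_min => /andP[/H1 Uh /andP[/H2 h2 /H3 h3]].
have h0 := cnorm_ge0 h.
have hadd := add_s Uz Uh; rewrite -/r in hadd.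
have addn : s (z + h) + s z != 0 by rewrite -cnorm_gt0; apply: lt_le_trans hadd.
have -> : s (z + h) - s z - d * (2 * s z)^-1 * h =
   (m (z + h) - m z - d * h) / (s (z + h) + s z) -
   d * h * (s (z + h) - s z) / ((s (z + h) + s z) * (2 * s z)).
  by rewrite -!sE//; field; rewrite addn sn.
have hs : r <= cnorm (s z) by exact: Re_le_cnorm.
apply: le_trans (ler_cnormB _ _) _; rewrite !cnormf !cnormM cnorm_nat.
have a0 : 0 < cnorm (s (z + h) + s z) by rewrite cnorm_gt0.
have k1 : cnorm (m (z + h) - m z - d * h) / cnorm (s (z + h) + s z) <= eps / 2 * cnorm h.
  rewrite ler_pdivrMr//; apply: le_trans h2 _.
  have -> : eps * r / 2 * cnorm h = eps / 2 * cnorm h * r by field.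
  by rewrite ler_wpM2l// mulr_ge0// divr_ge0// ltW.
have k2 : cnorm d * cnorm h * cnorm (s (z + h) - s z) /
    (cnorm (s (z + h) + s z) * (2 * cnorm (s z))) <= eps / 2 * cnorm h.
  rewrite ler_pdivrMr ?mulr_gt0 ?cnorm_gt0//.
  have k3 : (cnorm d + 1) * cnorm (s (z + h) - s z) <= eps * r ^+ 2.
    by rewrite mulrC -ler_pdivlMr// ltr_wpDl.
  have k4 : r * r <= cnorm (s (z + h) + s z) * cnorm (s z).
    by apply: ler_pM => //; exact: ltW.
  have k5 := cnorm_ge0 (s (z + h) - s z).
  have -> : eps / 2 * cnorm h * (cnorm (s (z + h) + s z) * (2 * cnorm (s z))) =
     cnorm h * (eps * (cnorm (s (z + h) + s z) * cnorm (s z))) by field.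
  rewrite mulrAC [leLHS]mulrC; apply: ler_wpM2l => //.
  apply: (@le_trans _ _ (eps * r ^+ 2)); first lra.
  by rewrite ler_pM2l// expr2.
lra.
Qed.

Lemma holn_sqrt n : holn n U m -> holn n U s.
Proof.
elim: n => [|n IH]; first by move=> h z Uz; apply: ccont_sqrt => //; exact: h.
move=> hm; have hs := IH (holnS hm); case: hm => [m' h1 h2].
exists (fun z => m' z * (2 * s z)^-1); first by move=> z Uz; apply: cderiv_sqrt => //; exact: h1.
apply: holnM => //; apply: holnV; last by apply: holnM => //; exact: holn_cst.
move=> z Uz; rewrite mulf_neq0 ?pnatr_eq0//; apply/eqP => h0.
by have := s_gt0 Uz; rewrite h0 ltxx.
Qed.

End Sqrt.

End Holomorphic.

(** * Harmonicity of logarithms of moduli *)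

Section HarmonicPlane.
Variable R : realType.
Implicit Types (f : R[i] -> R[i]) (G : R[i] -> R) (z d h : R[i]) (p q : R * R) (U : set R[i]).

Lemma C_ofD p q : C_of (p + q) = C_of p + C_of q.
Proof. by apply/eqP; rewrite eq_complex /= !eqxx. Qed.

Lemma C_ofZ (t : R) p : C_of (t *: p) = real_complex R t * C_of p.
Proof. by apply/eqP; rewrite eq_complex /=; apply/andP; split; apply/eqP; rewrite /GRing.scale /=; ring. Qed.

Lemma C_of_surj z : C_of (complex.Re z, complex.Im z) = z.
Proof. by case: z. Qed.

Lemma nbhs_C_of p (A : set (R * R)) : nbhs p A <->
  exists2 r : R, 0 < r & forall q, cnorm (C_of q - C_of p) <= r -> A q.
Proof.
split.
- move=> /nbhs_ballP[r /= r0 hr]; exists (r / 2); first by rewrite divr_gt0.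
  move=> q hq; apply: hr; have r2 : r / 2 < r by rewrite ltr_pdivrMr// ltr_pMr// ltr1n.
  split; rewrite /ball /= distrC; apply: le_lt_trans r2; apply: le_trans hq.
    exact: (cnorm_Re (C_of q - C_of p)).
  exact: (cnorm_Im (C_of q - C_of p)).
- move=> [r r0 hr]; apply/nbhs_ballP; exists (r / 2); first by rewrite /= divr_gt0.
  move=> q [/= h1 h2]; apply: hr; apply: le_trans (cnorm_le_ReIm _) _ => /=.
  by move: h1 h2; rewrite /ball /= [ `|p.1 - _| ]distrC [ `|p.2 - _| ]distrC; lra.
Qed.

(** Real differentiability, with the gradient coded as the single complex number [G_x - i G_y]. *)
Definition rderiv G z d := forall eps : R, 0 < eps -> exists2 del : R, 0 < del &
  forall h, cnorm h <= del -> `|G (z + h) - G z - complex.Re (d * h)| <= eps * cnorm h.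

Lemma rderiv_Re f z d : cderiv f z d -> rderiv (fun w => complex.Re (f w)) z d.
Proof.
move=> hf eps eps0; have [del del0 H] := hf _ eps0; exists del => // h /H h1.
apply: le_trans h1; apply: le_trans (cnorm_Re _).
by rewrite !raddfB.
Qed.

Lemma ln_1D_bound (x : R) : `|x| <= 1 / 2 -> `|ln (1 + x) - x| <= 2 * x ^+ 2.
Proof.
rewrite ler_norml => /andP[x1 x2]; have p0 : 0 < 1 + x by lra.
have up : ln (1 + x) <= x by apply: le_ln1Dx; lra.
have lo : 1 - (1 + x)^-1 <= ln (1 + x).
  have := @le_ln1Dx R ((1 + x)^-1 - 1).
  rewrite (_ : 1 + ((1 + x)^-1 - 1) = (1 + x)^-1); last by ring.
  rewrite lnV ?posrE// => h; have : 0 < (1 + x)^-1 by rewrite invr_gt0.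
  by move=> h2; have h3 : -1 < (1 + x)^-1 - 1 by [lra]; have := h h3; lra.
have e1 : 1 - (1 + x)^-1 - x = - (x ^+ 2 / (1 + x)).
  by field; rewrite gt_eqF.
have e2 : x ^+ 2 / (1 + x) <= 2 * x ^+ 2.
  rewrite ler_pdivrMr//; have := sqr_ge0 x; nra.
rewrite ler_norml; apply/andP; split; last by have := sqr_ge0 x; lra.
lra.
Qed.

(** With [|1 + h| ^ 2 = 1 + x] and [|x| <= 3 |h|], the error is at most [x ^ 2 + |h| ^ 2 / 2]. *)
Lemma ln_cnorm_bound h : cnorm h <= 1 / 6 ->
  `|ln (cnorm (1 + h)) - complex.Re h| <= 10 * cnorm h ^+ 2.
Proof.
move=> h1; have h0 := cnorm_ge0 h; have hR := cnorm_Re h.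
have hx : cnorm (1 + h) ^+ 2 = 1 + (2 * complex.Re h + cnorm h ^+ 2).
  by rewrite !cnorm_sqr; case: h {h1 h0 hR} => a b /=; ring.
set x := 2 * _ + _ in hx; have x3 : `|x| <= 3 * cnorm h.
  apply: le_trans (ler_normD _ _) _; rewrite normrM (ger0_norm (ler0n _ 2)).
  rewrite [ `|cnorm h ^+ 2| ]ger0_norm ?sqr_ge0//; nra.
have x2 : `|x| <= 1 / 2 by lra.
have c0 : 0 < cnorm (1 + h).
  have := lerB_cnorm 1 (- h); rewrite opprK cnorm1 cnormN; lra.
have L : ln (cnorm (1 + h)) = ln (1 + x) / 2.
  by rewrite -hx lnXn// mulr2n -mulr2n -[_ *+ 2]mulr_natr; field.
have := ln_1D_bound x2; rewrite L => hb.
have : x ^+ 2 <= (3 * cnorm h) ^+ 2.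
  by rewrite -real_normK ?num_real// lerXn2r ?nnegrE ?mulr_ge0.
move=> hx2; have h9 : (3 * cnorm h) ^+ 2 = 9 * cnorm h ^+ 2 by ring.
rewrite h9 in hx2; have xE : x = 2 * complex.Re h + cnorm h ^+ 2 by [].
move: hb; rewrite !ler_norml => /andP[b1 b2]; apply/andP; split; lra.
Qed.

(** The logarithmic derivative, obtained from [f (z + h) = f z * (1 + eta)] without choosing a
    branch of the complex logarithm. *)
Lemma rderiv_ln f z d : cderiv f z d -> f z != 0 ->
  rderiv (fun w => ln (cnorm (f w))) z (d / f z).
Proof.
move=> hf fz eps eps0.
have f0 : 0 < cnorm (f z) by rewrite cnorm_gt0.
have dd0 := cnorm_ge0 d.
pose K := cnorm d / cnorm (f z) + 1.
have K0 : 0 < K by rewrite ltr_wpDl// divr_ge0// ltW.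
have e1 : 0 < Num.min (cnorm (f z)) (eps * cnorm (f z) / 2).
  by rewrite lt_min f0 divr_gt0// mulr_gt0.
have [d1 d10 H1] := hf _ e1.
pose del := Num.min d1 (Num.min (1 / (6 * K)) (eps / (20 * K ^+ 2))).
exists del; first by rewrite !lt_min d10 !divr_gt0 ?mulr_gt0 ?exprn_gt0.
move=> h; rewrite !le_min => /andP[/H1 h1 /andP[h2 h3]].
have h0 := cnorm_ge0 h.
pose eta := (f (z + h) - f z) / f z.
have fE : f (z + h) = f z * (1 + eta) by rewrite /eta; field.
set r := f (z + h) - f z - d * h in h1.
have etaE : eta = r / f z + d / f z * h by rewrite /eta /r; field.
have r1 : cnorm r <= cnorm (f z) * cnorm h.
  by apply: le_trans h1 _; rewrite ler_wpM2r// ge_min lexx.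
have r2 : cnorm (r / f z) <= eps / 2 * cnorm h.
  rewrite cnormf ler_pdivrMr//; apply: le_trans h1 _.
  have -> : eps / 2 * cnorm h * cnorm (f z) = eps * cnorm (f z) / 2 * cnorm h by field.
  by rewrite ler_wpM2r// ge_min lexx orbT.
have etaK : cnorm eta <= K * cnorm h.
  rewrite etaE; apply: le_trans (ler_cnormD _ _) _.
  have -> : cnorm (d / f z * h) = cnorm d / cnorm (f z) * cnorm h by rewrite !cnormM cnormV.
  have : cnorm (r / f z) <= cnorm h by rewrite cnormf ler_pdivrMr// mulrC.
  have -> : K * cnorm h = cnorm d / cnorm (f z) * cnorm h + cnorm h by rewrite /K; ring.
  lra.
have eta6 : cnorm eta <= 1 / 6.
  apply: le_trans etaK _; move: h2; rewrite ler_pdivlMr ?mulr_gt0//; lra.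
have e0 : 1 + eta != 0.
  apply/eqP => e0; have := lerB_cnorm 1 (- eta); rewrite opprK e0 cnorm0 cnorm1 cnormN; lra.
have -> : ln (cnorm (f (z + h))) - ln (cnorm (f z)) = ln (cnorm (1 + eta)).
  by rewrite fE cnormM lnM ?posrE ?cnorm_gt0// addrAC subrr add0r.
have := ln_cnorm_bound eta6 => hb.
have -> : ln (cnorm (1 + eta)) - complex.Re (d / f z * h) =
   (ln (cnorm (1 + eta)) - complex.Re eta) + complex.Re (r / f z).
  by rewrite etaE [complex.Re (_ + _)]raddfD /=; ring.
apply: le_trans (ler_normD _ _) _.
have hr := cnorm_Re (r / f z).
have : 10 * cnorm eta ^+ 2 <= eps / 2 * cnorm h.
  apply: (@le_trans _ _ (10 * (K * cnorm h) ^+ 2)).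
    by rewrite ler_pM2l// lerXn2r ?nnegrE ?cnorm_ge0// mulr_ge0// ltW.
  move: h3; rewrite ler_pdivlMr ?mulr_gt0 ?exprn_gt0// => h3.
  have -> : 10 * (K * cnorm h) ^+ 2 = (cnorm h * (20 * K ^+ 2)) / 2 * cnorm h by field.
  by rewrite ler_wpM2r//; lra.
lra.
Qed.

Lemma is_derive_rderiv G p d b : rderiv G (C_of p) d ->
  is_derive p (axis R b) (G \o @C_of R) (complex.Re (d * C_of (axis R b))).
Proof.
move=> hG; have v1 : cnorm (C_of (axis R b)) = 1.
  by rewrite /cnorm; case: b; rewrite /= expr0n expr1n ?addr0 ?add0r sqrtr1.
set l := complex.Re _.
have cvg1 : (fun h : R => h^-1 *: (((G \o @C_of R) \o shift p) (h *: axis R b) -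
    (G \o @C_of R) p)) @ 0^' --> l.
  apply/cvgrPdist_le => eps eps0; have [del del0 H] := hG _ eps0.
  near=> h.
  have hn : h != 0 by near: h; exact: nbhs_dnbhs_neq.
  have hd : `|h| <= del by near: h; exact: dnbhs0_le.
  rewrite /= C_ofD C_ofZ.
  have hh : cnorm (real_complex R h * C_of (axis R b)) = `|h|.
    by rewrite cnormM cnorm_real v1 mulr1.
  have := H (real_complex R h * C_of (axis R b)); rewrite hh => /(_ hd).
  have -> : complex.Re (d * (real_complex R h * C_of (axis R b))) = h * l.
    rewrite /l; case: (d) (C_of (axis R b)) => [a1 a2] [b1 b2] /=; ring.
  rewrite [C_of p + _]addrC => h1.
  have -> : l - h^-1 *: (G (real_complex R h * C_of (axis R b) + C_of p) - G (C_of p)) =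
     - h^-1 * (G (real_complex R h * C_of (axis R b) + C_of p) - G (C_of p) - h * l).
    by rewrite /GRing.scale /=; field.
  rewrite normrM normrN normfV ler_pdivrMl ?normr_gt0// [leRHS]mulrC.
  exact: h1.
split; first by apply/cvg_ex; exists l.
exact: cvg_lim.
Unshelve. all: by end_near.
Qed.

(** The second partial derivative along axes [v] and [w] is the real part of [G'' * v * w]; the
    Laplacian is that of [G'' * (1 + i ^ 2) = 0]. *)
Lemma harmonic_of_rderiv U G (G' : R[i] -> R[i]) : copen U ->
  (forall z, U z -> rderiv G z (G' z)) -> holn 1 U G' ->
  harmonic_plane (@C_of R @^-1` U) (G \o @C_of R).
Proof.
move=> Uo hG [G'' hG'' cG''].
have nearU p : U (C_of p) -> \forall q \near p, U (C_of q).
  move=> Up; have [r r0 hr] := Uo _ Up; apply/nbhs_C_of; exists r => // q hq.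
  by have := hr _ hq; rewrite addrC subrK.
have D1 p b : U (C_of p) -> is_derive p (axis R b) (G \o @C_of R)
    (complex.Re (G' (C_of p) * C_of (axis R b))).
  by move=> Up; apply: is_derive_rderiv; exact: hG.
have D1near p b : U (C_of p) -> \forall q \near p,
    complex.Re (G' (C_of q) * C_of (axis R b)) = 'D_(axis R b) (G \o @C_of R) q.
  move=> Up; near=> q; have Uq : U (C_of q) by near: q; exact: nearU.
  by have [_ ->] := D1 q b Uq.
have D2 p b c : U (C_of p) -> is_derive p (axis R c) ('D_(axis R b) (G \o @C_of R))
    (complex.Re (G'' (C_of p) * C_of (axis R b) * C_of (axis R c))).
  move=> Up; apply: near_eq_is_derive (D1near p b Up) _.
  apply: (@is_derive_rderiv (fun z => complex.Re (G' z * C_of (axis R b)))).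
  apply: rderiv_Re.
  have := cderivM (hG'' _ Up) (cderiv_cst (C_of (axis R b)) (C_of p)).
  by rewrite mulr0 addr0.
move=> p Up; split.
  move=> b c; split.
  - by have [] := D1 p b Up.
  - by have [] := D2 p b c Up.
  - have near2 : \forall q \near p,
        complex.Re (G'' (C_of q) * C_of (axis R b) * C_of (axis R c)) =
        'D_(axis R c) ('D_(axis R b) (G \o @C_of R)) q.
      near=> q; have Uq : U (C_of q) by near: q; exact: nearU.
      by have [_ ->] := D2 q b c Uq.
    apply/cvgrPdist_le => eps eps0.
    have hc : ccont (fun z => G'' z * C_of (axis R b) * C_of (axis R c)) (C_of p).
      by apply: ccontM; [apply: ccontM|]; [exact: cG''| |]; exact: ccont_cst.
    have [del del0 H] := hc _ eps0.
    near=> q.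
    have -> : 'D_(axis R c) ('D_(axis R b) (G \o @C_of R)) q =
        complex.Re (G'' (C_of q) * C_of (axis R b) * C_of (axis R c)).
      by apply/esym; near: q.
    have [_ ->] := D2 p b c Up.
    have hq : cnorm (C_of q - C_of p) <= del.
      by near: q; apply/nbhs_C_of; exists del.
    have := H _ hq; rewrite [C_of p + _]addrC subrK => h1.
    rewrite distrC; apply: le_trans h1; apply: le_trans (cnorm_Re _).
    by rewrite raddfB.
have [_ ->] := D2 p false false Up; have [_ ->] := D2 p true true Up.
by case: (G'' _) => a b /=; ring.
Unshelve. all: by end_near.
Qed.

Lemma harmonic_ln_cnorm U f : copen U -> (forall z, U z -> f z != 0) -> holn 2 U f ->
  harmonic_plane (@C_of R @^-1` U) ((fun z => ln (cnorm (f z))) \o @C_of R).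
Proof.
move=> Uo fn hf0; have hf1 := holnS hf0; case: hf0 => f' hf hf'.
apply: (@harmonic_of_rderiv U _ (fun z => f' z / f z)) => //.
  by move=> z Uz; apply: rderiv_ln; [exact: hf|exact: fn].
by apply: holnM => //; exact: holnV.
Qed.

End HarmonicPlane.

(** * The complement of the arc and behaviour at its boundary *)

Section OmegaTopology.
Variables (R : realType) (alpha : R).
Hypothesis halpha : 0 < alpha < pi.
Implicit Types (z b : R[i]) (p q x : R * R).

Let e : R[i] := expi alpha.
Let Oc : set R[i] := ~` Gamma alpha.

Lemma copen_Gamma : copen Oc.
Proof.
move=> z /= nz; have [z1|z1] := eqVneq (cnorm z) 1.
- have hz : complex.Re z < cos alpha.
    by rewrite ltNge; apply/negP => h; apply: nz; apply/GammaP.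
  exists ((cos alpha - complex.Re z) / 2); first by rewrite divr_gt0// subr_gt0.
  move=> h hh /(GammaP halpha)[_]; rewrite [complex.Re (_ + _)]raddfD /=.
  have := Re_le_cnorm h; lra.
- exists (`|cnorm z - 1| / 2); first by rewrite divr_gt0// normr_gt0 subr_eq0.
  move=> h hh /(GammaP halpha)[zh _].
  have := ler_cnorm_dist (z + h) z; rewrite addrAC subrr add0r zh distrC => h1.
  have : 0 < `|cnorm z - 1| by rewrite normr_gt0 subr_eq0.
  lra.
Qed.

Lemma finite_part_Omega : finite_part (Omega alpha) = @C_of R @^-1` Oc.
Proof.
apply/seteqP; split => p /=; rewrite /finite_part /Omega /=.
  by move=> h g; apply: h; exists (C_of p).
by move=> h [z g [zE]]; apply: h; rewrite -zE.
Qed.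

Lemma Gamma_inv z : z != 0 -> Gamma alpha z^-1 <-> Gamma alpha z.
Proof.
have H y : y != 0 -> Gamma alpha y -> Gamma alpha y^-1.
  move=> yn /(GammaP halpha)[y1 hy]; apply/GammaP => //.
  by rewrite cnormV y1 invr1 -(conjc_unit y1); case: (y) hy.
move=> zn; split; last exact: H.
by move=> /(H _ (_ : z^-1 != 0)); rewrite invrK; apply; rewrite invr_eq0.
Qed.

Lemma Gamma_neq0 : ~ Gamma alpha 0.
Proof. by move=> /(cnorm_Gamma halpha); rewrite cnorm0 => /eqP; rewrite eq_sym oner_eq0. Qed.

(** The arc is invariant under [z |-> 1 / z], so the domain looks the same in both charts. *)
Lemma chart_Omega : @chart_infty R @^-1` Omega alpha = @C_of R @^-1` Oc.
Proof.
apply/seteqP; split => p; rewrite /= /chart_infty /Omega /=.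
- case: eqP => [-> _|/eqP pn h]; first exact: Gamma_neq0.
  by move=> /(Gamma_inv pn) g; apply: h; exists (C_of p)^-1.
- case: eqP => [-> _ [z _]//|/eqP pn h [z g [zE]]].
  by apply: h; apply/(Gamma_inv pn); rewrite -zE.
Qed.

Lemma open_Oc : open (@C_of R @^-1` Oc).
Proof.
rewrite openE => p Op; apply/nbhs_C_of; have [r r0 hr] := copen_Gamma Op.
by exists r => // q /hr; rewrite addrC subrK.
Qed.

(** Every point of the arc is a limit of its multiples by [1 + r], which are off the arc. *)
Lemma bdry_Omega : bdry (Omega alpha) = @C_of R @^-1` Gamma alpha.
Proof.
rewrite /bdry finite_part_Omega; have -> : (@C_of R @^-1` Oc)° = @C_of R @^-1` Oc.
  exact/interior_id/open_Oc.
apply/seteqP; split => p /=; first by move=> [_ /contrapT].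
move=> gp; split; last by move=> h; exact: h.
move=> B /nbhs_C_of[r r0 hr]; exists ((1 + r) *: p); split.
- rewrite /= C_ofZ => /(cnorm_Gamma halpha).
  rewrite cnormM cnorm_real (cnorm_Gamma halpha gp) mulr1 ger0_norm; lra.
- apply: hr; rewrite C_ofZ; have -> : real_complex R (1 + r) * C_of p - C_of p =
      real_complex R r * C_of p by rewrite rcD rc1; ring.
  by rewrite cnormM cnorm_real (cnorm_Gamma halpha gp) mulr1 ger0_norm// ltW.
Qed.

Lemma cvg_within_C_of (A : set (R * R)) x (f : R * R -> R) (l : R) :
  (forall eps : R, 0 < eps -> exists2 del : R, 0 < del & forall q, A q ->
    cnorm (C_of q - C_of x) <= del -> `|l - f q| <= eps) ->
  f q @[q --> within A (nbhs x)] --> l.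
Proof.
move=> h; apply/cvgrPdist_le => eps /h[del del0 H]; apply/nbhs_C_of.
by exists del => // q hq Aq; exact: H.
Qed.

Lemma holn_mob n : holn n Oc (mob alpha).
Proof.
have sub c : holn n Oc (fun z => z - c).
  by apply: holnD; [exact: holn_id|exact: holn_cst].
apply: holnM; last first.
  apply: holnV (sub _) => z /= nz; rewrite subr_eq0; apply/eqP => h; apply: nz.
  by rewrite h; exact: Gamma_e.
apply: holnD; last exact: holn_cst.
by apply: holnM; [exact: holn_id|exact: holn_cst].
Qed.

Lemma holn_sqrt_mob n : holn n Oc (sqrt_mob alpha).
Proof.
apply: (holn_sqrt copen_Gamma _ _ (holn_mob n)).
  by move=> z _; exact: sqrt_mob_sqr.
by move=> z /(Re_sqrt_mob halpha).
Qed.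

Definition sphere_sqrt (u : sphere R) : R[i] :=
  if u is Some z then sqrt_mob alpha z else sinf alpha.

Definition chart_sqrt z := sphere_sqrt (if z == 0 then None else Some z^-1).

Lemma chart_sqrtE p : sphere_sqrt (chart_infty p) = chart_sqrt (C_of p).
Proof. by []. Qed.

Lemma chart_sqrt_gt0 z : Oc z -> 0 < complex.Re (chart_sqrt z).
Proof.
rewrite /chart_sqrt /= => nz; case: eqP => [_|/eqP zn]; first exact: Re_sinf.
by apply: Re_sqrt_mob => // /(Gamma_inv zn).
Qed.

Lemma den_e_neq0 z : Oc z -> 1 - z * e != 0.
Proof.
move=> nz; apply/eqP => h; apply: nz.
have en : e != 0 by rewrite -cnorm_gt0 cnorm_expi.
have -> : z = e^-1.
  by apply: (mulIf en); rewrite mulVf//; apply/eqP; rewrite -subr_eq0 -oppr_eq0 opprB h.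
by apply/(Gamma_inv en); exact: Gamma_e.
Qed.

Lemma chart_sqrt_sqr z : Oc z -> chart_sqrt z ^+ 2 = (e - z) / (1 - z * e).
Proof.
move=> nz; have dn := den_e_neq0 nz; rewrite /chart_sqrt; case: eqP => [->|/eqP zn].
  by rewrite /= sinf_sqr mul0r !subr0 divr1.
rewrite /= sqrt_mob_sqr /mob -/e; by field; rewrite zn dn.
Qed.

Lemma holn_chart_sqrt n : holn n Oc chart_sqrt.
Proof.
apply: (holn_sqrt copen_Gamma chart_sqrt_sqr chart_sqrt_gt0).
apply: holnM.
  have := holnD (holn_cst n Oc e) (holnM (holn_cst n Oc (-1)) (holn_id n Oc)).
  by congr (holn n Oc _); apply/funext => z; rewrite mulN1r.
apply: holnV => [z|]; first exact: den_e_neq0.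
have := holnD (holn_cst n Oc 1) (holnM (holn_cst n Oc (- e)) (holn_id n Oc)).
by congr (holn n Oc _); apply/funext => z; rewrite mulNr mulrC.
Qed.

(** The modulus of the Blaschke factor of the right half-plane with zero [b]. *)
Definition sqrt_ratio b z : R :=
  cnorm (sqrt_mob alpha z - b) / cnorm (sqrt_mob alpha z + conjc b).

Lemma add_conj_neq0 b z : 0 < complex.Re b -> 0 < complex.Re z -> z + conjc b != 0.
Proof.
move=> b0 z0; apply/eqP => /(congr1 (@complex.Re R)).
by case: b z b0 z0 => [b1 b2] [z1 z2] /=; lra.
Qed.

Lemma sqrt_ratio_defect b z : 0 < complex.Re b -> ~ Gamma alpha z ->
  1 - sqrt_ratio b z ^+ 2 = 4 * complex.Re (sqrt_mob alpha z) * complex.Re b /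
    cnorm (sqrt_mob alpha z + conjc b) ^+ 2.
Proof.
move=> b0 nz; have s0 := Re_sqrt_mob halpha nz.
have n := add_conj_neq0 b0 s0.
have c0 : cnorm (sqrt_mob alpha z + conjc b) ^+ 2 != 0 by rewrite expf_neq0// cnorm_eq0.
apply: (mulIf c0); rewrite mulfVK// mulrBl mul1r /sqrt_ratio expr_div_n mulfVK//.
by rewrite !cnorm_sqr; case: (sqrt_mob alpha z) b {b0 s0 n c0} => [s1 s2] [b1 b2] /=; ring.
Qed.

(** Twice the square of the real part of [s] is [|s ^ 2|] plus the real part of [s ^ 2], which
    vanishes on the nonpositive ray. *)
Lemma sqrt_mob_small x (eps : R) : Gamma alpha (C_of x) -> C_of x != e -> 0 < eps ->
  exists2 del : R, 0 < del & forall z, ~ Gamma alpha z -> cnorm (z - C_of x) <= del ->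
    complex.Re (sqrt_mob alpha z) <= eps.
Proof.
move=> gx xe eps0; have [mu mu0 hmu] := mob_on halpha gx xe.
have hc : ccont (mob alpha) (C_of x).
  apply: ccontM; last first.
    apply: ccontV; last by rewrite subr_eq0.
    by apply: ccontD; [exact: cderiv_ccont (cderiv_id _)|exact: ccont_cst].
  apply: ccontD; last exact: ccont_cst.
  by apply: ccontM; [exact: cderiv_ccont (cderiv_id _)|exact: ccont_cst].
have [del del0 H] := hc _ (exprn_gt0 2 eps0); exists del => // z nz hz.
have := H _ hz; rewrite [C_of x + _]addrC subrK hmu opprK => h1.
have s0 := Re_sqrt_mob halpha nz.
rewrite -(@ler_pXn2r _ 2%N) ?nnegrE ?(ltW s0) ?(ltW eps0)//.
have key : 2 * complex.Re (sqrt_mob alpha z) ^+ 2 =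
    cnorm (mob alpha z) + complex.Re (mob alpha z).
  rewrite -sqrt_mob_sqr cnormX cnorm_sqr.
  by case: (sqrt_mob alpha z) => a b; rewrite /=; ring.
have h2 : cnorm (mob alpha z) <= mu + eps ^+ 2.
  have := ler_cnormB (mob alpha z + real_complex R mu) (real_complex R mu).
  by rewrite addrK cnorm_real (ger0_norm mu0); lra.
have h3 : complex.Re (mob alpha z) + mu <= eps ^+ 2.
  apply: le_trans h1; apply: le_trans (Re_le_cnorm _).
  by rewrite [complex.Re (_ + _)]raddfD.
lra.
Qed.

Lemma sqrt_mob_large (K : R) : 0 < K ->
  exists2 del : R, 0 < del & forall z, ~ Gamma alpha z -> cnorm (z - e) <= del ->
    K <= cnorm (sqrt_mob alpha z).
Proof.
move=> K0; pose E := cnorm (e ^+ 2 - 1).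
have E0 : 0 < E.
  rewrite cnorm_gt0; apply/eqP => /(congr1 (@complex.Re R)); rewrite expr2 /e /= -!expr2.
  have := cos2Dsin2 alpha; have := cos_alpha_lt1 halpha; lra.
exists (Num.min (E / 2) (E / (2 * K ^+ 2))).
  by rewrite lt_min !divr_gt0// mulr_gt0// exprn_gt0.
move=> z nz; rewrite le_min => /andP[h1 h2].
have [ze _] := mob_off halpha nz.
have d0 : 0 < cnorm (z - e) by rewrite cnorm_gt0 subr_eq0.
rewrite -(@ler_pXn2r _ 2%N) ?nnegrE ?cnorm_ge0 ?(ltW K0)// -cnormX sqrt_mob_sqr.
rewrite /mob cnormf ler_pdivlMr//.
have h3 : E / 2 <= cnorm (z * e - 1).
  have := lerB_cnorm (e ^+ 2 - 1) (- ((z - e) * e)).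
  have -> : e ^+ 2 - 1 - - ((z - e) * e) = z * e - 1 by ring.
  rewrite cnormN cnormM cnorm_expi mulr1 -/E; lra.
apply: le_trans h3; move: h2; rewrite ler_pdivlMr ?mulr_gt0 ?exprn_gt0//.
rewrite -/e; lra.
Qed.

(** By [sqrt_ratio_defect] it is enough that [Re s / |s + conjc b| ^ 2] tends to 0. At the end [e]
    this holds because [|s|] tends to infinity, elsewhere because [Re s] tends to 0. *)
Lemma sqrt_ratio_cvg b x : 0 < complex.Re b -> Gamma alpha (C_of x) ->
  sqrt_ratio b (C_of q) @[q --> within (finite_part (Omega alpha)) (nbhs x)] --> (1 : R).
Proof.
move=> b0 gx; apply: cvg_within_C_of => eps eps0; rewrite finite_part_Omega.
suff [del del0 H] : exists2 del : R, 0 < del & forall z, ~ Gamma alpha z ->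
    cnorm (z - C_of x) <= del -> 1 - sqrt_ratio b z ^+ 2 <= eps.
  exists del => // q /= nq hq; have h1 := H _ nq hq.
  have r0 : 0 <= sqrt_ratio b (C_of q) by rewrite divr_ge0 ?cnorm_ge0.
  have r1 : 0 <= 1 - sqrt_ratio b (C_of q) ^+ 2.
    rewrite sqrt_ratio_defect// divr_ge0 ?sqr_ge0// !mulr_ge0// ?(ltW b0)//.
    exact: ltW (Re_sqrt_mob halpha nq).
  have r2 : sqrt_ratio b (C_of q) <= 1.
    by rewrite -(@ler_pXn2r _ 2%N) ?nnegrE// expr1n -subr_ge0.
  rewrite ger0_norm ?subr_ge0//; nra.
have [xe|xe] := eqVneq (C_of x) e.
- have K0 : 0 < cnorm b + 4 * complex.Re b / eps.
    by rewrite ltr_wpDl ?cnorm_ge0// divr_gt0// mulr_gt0.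
  have [del del0 H] := sqrt_mob_large K0; exists del => // z nz hz.
  have := H z nz; rewrite -xe => /(_ hz) h1.
  have s0 := Re_sqrt_mob halpha nz; have n := add_conj_neq0 b0 s0.
  rewrite sqrt_ratio_defect//; set N := cnorm (_ + conjc b).
  have N0 : 0 < N by rewrite cnorm_gt0.
  have sN : complex.Re (sqrt_mob alpha z) <= N.
    apply: le_trans (Re_le_cnorm _); rewrite [complex.Re (_ + _)]raddfD /= lerDl.
    by case: (b) b0 => b1 b2 /= /ltW.
  have N1 : 4 * complex.Re b / eps <= N.
    have := lerB_cnorm (sqrt_mob alpha z) (- conjc b); rewrite opprK cnormN cnormJ -/N; lra.
  rewrite ler_pdivrMr ?exprn_gt0//; rewrite ler_pdivrMr// in N1.
  have : complex.Re (sqrt_mob alpha z) * (4 * complex.Re b) <= N * (N * eps).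
    by apply: ler_pM => //; [exact: ltW|rewrite mulr_ge0// ltW].
  lra.
- have e1 : 0 < eps * complex.Re b / 4 by rewrite divr_gt0// mulr_gt0.
  have [del del0 H] := sqrt_mob_small gx xe e1; exists del => // z nz hz.
  have h1 := H z nz hz; have s0 := Re_sqrt_mob halpha nz.
  rewrite sqrt_ratio_defect//; set N := cnorm (_ + conjc b).
  have bN : complex.Re b <= N.
    apply: le_trans (Re_le_cnorm _); rewrite [complex.Re (_ + _)]raddfD /=.
    by case: (b) => b1 b2 /=; rewrite lerDr ltW.
  have N0 : 0 < N by apply: lt_le_trans bN.
  rewrite ler_pdivrMr ?exprn_gt0//.
  have h2 : 4 * complex.Re (sqrt_mob alpha z) * complex.Re b <= eps * complex.Re b * complex.Re b.
    by rewrite ler_wpM2r ?(ltW b0)//; lra.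
  apply: le_trans h2 _; rewrite -mulrA ler_pM2l// expr2.
  by apply: ler_pM => //; exact: ltW.
Qed.

End OmegaTopology.

(** * Continuity of harmonic functions and the maximum principle *)

Section MaximumPrinciple.
Variable R : realType.
Implicit Types (F h : R * R -> R) (p q v x : R * R) (U : set (R * R)).

Lemma is_derive_slice F p v (t d : R) : is_derive (t *: v + p) v F d ->
  is_derive t (1 : R) (fun s => F (s *: v + p)) d.
Proof.
have E : (fun k : R => k^-1 *: (((fun s => F (s *: v + p)) \o shift t) (k *: (1 : R)) -
      F (t *: v + p))) =
   (fun k : R => k^-1 *: ((F \o shift (t *: v + p)) (k *: v) - F (t *: v + p))).
  apply/funext => k /=; rewrite /GRing.scale /= mulr1; congr (_ * (F _ - _)).
  by rewrite -[(k + t) *: v + p]/((k + t) *: v + p) scalerDl addrA.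
move=> [h1 h2]; split; first by move: h1; rewrite /derivable -E.
by rewrite -h2 /derive -E.
Qed.

Lemma mvt_le (f df : R -> R) (a b M : R) : a <= b ->
  (forall t, a <= t <= b -> is_derive t (1 : R) f (df t)) ->
  (forall t, a <= t <= b -> `|df t| <= M) -> `|f b - f a| <= M * (b - a).
Proof.
rewrite le_eqVlt => /orP[/eqP->|ab] hd hM; first by rewrite !subrr normr0 mulr0.
have [c|c|c cab ->] := @MVT R f df a b ab.
- by rewrite in_itv /= => /andP[c1 c2]; apply: hd; rewrite !ltW.
- apply: derivable_within_continuous => t; rewrite in_itv /= => tab.
  by have [] := hd t tab.
move: cab; rewrite in_itv /= => /andP[c1 c2].
by rewrite normrM (gtr0_norm (_ : 0 < b - a)) ?subr_gt0// ler_wpM2r ?subr_ge0 ?(ltW ab)// hM// !ltW.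
Qed.

Lemma slice_lip F (dF : R * R -> R) p v (T M : R) :
  (forall t, `|t| <= `|T| -> is_derive (t *: v + p) v F (dF (t *: v + p))) ->
  (forall t, `|t| <= `|T| -> `|dF (t *: v + p)| <= M) ->
  `|F (T *: v + p) - F p| <= M * `|T|.
Proof.
move=> hd hM; have E0 : F p = F (0 *: v + p) by rewrite scale0r add0r.
have [T0|T0] := leP 0 T.
- have tT t : 0 <= t <= T -> `|t| <= `|T|.
    by move=> /andP[t0 t1]; rewrite !ger0_norm.
  rewrite E0 (ger0_norm T0) -[X in _ <= _ * X]subr0.
  apply: (@mvt_le (fun s => F (s *: v + p)) (fun s => dF (s *: v + p))) => // t tt.
    by apply: is_derive_slice; apply: hd; exact: tT.
  by apply: hM; exact: tT.
- have tT t : T <= t <= 0 -> `|t| <= `|T|.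
    by move=> /andP[t0 t1]; rewrite !ler0_norm ?(ltW T0)// lerN2.
  rewrite E0 (ltr0_norm T0) distrC -[X in _ <= _ * X]sub0r.
  apply: (@mvt_le (fun s => F (s *: v + p)) (fun s => dF (s *: v + p))) => //.
  + exact: ltW.
  + by move=> t tt; apply: is_derive_slice; apply: hd; exact: tT.
  + by move=> t tt; apply: hM; exact: tT.
Qed.

Definition box p (r : R) q := `|q.1 - p.1| <= r /\ `|q.2 - p.2| <= r.

Lemma nbhs_box p (A : set (R * R)) : nbhs p A <->
  exists2 r : R, 0 < r & forall q, box p r q -> A q.
Proof.
split.
- move=> /nbhs_C_of[r r0 hr]; exists (r / 2); first by rewrite divr_gt0.
  move=> q [h1 h2]; apply: hr; apply: le_trans (cnorm_le_ReIm _) _ => /=; lra.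
- move=> [r r0 hr]; apply/nbhs_C_of; exists r => // q hq; apply: hr; split.
    exact: le_trans (cnorm_Re (C_of q - C_of p)) hq.
  exact: le_trans (cnorm_Im (C_of q - C_of p)) hq.
Qed.

Lemma axisE (b : bool) (t : R) p : t *: axis R b + p =
  if b then (p.1, t + p.2) else (t + p.1, p.2).
Proof.
case: b; rewrite /axis; congr (_, _); rewrite /= /GRing.scale /= ?mulr0 ?mulr1 ?add0r//.
Qed.

Lemma box_lip F (dF : bool -> R * R -> R) p (r M : R) :
  (forall b q, box p r q -> is_derive q (axis R b) F (dF b q)) ->
  (forall b q, box p r q -> `|dF b q| <= M) ->
  forall q, box p r q -> `|F q - F p| <= M * (`|q.1 - p.1| + `|q.2 - p.2|).
Proof.
move=> hd hM q [q1 q2].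
have r0 : 0 <= r := le_trans (normr_ge0 _) q1.
have h1 : `|F ((q.1 - p.1) *: axis R false + p) - F p| <= M * `|q.1 - p.1|.
  apply: (slice_lip (dF := dF false)) => t ht; [apply: hd|apply: hM];
  rewrite axisE; split => /=; rewrite ?addrK ?subrr ?normr0//; exact: le_trans ht q1.
set p' := _ + p in h1.
have h2 : `|F ((q.2 - p.2) *: axis R true + p') - F p'| <= M * `|q.2 - p.2|.
  apply: (slice_lip (dF := dF true)) => t ht; [apply: hd|apply: hM];
  rewrite /p' !axisE; split => /=; rewrite ?subrK ?addrK//; exact: le_trans ht q2.
have E : (q.2 - p.2) *: axis R true + p' = q by rewrite /p' !axisE /= !subrK; case: (q).
rewrite E in h2; rewrite mulrDr [leRHS]addrC.
have -> : F q - F p = (F q - F p') + (F p' - F p) by ring.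
apply: le_trans (ler_normD _ _) _; exact: lerD.
Qed.

Lemma common_ub (a b : R) : exists2 M : R, 0 < M & a <= M /\ b <= M.
Proof.
exists (`|a| + `|b| + 1); first by rewrite ltr_wpDl// addr_ge0.
by have := ler_norm a; have := ler_norm b; have := normr_ge0 a; have := normr_ge0 b; split; lra.
Qed.

(** The definition gives continuity only of the second partials. These are locally bounded, so the
    mean value theorem on a box bounds the first partials, and applied again makes [h] Lipschitz at
    [p]. *)
Lemma harmonic_continuous U h p : open U -> harmonic_plane U h -> U p -> {for p, continuous h}.
Proof.
move=> Uo hh Up.
have bounded_partial b : exists2 r, 0 < r & exists M, forall q, box p r q -> `|'D_(axis R b) h q| <= M.
  have [r0 r00 hr0] : exists2 r0 : R, 0 < r0 & forall q, box p r0 q -> U q.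
    by apply/nbhs_box; apply: open_nbhs_nbhs.
  have bc c : exists2 r, 0 < r & forall q, box p r q ->
      `|'D_(axis R c) ('D_(axis R b) h) q| <= `|'D_(axis R c) ('D_(axis R b) h) p| + 1.
    have [_ _] := (hh p Up).1 b c; move=> /cvgrPdist_le /(_ 1 ltr01) /nbhs_box[r r1 hr].
    exists r => // q /hr h1; rewrite -lerBlDl.
    by apply: le_trans (lerB_dist _ _) _; rewrite distrC.
  have [r1 r10 hr1] := bc false; have [r2 r20 hr2] := bc true.
  pose r := Num.min r0 (Num.min r1 r2).
  have rr0 : 0 < r by rewrite !lt_min r00 r10.
  have rl q : box p r q -> [/\ box p r0 q, box p r1 q & box p r2 q].
    by move=> [q1 q2]; split; split; (apply: le_trans q1 _ || apply: le_trans q2 _);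
      rewrite !ge_min lexx ?orbT.
  have [M M0 [Mf Mt]] := common_ub (`|'D_(axis R false) ('D_(axis R b) h) p| + 1)
    (`|'D_(axis R true) ('D_(axis R b) h) p| + 1).
  exists r => //; exists (`|'D_(axis R b) h p| + M * (r + r)) => q qr.
  have hl := @box_lip ('D_(axis R b) h) (fun c => 'D_(axis R c) ('D_(axis R b) h)) p r M _ _ q qr.
  have {}hl : `|'D_(axis R b) h q - 'D_(axis R b) h p| <= M * (`|q.1 - p.1| + `|q.2 - p.2|).
    apply: hl => c y /rl[y0 y1 y2].
      by have [_ h1 _] := (hh y (hr0 _ y0)).1 b c; exact: derivableP.
    by case: c; [apply: le_trans (hr2 y y2) Mt|apply: le_trans (hr1 y y1) Mf].
  rewrite -lerBlDl; apply: le_trans (lerB_dist _ _) _; apply: le_trans hl _.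
  by rewrite ler_wpM2l ?(ltW M0)// lerD//; case: qr.
have [r1 r10 [M1 hM1]] := bounded_partial false.
have [r2 r20 [M2 hM2]] := bounded_partial true.
have [r0 r00 hr0] : exists2 r0 : R, 0 < r0 & forall q, box p r0 q -> U q.
  by apply/nbhs_box; apply: open_nbhs_nbhs.
pose r := Num.min r0 (Num.min r1 r2).
have rr0 : 0 < r by rewrite !lt_min r00 r10.
have rl q : box p r q -> [/\ box p r0 q, box p r1 q & box p r2 q].
  by move=> [q1 q2]; split; split; (apply: le_trans q1 _ || apply: le_trans q2 _);
    rewrite !ge_min lexx ?orbT.
have [M M0 [MM1 MM2]] := common_ub M1 M2.
apply/cvgrPdist_le => eps eps0; apply/nbhs_box; exists (Num.min r (eps / (M + M))).
  by rewrite lt_min rr0 divr_gt0// addr_gt0.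
move=> q [q1 q2]; rewrite distrC.
have qr : box p r q by split; [apply: le_trans q1 _|apply: le_trans q2 _]; rewrite ge_min lexx.
have hl := @box_lip h (fun c => 'D_(axis R c) h) p r M _ _ q qr.
have {}hl : `|h q - h p| <= M * (`|q.1 - p.1| + `|q.2 - p.2|).
  apply: hl => c y /rl[y0 y1 y2].
    by have [h1 _ _] := (hh y (hr0 _ y0)).1 c false; exact: derivableP.
  by case: c; [apply: le_trans (hM2 y y2) MM2|apply: le_trans (hM1 y y1) MM1].
apply: le_trans hl _.
have e1 : `|q.1 - p.1| <= eps / (M + M) by apply: le_trans q1 _; rewrite ge_min lexx orbT.
have e2 : `|q.2 - p.2| <= eps / (M + M) by apply: le_trans q2 _; rewrite ge_min lexx orbT.
have -> : eps = M * (eps / (M + M) + eps / (M + M)).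
  by rewrite -mulrDl mulrA mulrDr -mulrDl mulrC mulKf// gt_eqF// addr_gt0.
by rewrite ler_wpM2l ?(ltW M0)// lerD.
Qed.

Lemma second_derivative_at_max (k k' : R -> R) (c r : R) : 0 < r ->
  (forall t, `|t| < r -> is_derive t (1 : R) k (k' t)) ->
  is_derive (0 : R) (1 : R) k' c ->
  (forall t, `|t| < r -> k t <= k 0) -> c <= 0.
Proof.
move=> r0 hk hk' hmax; rewrite leNgt; apply/negP => c0.
have k0 : k' 0 = 0.
  have h0 : is_derive (0 : R) (1 : R) k 0.
    apply: (@derive1_at_max R k (- r) r).
    - lra.
    - by move=> t; rewrite in_itv /= => tr; have [] := hk t; rewrite ?ltr_norml.
    - by rewrite in_itv /=; apply/andP; split; lra.
    - by move=> t; rewrite in_itv /= => tr; apply: hmax; rewrite ltr_norml.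
  have z0 : `|0 : R| < r by rewrite normr0.
  by have [_ <-] := hk 0 z0; have [_ ->] := h0.
have [d1 d2] := hk'.
have : (fun h : R => h^-1 *: ((k' \o shift 0) (h *: (1 : R)) - k' 0)) @ 0^' --> c.
  by rewrite -d2; exact: d1.
have c2 : 0 < c / 2 by rewrite divr_gt0.
move=> /cvgrPdist_le /(_ _ c2) /nbhs_ballP[del /= del0 H].
pose T := Num.min (r / 2) (del / 2).
have T0 : 0 < T by rewrite lt_min !divr_gt0.
have Tr : T < r by rewrite gt_min ltr_pdivrMr// ltr_pMr// ltr1n.
have Td : T < del by rewrite gt_min; apply/orP; right; rewrite ltr_pdivrMr// ltr_pMr// ltr1n.
have pos t : 0 < t <= T -> 0 < k' t.
  move=> /andP[t0 tT]; have := H t; rewrite /ball /= sub0r normrN gtr0_norm//.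
  move=> /(_ (le_lt_trans tT Td)); rewrite gt_eqF// => /(_ isT).
  rewrite k0 subr0 /GRing.scale /= mulr1 addr0 ler_norml => /andP[_ h2].
  have : 0 < t^-1 * k' t by lra.
  by rewrite pmulr_rgt0 ?invr_gt0.
have [t| |t tT hT] := @MVT R k k' 0 T T0.
- rewrite in_itv /= => /andP[t0 t1]; apply: hk; rewrite gtr0_norm//; lra.
- apply: derivable_within_continuous => t; rewrite in_itv /= => /andP[t0 t1].
  by have [] := hk t; rewrite ?ger0_norm//; lra.
move: tT; rewrite in_itv /= => /andP[t0 t1].
have := hmax T; rewrite gtr0_norm// => /(_ Tr) hTm.
have := pos t; rewrite t0 (ltW t1) => /(_ isT) => kt.
have : 0 < k' t * (T - 0) by rewrite subr0 mulr_gt0.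
lra.
Qed.

Lemma is_derive_quadratic (a b c t : R) :
  is_derive t (1 : R) (fun s => a * (s * s + b * s + c)) (a * (2 * t + b)).
Proof.
have -> : (fun s : R => a * (s * s + b * s + c)) = a \*: (id * id + b \*: id + cst c).
  by apply/funext => s; rewrite /= /GRing.scale /=.
by apply: is_derive_eq; rewrite /GRing.scale /=; ring.
Qed.

Lemma is_derive_affine (a b t : R) : is_derive t (1 : R) (fun s => a * (2 * s + b)) (2 * a).
Proof.
have -> : (fun s : R => a * (2 * s + b)) = a \*: (2 \*: id + cst b).
  by apply/funext => s; rewrite /= /GRing.scale /=.
by apply: is_derive_eq; rewrite /GRing.scale /=; ring.
Qed.

(** If [h p1 > 0], the set [K] where [h >= h p1 / 2] is compact by the conditions at the boundary
    and at infinity. A small multiple of the squared distance to [p1] is added; the maximum over [K]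
    of the sum is reached where [h] exceeds [h p1 / 2], hence inside [K], and there the positive
    Laplacian contradicts the second derivative test. *)
Lemma max_principle U h : open U -> harmonic_plane U h ->
  (forall x, (closure U `\` U) x -> h p @[p --> within U (nbhs x)] --> (0 : R)) ->
  (exists r : R, forall p, U p -> r < cnorm (C_of p) -> h p <= 0) ->
  forall p, U p -> h p <= 0.
Proof.
move=> Uo hh hb [r0 hr0] p1 Up1; rewrite leNgt; apply/negP => hp1.
pose c := h p1 / 2; have c0 : 0 < c by rewrite divr_gt0.
pose K := [set p | U p /\ c <= h p].
have hcont p : U p -> {for p, continuous h} by move=> Up; exact: (harmonic_continuous Uo).
pose r := Num.max r0 (cnorm (C_of p1)).
have Kr p : K p -> cnorm (C_of p) <= r.
  move=> [Up hp]; rewrite leNgt; apply/negP; rewrite gt_max => /andP[h1 _].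
  by have := hr0 p Up h1; lra.
have r_ge0 : 0 <= r by rewrite le_max cnorm_ge0 orbT.
have Kclosed : closed K.
  move=> x clx; have [Ux|nUx] := pselect (U x).
    split => //; rewrite leNgt; apply/negP => hx.
    have e0 : 0 < (c - h x) / 2 by rewrite divr_gt0// subr_gt0.
    have /cvgrPdist_le /(_ _ e0) nb := hcont x Ux.
    have [y [[Uy hy] hxy]] := clx _ nb.
    move: hxy; rewrite /= ler_norml => /andP[h1 h2]; lra.
  exfalso; have bx : (closure U `\` U) x.
    by split => // B /clx[y [[Uy _] By]]; exists y.
  have e0 : 0 < c / 2 by rewrite divr_gt0.
  have := hb x bx; move=> /cvgrPdist_le /(_ _ e0) => nb.
  have [y [[Uy hy] hxy]] := clx _ nb.
  move: (hxy Uy); rewrite /= sub0r normrN ler_norml => /andP[h1 h2]; lra.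
have Kcompact : compact K.
  apply: (@subclosed_compact _ K (`[- r, r]%classic `*` `[- r, r]%classic)) => //.
    by apply: compact_setX; exact: segment_compact.
  move=> p /Kr hp; split; rewrite /= in_itv /= -ler_norml.
    exact: le_trans (cnorm_Re (C_of p)) hp.
  exact: le_trans (cnorm_Im (C_of p)) hp.
pose N p := (p.1 - p1.1) ^+ 2 + (p.2 - p1.2) ^+ 2.
(* On [K] each coordinate differs from that of [p1] by at most [2 * r], so [N <= 8 * r ^+ 2]; the
   added 1 makes [del * N] strictly less than [c]. *)
pose B := 8 * r ^+ 2 + 1; have B0 : 0 < B by rewrite ltr_wpDl// mulr_ge0// sqr_ge0.
have NB p : K p -> N p <= B - 1.
  move=> /Kr hp; have hp1r : cnorm (C_of p1) <= r by rewrite le_max lexx orbT.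
  have sqle (s t : R) : `|s| <= r -> `|t| <= r -> (s - t) ^+ 2 <= 4 * r ^+ 2.
    rewrite !ler_norml => /andP[s1 s2] /andP[t1 t2]; nra.
  have := sqle p.1 p1.1 (le_trans (cnorm_Re (C_of p)) hp) (le_trans (cnorm_Re (C_of p1)) hp1r).
  have := sqle p.2 p1.2 (le_trans (cnorm_Im (C_of p)) hp) (le_trans (cnorm_Im (C_of p1)) hp1r).
  by rewrite /N /B; lra.
pose del := c / B; have del0 : 0 < del by rewrite divr_gt0.
have delB : del * B = c by rewrite mulfVK// gt_eqF.
pose phi p := h p + del * N p.
have phic : {within K, continuous phi}.
  apply: continuous_in_subspaceT => x; rewrite inE => -[Ux _].
  apply: cvgD; first exact: hcont.
  apply: cvgM; first exact: cvg_cst.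
  have c1 : {for x, continuous (fun p : R * R => p.1)} by exact: cvg_fst.
  have c2 : {for x, continuous (fun p : R * R => p.2)} by exact: cvg_snd.
  apply: cvgD; rewrite !expr2.
    by under eq_fun do rewrite expr2; apply: cvgM; apply: cvgB => //; exact: cvg_cst.
  by under eq_fun do rewrite expr2; apply: cvgM; apply: cvgB => //; exact: cvg_cst.
have Kp1 : K p1 by split => //; rewrite /c; lra.
have [pm] := compact_EVT_max (ex_intro _ p1 Kp1) Kcompact phic.
rewrite inE => -[Upm hpm] pmax.
have phip1 : phi p1 = 2 * c.
  by rewrite /phi /N !subrr expr0n addr0 mulr0 addr0 /c mulrC mulfVK.
have hpmc : c < h pm.
  have := pmax p1; rewrite inE => /(_ Kp1); rewrite phip1 /phi => h1.
  have : del * N pm <= del * (B - 1) by rewrite ler_pM2l//; exact: NB.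
  by rewrite mulrBr delB mulr1; lra.
have [rr rr0 hrr] : exists2 rr : R, 0 < rr & forall q, box pm rr q -> K q.
  apply/nbhs_box; near=> q; split; first by near: q; exact: open_nbhs_nbhs.
  near: q; have e0 : 0 < h pm - c by rewrite subr_gt0.
  have /cvgrPdist_le /(_ _ e0) := hcont pm Upm; apply: filterS => q.
  by rewrite ler_norml => /andP[h1 h2]; lra.
have key b : 'D_(axis R b) ('D_(axis R b) h) pm + 2 * del <= 0.
  have boxt t : `|t| < rr -> box pm rr (t *: axis R b + pm).
    move=> /ltW tr; rewrite axisE; case: b; split => /=; rewrite ?subrr ?normr0 ?addrK//;
    exact: ltW.
  pose co (p : R * R) := if b then p.2 - p1.2 else p.1 - p1.1.
  have phiE t : phi (t *: axis R b + pm) = h (t *: axis R b + pm) +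
      del * (t * t + (2 * co pm) * t + N pm).
    rewrite /phi /N /co axisE; case: b {boxt co} => /=; congr (_ + _ * _); ring.
  apply: (@second_derivative_at_max (fun t => phi (t *: axis R b + pm))
    (fun t => 'D_(axis R b) h (t *: axis R b + pm) + del * (2 * t + 2 * co pm)) _ rr) => //.
  - move=> t tr; have [Ut _] := hrr _ (boxt t tr).
    have [d1 _ _] := (hh _ Ut).1 b false.
    have D1 := is_derive_slice (derivableP d1).
    have -> : (fun t0 => phi (t0 *: axis R b + pm)) =
       (fun s => h (s *: axis R b + pm)) + (fun t => del * (t * t + (2 * co pm) * t + N pm)).
      by apply/funext => s; rewrite phiE.
    by apply: is_deriveD; exact: is_derive_quadratic.
  - have [_ d2 _] := (hh _ Upm).1 b b.
    have D2 : is_derive (0 : R) (1 : R) (fun s => 'D_(axis R b) h (s *: axis R b + pm))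
        ('D_(axis R b) ('D_(axis R b) h) pm).
      have E : 0 *: axis R b + pm = pm by rewrite scale0r add0r.
      apply: (@is_derive_slice ('D_(axis R b) h) pm (axis R b) 0).
      by rewrite E; exact: derivableP.
    by apply: is_deriveD; exact: is_derive_affine.
  - move=> t tr; rewrite scale0r add0r; apply: pmax; rewrite inE.
    by apply: hrr; exact: boxt.
have [_ lap] := hh pm Upm.
have := lerD (key false) (key true); rewrite addrACA lap add0r addr0 leNgt => /negP; apply.
by rewrite addr_gt0// mulr_gt0.
Unshelve. all: by end_near.
Qed.

End MaximumPrinciple.

(** * Uniqueness of the Green function *)

Section GreenUniqueness.
Variable R : realType.
Implicit Types (f g h : R * R -> R) (p v x : R * R) (U : set (R * R)).

(** Derivatives are local and [U] is open, so functions that agree with the partials on [U] suffice.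
    In this form harmonicity passes to linear combinations term by term. *)
Lemma harmonic_partials U h : open U ->
  (exists (D1 : bool -> R * R -> R) (D2 : bool -> bool -> R * R -> R), forall p, U p ->
    [/\ forall b, is_derive p (axis R b) h (D1 b p),
        forall b c, is_derive p (axis R c) (D1 b) (D2 b c p),
        forall b c, {for p, continuous (D2 b c)} &
        D2 false false p + D2 true true p = 0]) <-> harmonic_plane U h.
Proof.
move=> Uo; split; last first.
  move=> hh; exists (fun b => 'D_(axis R b) h), (fun b c => 'D_(axis R c) ('D_(axis R b) h)).
  move=> p Up; have [h1 h2] := hh p Up; split => // b.
  - by have [d _ _] := h1 b b; exact: derivableP.
  - by move=> c; have [_ d _] := h1 b c; exact: derivableP.
  - by move=> c; have [_ _ d] := h1 b c; exact: d.
move=> [D1 [D2 hD]].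
have nU p : U p -> \near p, U p by move=> Up; exact: open_nbhs_nbhs.
have E1 p b : U p -> {near p, D1 b =1 'D_(axis R b) h}.
  by move=> /nU; apply: filterS => q /hD[h1 _ _ _]; have [_ ->] := h1 b.
have E2 p b c : U p -> 'D_(axis R c) ('D_(axis R b) h) p = D2 b c p.
  move=> Up; rewrite -(near_eq_derive _ (E1 p b Up)).
  by have [_ h2 _ _] := hD p Up; have [_ ->] := h2 b c.
move=> p Up; have [h1 h2 h3 h4] := hD p Up; split.
- move=> b c; split; first by have [] := h1 b.
    by apply: near_eq_derivable (E1 p b Up) _; have [] := h2 b c.
  have := E2 p b c Up; rewrite /prop_for /continuous_at => ->.
  apply: cvg_trans (h3 b c); apply: near_eq_cvg.
  by apply: filterS (nU p Up) => q Uq; rewrite E2.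
- by have := E2 p false false Up; have := E2 p true true Up => -> ->.
Qed.

Lemma harmonic_lin U f g (a b : R) : open U -> harmonic_plane U f -> harmonic_plane U g ->
  harmonic_plane U (fun p => a * f p + b * g p).
Proof.
move=> Uo /(harmonic_partials _ Uo)[F1 [F2 hF]] /(harmonic_partials _ Uo)[G1 [G2 hG]].
apply/(harmonic_partials _ Uo).
exists (fun c p => a * F1 c p + b * G1 c p), (fun c d p => a * F2 c d p + b * G2 c d p).
move=> p Up; have [f1 f2 f3 f4] := hF p Up; have [g1 g2 g3 g4] := hG p Up.
have dlin F G v d1 d2 : is_derive p v F d1 -> is_derive p v G d2 ->
    is_derive p v (fun q => a * F q + b * G q) (a * d1 + b * d2).
  by move=> h1 h2; exact: (is_deriveD (is_deriveZ a h1) (is_deriveZ b h2)).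
split.
- by move=> c; exact: dlin.
- by move=> c d; exact: dlin.
- move=> c d; move: (f3 c d) (g3 c d) => cF cG.
  by apply: cvgD; (apply: cvgM; first exact: cvg_cst).
- by rewrite addrACA -!mulrDr f4 g4 !mulr0 addr0.
Qed.

(** Near infinity [g1 - g2] is known only to be bounded. Subtracting [(1 + eps) * g2] instead makes
    the difference tend to minus infinity there, and the maximum principle applies. *)
Lemma green_le (U : set (sphere R)) (g1 g2 : R[i] -> R) z : open (finite_part U) ->
  is_green_infty U g1 -> is_green_infty U g2 -> U (Some z) -> g1 z <= g2 z.
Proof.
move=> Uo [h1 [M1 [r1 b1]] l1] [h2 [M2 [r2 b2]] l2] Uz; rewrite leNgt; apply/negP => lt12.
pose d := g1 z - g2 z; have d0 : 0 < d by rewrite subr_gt0.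
have n0 : 0 < 2 * (`|g2 z| + 1) by rewrite mulr_gt0// ltr_wpDl.
(* Small enough that [eps * g2 z] is less than the gap [d]. *)
pose eps := d / (2 * (`|g2 z| + 1)); have eps0 : 0 < eps by rewrite divr_gt0.
have epsE : eps * (2 * (`|g2 z| + 1)) = d by rewrite /eps mulfVK// gt_eqF.
have hz : finite_part U (complex.Re z, complex.Im z) by rewrite /finite_part /= C_of_surj.
have := @max_principle R (finite_part U)
  (fun p => 1 * (g1 \o @C_of R) p + (- (1 + eps)) * (g2 \o @C_of R) p) Uo
  (harmonic_lin _ _ Uo h1 h2) _ _ _ hz.
rewrite /= C_of_surj => H.
have {H} : 1 * g1 z + - (1 + eps) * g2 z <= 0.
  apply: H => [x [clx nUx]|].
    have bx : bdry U x by split => //; rewrite (interior_id _).1.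
    rewrite -[X in _ --> X](_ : 1 * 0 + (- (1 + eps)) * 0 = 0); last by rewrite !mulr0 addr0.
    by apply: cvgD; (apply: cvgM; first exact: cvg_cst); [exact: l1|exact: l2].
  have [r r_ge0 [rr1 rr2]] := common_ub r1 r2.
  have [r' r'_ge0 [rr3 rr4]] := common_ub r (expR ((M1 + M2) / eps + M2)).
  exists r' => p Up pr; set w := C_of p in pr *.
  have L : (M1 + M2) / eps + M2 < ln (cnorm w).
    by rewrite -[X in X < _]expRK ltr_ln ?posrE ?expR_gt0//;
      [exact: le_lt_trans pr|exact: lt_trans pr].
  have {b1}b1 : g1 w - ln (cnorm w) <= M1.
    by apply: le_trans (ler_norm _) (b1 w _); apply: le_lt_trans pr; exact: le_trans rr3.
  have {b2}b2 : ln (cnorm w) - g2 w <= M2.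
    apply: le_trans (ler_norm _) _; rewrite distrC; apply: (b2 w _).
    by apply: le_lt_trans pr; exact: le_trans rr3.
  have g2w : (M1 + M2) / eps <= g2 w by lra.
  have : M1 + M2 <= eps * g2 w by rewrite mulrC -ler_pdivrMr.
  by move: b1 b2; move: (g1 w) (g2 w) (ln (cnorm w)) => x y t; lra.
have := ler_norm (g2 z).
move: epsE lt12 d0 n0 eps0; rewrite /d; move: (eps) (g1 z) (g2 z) `|g2 z| => E x y t; nra.
Qed.

End GreenUniqueness.

(** * The Green function of the complement of the arc *)

Section GreenArc.
Variables (R : realType) (alpha : R).
Hypothesis halpha : 0 < alpha < pi.
Implicit Types z : R[i].

Let e : R[i] := expi alpha.
Let b : R[i] := sinf alpha.
Let Oc : set R[i] := ~` Gamma alpha.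

Definition green_arc z : R :=
  ln (cnorm ((sqrt_mob alpha z + conjc b) * (sqrt_mob alpha z - b)^-1)).

Lemma sqrt_mob_neq_sinf z : Oc z -> sqrt_mob alpha z - b != 0.
Proof.
move=> Oz; have [ze _] := mob_off halpha Oz; have := mob_neqe halpha ze.
rewrite subr_eq0; apply: contra => /eqP h.
by rewrite -(sqrt_mob_sqr alpha) h /b sinf_sqr.
Qed.

Lemma sqrt_mob_add_conj z c : Oc z -> 0 < complex.Re c -> sqrt_mob alpha z + conjc c != 0.
Proof. by move=> Oz c0; apply: add_conj_neq0 => //; exact: Re_sqrt_mob. Qed.

Lemma green_arc_ratio z : Oc z -> green_arc z = - ln (sqrt_ratio alpha b z).
Proof.
move=> Oz; have h1 := sqrt_mob_neq_sinf Oz; have h2 := sqrt_mob_add_conj Oz (Re_sinf halpha).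
rewrite /green_arc /sqrt_ratio cnormM cnormV -[X in - ln X]invf_div lnV ?opprK//.
by rewrite posrE divr_gt0// cnorm_gt0.
Qed.

(** From [(s - b) * (s + b) * (z - e) = e ^+ 2 - 1], the inverse of [s - b] is [z - e] times
    quantities bounded above and away from 0. *)
Lemma green_arc_infty : exists M r : R, forall z, r < cnorm z ->
  `|green_arc z - ln (cnorm z)| <= M.
Proof.
have e1 : cnorm e = 1 by exact: cnorm_expi.
have b1 : cnorm b = 1 by exact: cnorm_sinf.
pose c := complex.Re b; have c0 : 0 < c by exact: Re_sinf.
pose c3 := cnorm (e ^+ 2 - 1).
have c30 : 0 < c3.
  have e0 : e != 0 by rewrite -cnorm_eq0 e1 oner_eq0.
  rewrite cnorm_gt0; apply/eqP => h.
  have n0 : 0 != e by rewrite eq_sym.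
  have := mob_neqe halpha n0; have := mobK n0; rewrite mul0r => h1 /eqP; apply.
  apply: (mulIf e0); rewrite -expr2; apply/eqP; rewrite -subr_eq0; apply/eqP.
  rewrite -[expi alpha]/e in h1 *; move/eqP: h; rewrite subr_eq0 => /eqP ->.
  by rewrite -h1.
(* For [|z| > 2], [|s + b|] and [|s + conjc b|] lie between [c] and 3, and [|z - e| / |z|] between
   1/2 and 2. *)
pose m := c * c / (2 * c3); pose M := 18 / c3.
have m0 : 0 < m by rewrite divr_gt0 ?mulr_gt0.
have M0 : 0 < M by rewrite divr_gt0.
exists (`|ln m| + `|ln M|), 2 => z z2.
have Oz : Oc z by move=> /(cnorm_Gamma halpha) h; move: z2; rewrite h; lra.
have [ze _] := mob_off halpha Oz.
have z0 : 0 < cnorm z by lra.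
have d1 := lerB_cnorm z e; have d2 := ler_cnormB z e; rewrite e1 in d1 d2.
have D0 : 0 < cnorm (z - e) by lra.
have s_sqr := sqrt_mob_sqr alpha z; have s0 := Re_sqrt_mob halpha Oz.
have sb := sqrt_mob_neq_sinf Oz; have sbJ := sqrt_mob_add_conj Oz (Re_sinf halpha).
rewrite /green_arc; move: (sqrt_mob alpha z) s_sqr s0 sb sbJ => s s_sqr s0 sb sbJ.
have sE : (s - b) * (s + b) * (z - e) = e ^+ 2 - 1.
  rewrite -subr_sqr s_sqr {1}/b sinf_sqr -/e mulrBl /mob -/e mulfVK ?subr_eq0//; ring.
have sb2 : s + b != 0.
  by apply/eqP => sb0; move: c30; rewrite /c3 -sE sb0 mulr0 mul0r cnorm0 ltxx.
have s2 : cnorm s <= 2.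
  have : cnorm s ^+ 2 <= 3.
    rewrite -cnormX s_sqr /mob cnormM cnormV -/e ler_pdivrMr//.
    have := ler_cnormB (z * e) 1; rewrite cnormM e1 mulr1 cnorm1; lra.
  have := cnorm_ge0 s; nra.
have reb : c <= cnorm (s + b).
  apply: le_trans (Re_le_cnorm _); rewrite [complex.Re (_ + _)]raddfD /=.
  by rewrite lerDr ltW.
have rebJ : c <= cnorm (s + conjc b).
  apply: le_trans (Re_le_cnorm _); rewrite [complex.Re (_ + _)]raddfD /=.
  by rewrite /c lerDr ltW.
have uJ : cnorm (s + conjc b) <= 3.
  by apply: le_trans (ler_cnormD _ _) _; rewrite cnormJ b1; lra.
have ub : cnorm (s + b) <= 3 by apply: le_trans (ler_cnormD _ _) _; rewrite b1; lra.
have -> : cnorm ((s + conjc b) * (s - b)^-1) =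
    cnorm z * (cnorm (s + conjc b) * cnorm (s + b) * (cnorm (z - e) / cnorm z) / c3).
  have -> : (s + conjc b) * (s - b)^-1 = (s + conjc b) * (s + b) * (z - e) / (e ^+ 2 - 1).
    have ze0 : z - e != 0 by rewrite subr_eq0.
    by rewrite -sE; clear -sb sb2 ze0; field; rewrite sb sb2 ze0.
  rewrite !cnormM cnormV -/c3; field; rewrite (gt_eqF c30) (gt_eqF z0)//.
have Dz1 : 1 / 2 <= cnorm (z - e) / cnorm z by rewrite ler_pdivlMr//; lra.
have Dz2 : cnorm (z - e) / cnorm z <= 2 by rewrite ler_pdivrMr//; lra.
set Q := _ / c3.
have Q1 : m <= Q.
  have -> : m = c * c * (1 / 2) / c3 by rewrite /m; move: (c3) c30 (c) => x x0 y; field; rewrite gt_eqF.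
  rewrite /Q ler_pM2r ?invr_gt0//; apply: ler_pM => //.
    by rewrite mulr_ge0// ltW.
  by apply: ler_pM => //; exact: ltW.
have Q2 : Q <= M.
  rewrite /M /Q ler_pM2r ?invr_gt0// (_ : 18 = 3 * 3 * 2); last by ring.
  apply: ler_pM Dz2; [by rewrite mulr_ge0 ?cnorm_ge0|by rewrite divr_ge0 ?cnorm_ge0|].
  by apply: ler_pM => //; exact: cnorm_ge0.
have Q0 : 0 < Q by exact: lt_le_trans Q1.
rewrite lnM ?posrE// addrC addKr.
have l1 : ln m <= ln Q by rewrite ler_ln ?posrE.
have l2 : ln Q <= ln M by rewrite ler_ln ?posrE.
have := ler_norm (ln M); have := ler_norm (- ln m); rewrite normrN.
move: l1 l2 (normr_ge0 (ln m)) (normr_ge0 (ln M)).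
move: (ln m) (ln Q) (ln M) `|ln m| `|ln M| => x y t x' t' h1 h2 h3 h4 h5 h6.
rewrite ler_norml; apply/andP; split; lra.
Qed.

Lemma green_arcP : is_green_infty (Omega alpha) green_arc.
Proof.
split; last 1 first.
- move=> x; rewrite (bdry_Omega halpha) => gx.
  have h := sqrt_ratio_cvg halpha (Re_sinf halpha) gx.
  have l1 : {for 1, continuous (@ln R)} by apply: continuous_ln; rewrite ltr01.
  have : - ln (sqrt_ratio alpha b (C_of q)) @[q --> within (finite_part (Omega alpha)) (nbhs x)]
      --> - ln (1 : R).
    by apply: cvgN; apply: (cvg_comp _ _ h); exact: l1.
  rewrite ln1 oppr0; apply: cvg_trans; apply: near_eq_cvg.
  rewrite (finite_part_Omega alpha); apply: (@filterE _ (nbhs x)) => q Oq.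
  by rewrite /= green_arc_ratio.
- rewrite (finite_part_Omega alpha).
  have -> : green_arc \o @C_of R = (fun z => ln (cnorm ((fun z =>
    (sqrt_mob alpha z + conjc b) * (sqrt_mob alpha z + - b)^-1) z))) \o @C_of R by [].
  apply: harmonic_ln_cnorm.
  + exact: copen_Gamma.
  + move=> z Oz; rewrite mulf_neq0 ?invr_eq0//; first exact: sqrt_mob_add_conj (Re_sinf halpha).
    exact: sqrt_mob_neq_sinf.
  + have hs := holn_sqrt_mob halpha 2.
    apply: holnM; first by apply: holnD => //; exact: holn_cst.
    apply: holnV; first by move=> z Oz; exact: sqrt_mob_neq_sinf.
    by apply: holnD => //; exact: holn_cst.
- exact: green_arc_infty.
Qed.

Lemma green_arc_unique g z : is_green_infty (Omega alpha) g -> Oc z -> g z = green_arc z.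
Proof.
move=> hg Oz; have Uo : open (finite_part (Omega alpha)).
  by rewrite (finite_part_Omega alpha); exact: open_Oc.
have Uz : Omega alpha (Some z) by move=> [y gy [yz]]; apply: Oz; rewrite -yz.
apply/eqP; rewrite eq_le; apply/andP; split; apply: (green_le Uo) => //; exact: green_arcP.
Qed.

End GreenArc.

(** * The harmonic extension of the logarithm of the weight *)

Section HarmonicMeasure.
Variables (R : realType) (alpha beta : R) (k : nat) (u : 'I_k -> R[i]).
Hypothesis halpha : 0 < alpha < pi.
Hypothesis hu : forall j, 1 < cnorm (u j).
Implicit Types (z s : R[i]) (p q x : R * R).

Let e : R[i] := expi alpha.
Let b : R[i] := sinf alpha.
Let Oc : set R[i] := ~` Gamma alpha.
Let sj j := sqrt_mob alpha (u j).

Lemma continuous_cnorm_sub z : continuous (fun q : R * R => cnorm (C_of q - z)).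
Proof.
move=> p; apply/cvgrPdist_le => eps eps0; apply/nbhs_C_of; exists eps => // q hq.
apply: le_trans hq; apply: le_trans (ler_cnorm_dist _ _) _.
by rewrite opprB addrA subrK -cnormN opprB.
Qed.

Let Oc_u j : Oc (u j).
Proof. by move=> /(cnorm_Gamma halpha) h; have := hu j; rewrite h ltxx. Qed.

Arguments Oc_u : clear implicits.

Let sj_gt0 j : 0 < complex.Re (sj j).
Proof. exact: (Re_sqrt_mob halpha (Oc_u j)). Qed.

Let e_neq_u j : e - u j != 0.
Proof.
rewrite subr_eq0; apply/eqP => h; have := hu j.
by rewrite -h /e cnorm_expi ltxx.
Qed.

(* On the arc, where [s] is purely imaginary or infinite, the modulus is [|z - u j|]. *)
Definition pole_factor j s : R[i] :=
  (e - u j) * ((s + sj j) * (s + conjc (sj j))) * ((s + b) * (s + conjc b))^-1.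

Lemma pole_factor_den s : 0 < complex.Re s -> (s + b) * (s + conjc b) != 0.
Proof.
move=> s0; have b0 := Re_sinf halpha.
have h : s + conjc (conjc b) != 0 by apply: add_conj_neq0 => //; move: b0; rewrite /b; case: sinf.
by rewrite conjcK in h; rewrite mulf_neq0 ?add_conj_neq0.
Qed.

Lemma pole_factor_neq0 j s : 0 < complex.Re s -> pole_factor j s != 0.
Proof.
move=> s0; have sj0 := sj_gt0 j.
have h : s + conjc (conjc (sj j)) != 0 by apply: add_conj_neq0 => //; move: sj0; case: (sj j).
rewrite conjcK in h.
by rewrite /pole_factor !mulf_neq0 ?invr_eq0 ?pole_factor_den ?add_conj_neq0.
Qed.

Lemma holn_pole_factor n j (U : set R[i]) (f : R[i] -> R[i]) :
  (forall z, U z -> 0 < complex.Re (f z)) -> holn n U f ->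
  holn n U (fun z => pole_factor j (f z)).
Proof.
move=> f0 hf; apply: holnM; last first.
  apply: holnV; first by move=> z Uz; apply: pole_factor_den; exact: f0.
  by apply: holnM; apply: holnD => //; exact: holn_cst.
by apply: holnM; [exact: holn_cst|apply: holnM; apply: holnD => //; exact: holn_cst].
Qed.

(** [z - u j] is [e - u j] times [(s - sj j) (s + sj j)] over [(s - b) (s + b)]. [pole_factor]
    reflects the zero [sj j] and the pole [b] into the left half-plane, and [sqrt_ratio] measures
    both changes; as it tends to 1, the boundary moduli agree. *)
Lemma pole_factor_ratio j z : Oc z ->
  cnorm (pole_factor j (sqrt_mob alpha z)) * sqrt_ratio alpha (sj j) z =
  cnorm (z - u j) * sqrt_ratio alpha b z.
Proof.
move=> Oz; have s0 := Re_sqrt_mob halpha Oz; have ssqr := sqrt_mob_sqr alpha z.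
have sj0 := sj_gt0 j.
have [ze _] := mob_off halpha Oz; have [ue _] := mob_off halpha (Oc_u j).
have jsqr := sqrt_mob_sqr alpha (u j); rewrite -/(sj j) in jsqr.
have bsqr : b ^+ 2 = e by exact: sinf_sqr.
have h1 := pole_factor_den s0; have h2 := add_conj_neq0 sj0 s0.
rewrite /sqrt_ratio /pole_factor -!cnormV -!cnormM.
move: (sqrt_mob alpha z) s0 ssqr h1 h2 => s s0 ssqr h1 h2.
congr cnorm; move: h1; rewrite mulf_eq0 negb_or => /andP[h1 h3].
move: ssqr jsqr; rewrite /mob -/e => ssqr jsqr.
have ze0 : z - e != 0 by rewrite subr_eq0.
have ue0 : u j - e != 0 by rewrite subr_eq0.
have E1 : (s - sj j) * (s + sj j) * (z - e) * (u j - e) = (z - u j) * (1 - e ^+ 2).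
  rewrite -subr_sqr ssqr jsqr; by field; rewrite ze0 ue0.
have E2 : (s - b) * (s + b) * (z - e) = e ^+ 2 - 1.
  by rewrite -subr_sqr ssqr bsqr; field.
apply: (mulIf ze0); apply: (mulIf h1).
transitivity ((e - u j) * ((s - sj j) * (s + sj j) * (z - e)) / (s + conjc b)).
  move: (conjc (sj j)) h2 => c h2; move: (conjc b) h3 => d h3.
  by clear -h1 h2 h3; field; rewrite h1 h2 h3.
have -> : (e - u j) * ((s - sj j) * (s + sj j) * (z - e)) = (z - u j) * ((s - b) * (s + b) * (z - e)).
  by rewrite E2 -[e - u j]opprB mulNr mulrC E1; ring.
move: (conjc b) h3 => d h3; by field.
Qed.

Lemma pole_factor_cvg j x : Gamma alpha (C_of x) ->
  cnorm (pole_factor j (sqrt_mob alpha (C_of q)))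
    @[q --> within (finite_part (Omega alpha)) (nbhs x)] --> cnorm (C_of x - u j).
Proof.
move=> gx; have sj0 := sj_gt0 j.
have h1 := sqrt_ratio_cvg halpha sj0 gx.
have h2 := sqrt_ratio_cvg halpha (Re_sinf halpha) gx.
have h3 : cnorm (C_of q - u j) @[q --> within (finite_part (Omega alpha)) (nbhs x)] -->
    cnorm (C_of x - u j).
  by apply: cvg_within_filter; exact: continuous_cnorm_sub.
have : cnorm (C_of q - u j) * sqrt_ratio alpha b (C_of q) / sqrt_ratio alpha (sj j) (C_of q)
    @[q --> within (finite_part (Omega alpha)) (nbhs x)] --> cnorm (C_of x - u j) * 1 / 1.
  by apply: cvgM; [exact: cvgM|apply: cvgV => //; exact: oner_neq0].
rewrite mulr1 divr1; apply: cvg_trans; apply: near_eq_cvg.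
have n0 : \forall q \near within (finite_part (Omega alpha)) (nbhs x),
    sqrt_ratio alpha (sj j) (C_of q) != 0 by exact: (cvgr_neq0 _ h1 (oner_neq0 _)).
move: n0; rewrite (finite_part_Omega alpha).
apply: (@filterS _ (nbhs x) (nbhs_filter x)) => q n0 Oq.
by rewrite -pole_factor_ratio// mulfK// n0.
Qed.

Lemma cvg_prodr (T : Type) (F : set_system T) (FF : Filter F) (I : Type) (r : seq I)
    (f : I -> T -> R) (l : I -> R) : (forall i, f i t @[t --> F] --> l i) ->
  \prod_(i <- r) f i t @[t --> F] --> \prod_(i <- r) l i.
Proof.
move=> h; elim: r => [|i r IH].
  by under eq_fun do rewrite big_nil; rewrite big_nil; exact: cvg_cst.
by under eq_fun do rewrite big_cons; rewrite big_cons; exact: cvgM.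
Qed.

Lemma cnorm_weight z : cnorm (weight beta u z) = (\prod_j cnorm (z - u j))^-1.
Proof. by rewrite /weight cnormM cnorm_expi mul1r cnormV cnorm_prod. Qed.

(** The solution of the Dirichlet problem with data [ln |w|], harmonic also at infinity. *)
Let h (S : sphere R) : R := ln (cnorm (\prod_j (pole_factor j (sphere_sqrt alpha S))^-1)).

Let hE S : 0 < complex.Re (sphere_sqrt alpha S) ->
  h S = - ln (\prod_j cnorm (pole_factor j (sphere_sqrt alpha S))).
Proof.
move=> S0; rewrite /h cnorm_prod; under eq_bigr do rewrite cnormV.
rewrite prodfV lnV// posrE prodr_gt0// => j _.
by rewrite cnorm_gt0 pole_factor_neq0.
Qed.

Let harmonic_h (f : R[i] -> R[i]) : (forall z, Oc z -> 0 < complex.Re (f z)) -> holn 2 Oc f ->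
  harmonic_plane (@C_of R @^-1` Oc)
    ((fun z => ln (cnorm (\prod_j (pole_factor j (f z))^-1))) \o @C_of R).
Proof.
move=> f0 hf; apply: (@harmonic_ln_cnorm R Oc (fun z => \prod_j (pole_factor j (f z))^-1)).
- exact: copen_Gamma.
- move=> z Oz; apply/prodf_neq0 => j _; rewrite invr_eq0 pole_factor_neq0//; exact: f0.
- apply: holn_prod => j; apply: holnV; last exact: holn_pole_factor.
  by move=> z Oz; rewrite pole_factor_neq0//; exact: f0.
Qed.

Lemma Re_sphere_sqrt S : Omega alpha S -> 0 < complex.Re (sphere_sqrt alpha S).
Proof.
case: S => [z|] OS /=; last exact: Re_sinf.
by apply: Re_sqrt_mob => // gz; apply: OS; exists z.
Qed.

Lemma expR_integral_ln_weight u0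
    (omega : probability (measurableTypeR R * measurableTypeR R)%type R) :
  Omega alpha u0 -> is_harmonic_measure (Omega alpha) u0 omega ->
  expR (\int[omega]_(x in @C_of R @^-1` Gamma alpha) ln (cnorm (weight beta u (C_of x)))) =
  (\prod_j cnorm (pole_factor j (sphere_sqrt alpha u0)))^-1.
Proof.
move=> Ou0 [_ H]; have P0 j : 0 < cnorm (pole_factor j (sphere_sqrt alpha u0)).
  by rewrite cnorm_gt0 pole_factor_neq0// Re_sphere_sqrt.
have W0 x : Gamma alpha (C_of x) -> 0 < \prod_j cnorm (C_of x - u j).
  move=> gx; apply: prodr_gt0 => j _; rewrite cnorm_gt0 subr_eq0.
  by apply/eqP => E; have := Oc_u j; rewrite -E.
have WE x : Gamma alpha (C_of x) -> ln (cnorm (weight beta u (C_of x))) =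
    - ln (\prod_j cnorm (C_of x - u j)).
  by move=> gx; rewrite cnorm_weight lnV// posrE W0.
rewrite -(bdry_Omega halpha) (H _ h).
- by rewrite hE ?Re_sphere_sqrt// expRN lnK// posrE prodr_gt0.
- rewrite (bdry_Omega halpha).
  apply: (@subspace_eq_continuous _ _ _ (fun x => - ln (\prod_j cnorm (C_of x - u j)))).
    by move=> x; rewrite inE => gx /=; exact/esym/WE.
  apply: continuous_in_subspaceT => x; rewrite inE => gx.
  apply: cvgN; apply: (@cvg_comp _ _ _ (fun x => \prod_j cnorm (C_of x - u j)) (@ln R) _
     (nbhs (\prod_j cnorm (C_of x - u j)))); last by apply: continuous_ln; exact: W0.
  by apply: cvg_prodr => j; exact: continuous_cnorm_sub.
- split; first by rewrite (finite_part_Omega alpha); apply: harmonic_h;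
    [move=> z Oz; exact: Re_sqrt_mob|exact: holn_sqrt_mob].
  rewrite (chart_Omega halpha).
  have -> : h \o @chart_infty R = (fun z => ln (cnorm (\prod_j
      (pole_factor j (chart_sqrt alpha z))^-1))) \o @C_of R.
    by apply/funext => p; rewrite /h /= chart_sqrtE.
  by apply: harmonic_h; [exact: chart_sqrt_gt0|exact: holn_chart_sqrt].
- move=> x; rewrite (bdry_Omega halpha) => gx; rewrite WE//.
  have c : - ln (\prod_j cnorm (pole_factor j (sqrt_mob alpha (C_of q))))
      @[q --> within (finite_part (Omega alpha)) (nbhs x)] -->
      - ln (\prod_j cnorm (C_of x - u j)).
    apply: cvgN; apply: (@cvg_comp _ _ _ (fun q => \prod_j cnorm (pole_factor j
      (sqrt_mob alpha (C_of q)))) (@ln R) _ (nbhs (\prod_j cnorm (C_of x - u j)))); last first.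
      by apply: continuous_ln; exact: W0.
    by apply: cvg_prodr => j; exact: pole_factor_cvg.
  apply: cvg_trans c; apply: near_eq_cvg.
  rewrite (finite_part_Omega alpha); apply: (@filterE _ (nbhs x)) => q Oq.
  have s0 : 0 < complex.Re (sphere_sqrt alpha (Some (C_of q))) by exact: Re_sqrt_mob.
  by rewrite hE.
Qed.

End HarmonicMeasure.

(** * Capacity of the arc *)

Section Expectation.
Context d (T : measurableType d) (R : realType) (P : probability T R).
Implicit Types (f g : T -> R) (D : set T).

(** Holds without measurability, the integral being a difference of suprema over simple functions
    below the positive and negative parts. It serves for the inner integral of the energy as a
    function of [x]. *)
Lemma integral_monotone (f g : T -> \bar R) : (forall x, (f x <= g x)%E) ->
  (\int[P]_x f x <= \int[P]_x g x)%E.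
Proof.
move=> fg; rewrite /integral; apply: leeB; apply: ereal_sup_le => _ [h hh <-]; exists h => // x;
  apply: le_trans (hh x) _; rewrite !patch_setT !(funeposE, funenegE).
  by rewrite ge_max !le_max fg lexx !orbT.
by rewrite ge_max !le_max leeN2 fg lexx !orbT.
Qed.

Definition bounded_measurable f :=
  measurable_fun [set: T] f /\ exists M : R, forall x, `|f x| <= M.

Lemma bm_integrable f : bounded_measurable f -> P.-integrable [set: T] (EFin \o f).
Proof.
move=> [mf [M hM]]; apply: measurable_bounded_integrable => //.
  have P1 : P [set: T] = 1%E by exact: probability_setT.
  by rewrite [X in (X < _)%E]P1 ltry.
exists M; split; first by rewrite num_real.
by move=> x Mx y _; exact: le_trans (hM y) (ltW Mx).
Qed.

Lemma bm_cst (c : R) : bounded_measurable (fun=> c).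
Proof. by split; [exact: measurable_cst|exists `|c|]. Qed.

Lemma bmD f g : bounded_measurable f -> bounded_measurable g ->
  bounded_measurable (fun x => f x + g x).
Proof.
move=> [mf [M hM]] [mg [N hN]]; split; first exact: measurable_funD.
by exists (M + N) => x; apply: le_trans (ler_normD _ _) _; exact: lerD.
Qed.

Lemma bmM f g : bounded_measurable f -> bounded_measurable g ->
  bounded_measurable (fun x => f x * g x).
Proof.
move=> [mf [M hM]] [mg [N hN]]; split; first exact: measurable_funM.
by exists (M * N) => x; rewrite normrM; apply: ler_pM.
Qed.

Lemma bmZ (c : R) f : bounded_measurable f -> bounded_measurable (fun x => c * f x).
Proof. by move=> hf; apply: bmM => //; exact: bm_cst. Qed.

Lemma bmZr (c : R) f : bounded_measurable f -> bounded_measurable (fun x => f x * c).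
Proof. by move=> hf; apply: bmM => //; exact: bm_cst. Qed.

Lemma bm_sum (I : Type) (r : seq I) (F : I -> T -> R) :
  (forall i, bounded_measurable (F i)) -> bounded_measurable (fun x => \sum_(i <- r) F i x).
Proof.
move=> hF; elim: r => [|i r IH].
  by under eq_fun do rewrite big_nil; exact: bm_cst.
by under eq_fun do rewrite big_cons; exact: bmD.
Qed.

Local Notation mean f := (\int[P]_x f x).

Lemma mean_cst (c : R) : mean (fun=> c) = c.
Proof.
have P1 : P [set: T] = 1%E by exact: probability_setT.
by rewrite Rintegral_cst//= P1 mulr1.
Qed.

Lemma meanD f g : bounded_measurable f -> bounded_measurable g ->
  mean (fun x => f x + g x) = mean f + mean g.
Proof. by move=> hf hg; rewrite RintegralD//; exact: bm_integrable. Qed.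

Lemma meanZ (c : R) f : bounded_measurable f -> mean (fun x => c * f x) = c * mean f.
Proof. by move=> hf; rewrite RintegralZl//; exact: bm_integrable. Qed.

Lemma mean_sum (I : Type) (r : seq I) (F : I -> T -> R) :
  (forall i, bounded_measurable (F i)) ->
  mean (fun x => \sum_(i <- r) F i x) = \sum_(i <- r) mean (F i).
Proof.
move=> hF; elim: r => [|i r IH].
  by under eq_Rintegral do rewrite big_nil; rewrite big_nil mean_cst.
under eq_Rintegral do rewrite big_cons.
by rewrite big_cons meanD// ?IH//; exact: bm_sum.
Qed.

Lemma mean_le f g : bounded_measurable f -> bounded_measurable g -> (forall x, f x <= g x) ->
  mean f <= mean g.
Proof. by move=> hf hg fg; apply: le_Rintegral => //; exact: bm_integrable. Qed.

Lemma mean_EFin f : bounded_measurable f -> (\int[P]_x (f x)%:E)%E = (mean f)%:E.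
Proof.
by move=> hf; rewrite /Rintegral fineK//; apply: integrable_fin_num => //; exact: bm_integrable.
Qed.

Lemma ae_eq_mean D (f : T -> R) (g : T -> \bar R) : measurable D -> P D = 1%E ->
  bounded_measurable f -> measurable_fun [set: T] g -> (forall x, D x -> g x = (f x)%:E) ->
  (\int[P]_x g x)%E = (mean f)%:E.
Proof.
move=> mD PD hf mg fg; rewrite -mean_EFin//; apply: ae_eq_integral => //.
  by apply/measurable_EFinP; case: hf.
exists (~` D); split; first exact: measurableC.
  apply: etrans (probability_setC P mD) _.
  by rewrite [X in (_ - X)%E]PD subee.
by move=> x /= h; apply: contra_not h => Dx _; exact: fg.
Qed.

Lemma measurable_patch_ae D f (y : \bar R) : measurable D -> measurable_fun [set: T] f ->
  measurable_fun [set: T] (fun x => if x \in D then (f x)%:E else y).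
Proof.
move=> mD mf; apply: measurable_fun_ifT.
- by apply: (measurable_fun_bool true); rewrite setTI preimage_mem_true.
- exact/measurable_EFinP.
- exact: measurable_cst.
Qed.

(* The function integrated need not be measurable, nor controlled off the
   full set D: it is compared with a minorant equal to -oo there. *)
Lemma integral_ge_on D f (F : T -> \bar R) : measurable D -> P D = 1%E -> bounded_measurable f ->
  (forall x, D x -> ((f x)%:E <= F x)%E) -> ((mean f)%:E <= \int[P]_x F x)%E.
Proof.
move=> mD PD hf fF.
rewrite -(@ae_eq_mean D f (fun x => if x \in D then (f x)%:E else -oo%E))//.
- apply: integral_monotone => x; case: ifPn => [|_]; last exact: leNye.
  by rewrite inE; exact: fF.
- by apply: measurable_patch_ae => //; case: hf.
- by move=> x Dx; rewrite mem_set.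
Qed.

Lemma integral_le_on D (c : R) (F : T -> \bar R) : measurable D -> P D = 1%E ->
  (forall x, D x -> (F x <= c%:E)%E) -> (\int[P]_x F x <= c%:E)%E.
Proof.
move=> mD PD fF; rewrite -[c in leRHS]mean_cst.
rewrite -(@ae_eq_mean D (fun=> c) (fun x => if x \in D then c%:E else +oo%E))//.
- apply: integral_monotone => x; case: ifPn => [|_]; last exact: leey.
  by rewrite inE; exact: fF.
- exact: bm_cst.
- by apply: measurable_patch_ae => //; exact: measurable_cst.
- by move=> x Dx; rewrite mem_set.
Qed.

End Expectation.

(** * The truncated logarithmic series *)

Section LogSeries.
Variable R : realType.
Implicit Types z : R[i].

Lemma is_derive_sum_pow (M : nat) (c : nat -> R) (t : R) :
  is_derive t (1 : R) (fun s => \sum_(m < M) c m * s ^+ m.+1) (\sum_(m < M) (m.+1%:R * c m) * t ^+ m).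
Proof.
elim: M => [|M IH].
  by under eq_fun do rewrite big_ord0; rewrite big_ord0; exact: is_derive_cst.
under eq_fun do rewrite big_ord_recr /=; rewrite big_ord_recr /=.
apply: is_deriveD.
have -> : (fun s : R => c M * s ^+ M.+1) = c M \*: (id ^+ M.+1).
  by apply/funext => s; rewrite /= /GRing.scale /= fctE.
by apply: is_derive_eq; rewrite /GRing.scale /= mulr1 -mulr_natl; ring.
Qed.

Lemma is_derive_ln_quadratic (a n t : R) : 0 < 1 - 2 * a * t + n * t ^+ 2 ->
  is_derive t (1 : R) (fun s => ln (1 - 2 * a * s + n * s ^+ 2) / 2)
    ((n * t - a) / (1 - 2 * a * t + n * t ^+ 2)).
Proof.
move=> q0; have hq : is_derive t (1 : R) (fun s => 1 * (n * (s * s) + (- (2 * a)) * s + 1))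
   (2 * n * t - 2 * a).
  have -> : (fun s : R => 1 * (n * (s * s) + (- (2 * a)) * s + 1)) =
    n \*: (id * id) + (- (2 * a)) \*: id + cst 1.
    by apply/funext => s; rewrite /= /GRing.scale /= mul1r.
  by apply: is_derive_eq; rewrite /GRing.scale /=; ring.
have E s : 1 * (n * (s * s) + (- (2 * a)) * s + 1) = 1 - 2 * a * s + n * s ^+ 2 by ring.
under eq_fun do rewrite -E mulrC.
have hl := @is_derive1_ln R (1 * (n * (t * t) + (- (2 * a)) * t + 1)).
rewrite E in hl; have {}hl := hl q0.
have := is_deriveZ 2^-1 (@is_derive1_comp R (@ln R) (fun s => 1 * (n * (s * s) + (- (2 * a)) * s + 1))
  t _ _ _ hq); rewrite E => /(_ _ hl) h.
apply: is_derive_eq; rewrite /GRing.scale /=; field.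
by rewrite gt_eqF.
Qed.

Lemma cnorm_one_sub_scale z (t : R) : cnorm (1 - real_complex R t * z) ^+ 2 =
  1 - 2 * complex.Re z * t + cnorm z ^+ 2 * t ^+ 2.
Proof. by rewrite !cnorm_sqr; case: z => a b /=; ring. Qed.

(** The mean value theorem along [t * z] for [t] in [0, 1]: the derivative is, up to sign, the real
    part of [z] times the tail of the geometric series. *)
Lemma ln_cnorm_series z (M : nat) : cnorm z < 1 ->
  `|ln (cnorm (1 - z)) + \sum_(m < M) m.+1%:R^-1 * complex.Re (z ^+ m.+1)| <=
  cnorm z ^+ M.+1 / (1 - cnorm z).
Proof.
move=> z1; have z0 := cnorm_ge0 z.
pose a := complex.Re z; pose n := cnorm z ^+ 2.
have tz (t : R) : 0 <= t <= 1 -> cnorm (real_complex R t * z) <= cnorm z.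
  by move=> /andP[t0 t1]; rewrite cnormM cnorm_real ger0_norm// ler_piMl.
have q0 (t : R) : 0 <= t <= 1 -> 0 < 1 - 2 * a * t + n * t ^+ 2.
  move=> /tz ht; rewrite -cnorm_one_sub_scale exprn_gt0// cnorm_gt0.
  by have := @one_sub_neq0 R (real_complex R t * z) 1 (le_lt_trans ht z1); rewrite cnorm1 mulr1; exact.
pose phi (t : R) := ln (1 - 2 * a * t + n * t ^+ 2) / 2 +
  \sum_(m < M) (m.+1%:R^-1 * complex.Re (z ^+ m.+1)) * t ^+ m.+1.
pose dphi (t : R) := (n * t - a) / (1 - 2 * a * t + n * t ^+ 2) +
  \sum_(m < M) (m.+1%:R * (m.+1%:R^-1 * complex.Re (z ^+ m.+1))) * t ^+ m.
have dphiE (t : R) : 0 <= t <= 1 -> dphi t = - complex.Re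
    (z * ((1 - real_complex R t * z)^-1 - \sum_(i < M) (real_complex R t * z) ^+ i)).
  move=> ht; rewrite mulrBr [complex.Re (_ - _)]raddfB opprB addrC /=; congr (_ + _); last first.
    rewrite mulr_sumr raddf_sum; apply: eq_bigr => m _.
    rewrite mulrA mulfV ?pnatr_eq0// mul1r exprMn mulrCA -exprS -rcX.
    by case: (z ^+ m.+1) => x y /=; rewrite mul0r subr0 mulrC.
  have w0 : 1 - real_complex R t * z != 0.
    by have := q0 _ ht; rewrite -cnorm_one_sub_scale; apply: contraTneq => ->; rewrite cnorm0 expr0n ltxx.
  have -> : (1 - real_complex R t * z)^-1 = conjc (1 - real_complex R t * z) /
     real_complex R (cnorm (1 - real_complex R t * z) ^+ 2).
    rewrite -mulcJ invfM mulrCA mulfV ?mulr1//.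
    by apply: contraNneq w0 => h; rewrite -[1 - _]conjcK h; apply/eqP; exact: rmorph0.
  rewrite cnorm_one_sub_scale -/a -/n; move: (1 - 2 * a * t + _) (q0 t ht) => q qp.
  rewrite -rcV /n cnorm_sqr /a; case: (z) => x y /=; ring.
have -> : ln (cnorm (1 - z)) + \sum_(m < M) m.+1%:R^-1 * complex.Re (z ^+ m.+1) = phi 1 - phi 0.
  have -> : phi 0 = 0.
    rewrite /phi expr0n /= !mulr0 subr0 addr0 ln1 mul0r add0r big1// => i _.
    by rewrite expr0n mulr0.
  rewrite subr0 /phi; congr (_ + _); last by apply: eq_bigr => i _; rewrite expr1n mulr1.
  rewrite -cnorm_one_sub_scale rc1 mul1r lnXn ?mulr2n; last first.
    have := q0 1; rewrite ler01 lexx -cnorm_one_sub_scale rc1 mul1r => /(_ isT).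
    by rewrite exprn_even_gt0//= cnorm_eq0 => h; rewrite cnorm_gt0.
  by rewrite -mulr2n -mulr_natr mulfK// pnatr_eq0.
rewrite -[leRHS]mulr1 -[X in _ * X]subr0.
apply: (@mvt_le R phi dphi) => // t ht.
  apply: is_deriveD; first by apply: is_derive_ln_quadratic; exact: q0.
  exact: (is_derive_sum_pow M (fun m => m.+1%:R^-1 * complex.Re (z ^+ m.+1)) t).
rewrite dphiE// normrN; apply: le_trans (cnorm_Re _) _; rewrite cnormM exprS -mulrA.
by rewrite ler_wpM2l//; apply: geo_tail => //; exact: tz.
Qed.

End LogSeries.

(** * Means over a uniform angle and Jensen's formula *)

Section CircleMean.
Variable R : realType.
Implicit Types (h : R -> R[i]) (a c t : R[i]).

Lemma circle_length : 0 < 2 * pi :> R.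
Proof. by rewrite mulr_gt0 ?pi_gt0. Qed.

Definition uniform_angle := uniform_prob circle_length.

Local Notation mean f := (\int[uniform_angle]_x f x).

Definition cpath h :=
  continuous (fun x => complex.Re (h x)) /\ continuous (fun x => complex.Im (h x)).

Lemma cpath_cst c : cpath (fun=> c).
Proof. by split; exact: cst_continuous. Qed.

Lemma cpath_expi : cpath (@expi R).
Proof. by split; [exact: continuous_cos|exact: continuous_sin]. Qed.

Lemma cpathD h1 h2 : cpath h1 -> cpath h2 -> cpath (fun x => h1 x + h2 x).
Proof.
move=> [a1 b1] [a2 b2]; split => x.
  have -> : (fun x => complex.Re (h1 x + h2 x)) = (fun x => complex.Re (h1 x) + complex.Re (h2 x)).
    by apply/funext => y; case: (h1 y) (h2 y) => ? ? [].
  exact: cvgD (a1 x) (a2 x).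
have -> : (fun x => complex.Im (h1 x + h2 x)) = (fun x => complex.Im (h1 x) + complex.Im (h2 x)).
  by apply/funext => y; case: (h1 y) (h2 y) => ? ? [].
exact: cvgD (b1 x) (b2 x).
Qed.

Lemma cpathM h1 h2 : cpath h1 -> cpath h2 -> cpath (fun x => h1 x * h2 x).
Proof.
move=> [a1 b1] [a2 b2]; split => x.
  have -> : (fun x => complex.Re (h1 x * h2 x)) = (fun x => complex.Re (h1 x) * complex.Re (h2 x) -
      complex.Im (h1 x) * complex.Im (h2 x)).
    by apply/funext => y; case: (h1 y) (h2 y) => ? ? [].
  exact: cvgB (cvgM (a1 x) (a2 x)) (cvgM (b1 x) (b2 x)).
have -> : (fun x => complex.Im (h1 x * h2 x)) = (fun x => complex.Re (h1 x) * complex.Im (h2 x) +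
    complex.Im (h1 x) * complex.Re (h2 x)).
  by apply/funext => y; case: (h1 y) (h2 y) => ? ? [].
exact: cvgD (cvgM (a1 x) (b2 x)) (cvgM (b1 x) (a2 x)).
Qed.

Lemma cpathX n h : cpath h -> cpath (fun x => h x ^+ n).
Proof.
move=> hc; elim: n => [|n IH]; first by under eq_fun do rewrite expr0; exact: cpath_cst.
by under eq_fun do rewrite exprS; exact: cpathM.
Qed.

Lemma continuous_cnorm_path h : cpath h -> continuous (fun x => cnorm (h x)).
Proof.
move=> [a b] x.
have -> : (fun x => cnorm (h x)) =
    (fun x => Num.sqrt (complex.Re (h x) * complex.Re (h x) + complex.Im (h x) * complex.Im (h x))).
  by apply/funext => y; rewrite /cnorm; case: (h y) => ? ? /=; rewrite !expr2.
apply: (@continuous_comp _ _ _ (fun x => complex.Re (h x) * complex.Re (h x) +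
  complex.Im (h x) * complex.Im (h x)) Num.sqrt); last exact: sqrt_continuous.
exact: cvgD (cvgM (a x) (a x)) (cvgM (b x) (b x)).
Qed.

Lemma cpathV h : (forall x, h x != 0) -> cpath h -> cpath (fun x => (h x)^-1).
Proof.
move=> h0 hc; have hn := continuous_cnorm_path hc; case: (hc) => a b.
have n0 x : cnorm (h x) * cnorm (h x) != 0 by rewrite mulf_neq0// cnorm_eq0.
have hE x : (h x)^-1 = conjc (h x) * real_complex R (cnorm (h x) * cnorm (h x))^-1.
  rewrite rcV -expr2 -mulcJ invfM mulrCA mulfV ?mulr1//.
  by apply: contraNneq (h0 x) => E; rewrite -[h x]conjcK E; apply/eqP; exact: rmorph0.
split => x.
  have -> : (fun x => complex.Re (h x)^-1) =
      (fun x => complex.Re (h x) * (cnorm (h x) * cnorm (h x))^-1).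
    by apply/funext => y; rewrite hE; case: (h y) => ? ? /=; rewrite mulr0 subr0.
  exact: cvgM (a x) (cvgV (n0 x) (cvgM (hn x) (hn x))).
have -> : (fun x => complex.Im (h x)^-1) =
    (fun x => - complex.Im (h x) * (cnorm (h x) * cnorm (h x))^-1).
  by apply/funext => y; rewrite hE; case: (h y) => ? ? /=; rewrite mulr0 add0r.
exact: cvgM (cvgN (b x)) (cvgV (n0 x) (cvgM (hn x) (hn x))).
Qed.

Lemma bm_continuous (f : R -> R) (M : R) : continuous f -> (forall x, `|f x| <= M) ->
  @bounded_measurable _ (measurableTypeR R) R f.
Proof. by move=> cf hM; split; [exact: continuous_measurable_fun|exists M]. Qed.

Lemma mean_FTC (f F : R -> R) (M : R) : continuous f -> (forall x, `|f x| <= M) ->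
  (forall x, is_derive x (1 : R) F (f x)) -> F (2 * pi) = F 0 -> mean f = 0.
Proof.
move=> cf hM dF F0; have bf := bm_continuous cf hM.
have M0 : 0 <= M by exact: le_trans (normr_ge0 _) (hM 0).
have bfM : @bounded_measurable _ (measurableTypeR R) R (fun x => f x + M).
  by apply: bmD => //; exact: bm_cst.
(* The shift makes the integrand nonnegative, as [integral_uniform] asks. *)
suff : mean (fun x => f x + M) = M.
  by rewrite meanD//; [rewrite mean_cst; lra|exact: bm_cst].
have mf : measurable_fun [set: measurableTypeR R] (fun x => (f x + M)%:E).
  by apply/measurable_EFinP; case: bfM.
rewrite /Rintegral integral_uniform//; last first.
  by move=> x; rewrite lee_fin; have := hM x; rewrite ler_norml => /andP[? ?]; lra.
have dG x : is_derive x (1 : R) (F + (fun x => M * x)) (f x + M).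
  apply: is_deriveD; have -> : (fun x : R => M * x) = M \*: id by apply/funext.
  by apply: is_derive_eq; rewrite /GRing.scale /= mulr1.
have cG : continuous (F + (fun x => M * x)).
  by move=> x; apply/differentiable_continuous/derivable1_diffP; have [] := dG x.
rewrite (@continuous_FTC2 R (fun x => f x + M) (F + (fun x => M * x)))//.
- transitivity ((2 * pi)^-1 * (F (2 * pi) + M * (2 * pi) - (F 0 + M * 0))); first by rewrite subr0.
  have pi0 : 2 * pi != 0 :> R by rewrite gt_eqF// circle_length.
  by rewrite F0 mulr0 addr0 addrAC subrr add0r mulrCA mulVf ?mulr1.
- exact: circle_length.
- apply: continuous_subspaceT => x; apply: cvgD; [exact: cf|exact: cvg_cst].
- split.
  + by move=> x _; have [] := dG x.
  + by apply: cvg_at_right_filter; exact: cG.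
  + by apply: cvg_at_left_filter; exact: cG.
- by move=> x _; rewrite derive1E; have [_ ->] := dG x.
Qed.

Lemma is_derive_sinM (k x : R) : is_derive x (1 : R) (fun s => sin (k * s)) (k * cos (k * x)).
Proof.
have hk : is_derive x (1 : R) (fun s => k * s) k.
  have -> : (fun s : R => k * s) = k \*: id by apply/funext.
  by apply: is_derive_eq; rewrite /GRing.scale /= mulr1.
by apply: is_derive_eq (is_derive1_comp _ _) _; rewrite mulrC.
Qed.

Lemma is_derive_cosM (k x : R) : is_derive x (1 : R) (fun s => cos (k * s)) (- k * sin (k * x)).
Proof.
have hk : is_derive x (1 : R) (fun s => k * s) k.
  have -> : (fun s : R => k * s) = k \*: id by apply/funext.
  by apply: is_derive_eq; rewrite /GRing.scale /= mulr1.
by apply: is_derive_eq (is_derive1_comp _ _) _; rewrite mulrC mulrN mulNr.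
Qed.

Lemma Re_expi_le c n x : `|complex.Re (c * expi x ^+ n)| <= cnorm c.
Proof. by apply: le_trans (cnorm_Re _) _; rewrite cnormM cnormX cnorm_expi expr1n mulr1. Qed.

Lemma continuous_Re_expi c n : continuous (fun x => complex.Re (c * expi x ^+ n)).
Proof.
have [] // : cpath (fun x => c * expi x ^+ n).
by apply: cpathM; [exact: cpath_cst|apply: cpathX; exact: cpath_expi].
Qed.

Lemma bm_Re_expi c n :
  @bounded_measurable _ (measurableTypeR R) R (fun x => complex.Re (c * expi x ^+ n)).
Proof.
exact: (@bm_continuous (fun x => complex.Re (c * expi x ^+ n)) (cnorm c)
  (@continuous_Re_expi c n) (Re_expi_le c n)).
Qed.

Lemma mean_expi c n : mean (fun x => complex.Re (c * expi x ^+ n.+1)) = 0.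
Proof.
pose k : R := n.+1%:R; have k0 : k != 0 by rewrite pnatr_eq0.
pose F x := complex.Re c / k * sin (k * x) + complex.Im c / k * cos (k * x).
apply: (@mean_FTC _ F (cnorm c)).
- exact: continuous_Re_expi.
- exact: Re_expi_le.
- move=> x; have h1 := is_deriveZ (complex.Re c / k) (is_derive_sinM k x).
  have h2 := is_deriveZ (complex.Im c / k) (is_derive_cosM k x).
  apply: is_derive_eq (is_deriveD h1 h2) _; rewrite expiX -/k /GRing.scale /=.
  have alg (K p q C D : R) : K != 0 -> p / K * (K * C) + q / K * (- K * D) = p * C - q * D.
    by move=> K0; field.
  by rewrite alg//; case: (c).
rewrite /F !mulr0 sin0 cos0; have := expiX (2 * pi : R) n.+1.
rewrite expi_2pi expr1n -/k => /eqP; rewrite eq_sym eq_complex => /andP[/eqP /= -> /eqP /= ->] //.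
Qed.

Lemma bm_ln_cnorm h (m M : R) : cpath h -> 0 < m -> (forall x, m <= cnorm (h x) <= M) ->
  @bounded_measurable _ (measurableTypeR R) R (fun x => ln (cnorm (h x))).
Proof.
move=> hc m0 hm; split.
  by apply: measurableT_comp (@measurable_ln R) _; apply: continuous_measurable_fun;
    exact: continuous_cnorm_path.
exists (`|ln m| + `|ln M|) => x; have /andP[h1 h2] := hm x.
have l1 : ln m <= ln (cnorm (h x)) by rewrite ler_ln ?posrE//; exact: lt_le_trans h1.
have l2 : ln (cnorm (h x)) <= ln M.
  by rewrite ler_ln ?posrE//; [exact: lt_le_trans h1|apply: lt_le_trans h2; exact: lt_le_trans h1].
have := ler_norm (ln M); have := ler_norm (- ln m); rewrite normrN.
move: l1 l2 (normr_ge0 (ln m)) (normr_ge0 (ln M)).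
move: (ln m) (ln _) (ln M) `|ln m| `|ln M| => p q s p' s' *.
by rewrite ler_norml; apply/andP; split; lra.
Qed.

(** Every term of the logarithmic series has mean 0, so the mean is bounded by the tail for each
    truncation. *)
Lemma mean_ln_one_sub a : cnorm a < 1 -> mean (fun x => ln (cnorm (1 - a * expi x))) = 0.
Proof.
move=> a1; have a0 := cnorm_ge0 a; have n1 x : cnorm (a * expi x) = cnorm a.
  by rewrite cnormM cnorm_expi mulr1.
have bl : @bounded_measurable _ (measurableTypeR R) R (fun x => ln (cnorm (1 - a * expi x))).
  apply: (@bm_ln_cnorm _ (1 - cnorm a) (1 + cnorm a)); last 1 first.
  - move=> x; have := lerB_cnorm 1 (a * expi x); have := ler_cnormB 1 (a * expi x).
    by rewrite n1 cnorm1 => -> ->.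
  - apply: cpathD; first exact: cpath_cst.
    under eq_fun do rewrite -mulNr.
    by apply: cpathM; [exact: cpath_cst|exact: cpath_expi].
  - by rewrite subr_gt0.
have bp (m : nat) : @bounded_measurable _ (measurableTypeR R) R
    (fun x => m.+1%:R^-1 * complex.Re ((a * expi x) ^+ m.+1)).
  under eq_fun do rewrite exprMn.
  apply: bmM; first exact: bm_cst.
  exact: bm_Re_expi.
have key (M : nat) : `|mean (fun x => ln (cnorm (1 - a * expi x)))| <= cnorm a ^+ M.+1 / (1 - cnorm a).
  have -> : mean (fun x => ln (cnorm (1 - a * expi x))) = mean (fun x =>
      ln (cnorm (1 - a * expi x)) + \sum_(m < M) m.+1%:R^-1 * complex.Re ((a * expi x) ^+ m.+1)).
    rewrite meanD//; last by apply: bm_sum => i; exact: bp.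
    rewrite mean_sum; last by move=> i; exact: bp.
    rewrite big1 ?addr0// => m _; rewrite meanZ; last first.
      under eq_fun do rewrite exprMn.
      exact: bm_Re_expi.
    by under eq_Rintegral do rewrite exprMn; rewrite mean_expi mulr0.
  have bg : @bounded_measurable _ (measurableTypeR R) R (fun x =>
      ln (cnorm (1 - a * expi x)) + \sum_(m < M) m.+1%:R^-1 * complex.Re ((a * expi x) ^+ m.+1)).
    by apply: bmD => //; apply: bm_sum => i; exact: bp.
  have gb x : `|ln (cnorm (1 - a * expi x)) + \sum_(m < M) m.+1%:R^-1 *
      complex.Re ((a * expi x) ^+ m.+1)| <= cnorm a ^+ M.+1 / (1 - cnorm a).
    by rewrite -(n1 x); apply: ln_cnorm_series; rewrite n1.
  rewrite ler_norml; apply/andP; split.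
    rewrite -[X in X <= _](@mean_cst _ _ _ uniform_angle); apply: mean_le => //; first exact: bm_cst.
    by move=> x; have := gb x; rewrite ler_norml => /andP[].
  rewrite -[X in _ <= X](@mean_cst _ _ _ uniform_angle); apply: mean_le => //; first exact: bm_cst.
  by move=> x; have := gb x; rewrite ler_norml => /andP[].
apply/eqP; rewrite -normr_le0 leNgt; apply/negP => pos.
have e0 : 0 < `|mean (fun x => ln (cnorm (1 - a * expi x)))| * (1 - cnorm a) / 2.
  by rewrite divr_gt0// mulr_gt0// subr_gt0.
have [|N hN] := @expr_small R (cnorm a) _ _ e0; first by rewrite a0.
have := key N; rewrite ler_pdivlMr ?subr_gt0// => h1.
have := hN N.+1 (leqnSn N); move: e0; move: (`|_| * _) h1 => X; lra.
Qed.

(* Jensen's formula for a linear polynomial. *)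
Lemma mean_ln_sub t : cnorm t != 1 ->
  @bounded_measurable _ (measurableTypeR R) R (fun x => ln (cnorm (expi x - t))) /\
  mean (fun x => ln (cnorm (expi x - t))) = ln (Num.max 1 (cnorm t)).
Proof.
move=> t1; have t0 := cnorm_ge0 t; split.
  apply: (@bm_ln_cnorm _ `|1 - cnorm t| (1 + cnorm t)).
  - by apply: cpathD; [exact: cpath_expi|exact: cpath_cst].
  - by rewrite normr_gt0 subr_eq0 eq_sym.
  - move=> x; have := ler_cnormB (expi x) t; rewrite cnorm_expi => ->; rewrite andbT.
    by have := ler_cnorm_dist (expi x) t; rewrite cnorm_expi.
have [h|h|h] := ltgtP (cnorm t) 1; last by rewrite h eqxx in t1.
- transitivity (mean (fun x => ln (cnorm (1 - conjc t * expi x)))); last first.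
    by rewrite ln1 mean_ln_one_sub// cnormJ.
  apply: eq_Rintegral => x _.
  congr ln; rewrite -cnormJ; have -> : conjc (expi x - t) = conjc (expi x) * (1 - conjc t * expi x).
    have ee : conjc (expi x) * expi x = 1 by rewrite mulrC mulcJ cnorm_expi expr1n rc1.
    by rewrite [conjc (_ - _)]rmorphB mulrBr mulr1 mulrCA ee mulr1.
  by rewrite cnormM cnormJ cnorm_expi mul1r.
- have tn0 : t != 0 by apply: contraTneq h => ->; rewrite cnorm0 ltNge ler01.
  have ti1 : cnorm t^-1 < 1 by rewrite cnormV invf_lt1//; exact: lt_trans h.
  have -> : (fun x => ln (cnorm (expi x - t))) = (fun x => ln (cnorm t) + ln (cnorm (1 - t^-1 * expi x))).
    apply/funext => x; have -> : expi x - t = - t * (1 - t^-1 * expi x) by field.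
    have p0 : 0 < cnorm (1 - t^-1 * expi x).
      have := lerB_cnorm 1 (t^-1 * expi x); rewrite cnorm1 cnormM cnorm_expi; lra.
    by rewrite cnormM cnormN lnM ?posrE// (lt_trans _ h).
  rewrite meanD ?mean_cst ?mean_ln_one_sub ?addr0//; first exact: bm_cst.
  apply: (@bm_ln_cnorm _ (1 - cnorm t^-1) (1 + cnorm t^-1)).
  - apply: cpathD; first exact: cpath_cst.
    under eq_fun do rewrite -mulNr.
    by apply: cpathM; [exact: cpath_cst|exact: cpath_expi].
  - by rewrite subr_gt0.
  - move=> x; have := lerB_cnorm 1 (t^-1 * expi x); have := ler_cnormB 1 (t^-1 * expi x).
    by rewrite cnormM cnorm_expi mulr1 cnorm1 => -> ->.
Qed.

End CircleMean.

(** * Parametrization of the arc and its potential *)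

Section ArcMap.
Variables (R : realType) (alpha : R).
Hypothesis halpha : 0 < alpha < pi.
Implicit Types (t w : R[i]).

Definition half_chord : R := sin (alpha / 2).
Local Notation S := half_chord.
Local Notation Sc := (real_complex R half_chord).

Lemma half_chord_gt0 : 0 < S.
Proof. by apply: sin_gt0_pi; move: halpha => /andP[h1 h2]; apply/andP; split; lra. Qed.

Lemma cos_half_chord : cos alpha = 1 - 2 * S ^+ 2.
Proof.
have -> : alpha = alpha / 2 + alpha / 2 by field.
by rewrite cosD -/S; have := cos2Dsin2 (alpha / 2); rewrite -/S; lra.
Qed.

Lemma half_chord_lt1 : S < 1.
Proof.
have := Re_sinf halpha; rewrite /sinf /expi /= => c0.
by have := cos2Dsin2 (alpha / 2); rewrite -/S; have := half_chord_gt0; nra.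
Qed.

Let S0 : 0 < S. Proof. exact: half_chord_gt0. Qed.
Let S1 : S < 1. Proof. exact: half_chord_lt1. Qed.

(* Maps the unit circle onto the arc, the uniform measure to the equilibrium measure. *)
Definition arc_map t : R[i] := (t + Sc) / (t * (1 + Sc * t)).

Lemma arc_one_add_neq0 t : cnorm t = 1 -> 1 + Sc * t != 0.
Proof.
move=> t1; have := lerB_cnorm 1 (- (Sc * t)).
rewrite opprK cnormN cnormM t1 cnorm1 cnorm_real gtr0_norm// mulr1 => h.
by rewrite -cnorm_gt0; apply: lt_le_trans h; rewrite subr_gt0.
Qed.

Lemma arc_den t : cnorm t = 1 -> t * (1 + Sc * t) != 0.
Proof. by move=> t1; rewrite mulf_neq0 ?arc_one_add_neq0// -cnorm_gt0 t1. Qed.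

(** The image thus has argument [- 2 arg (1 + S t)], and [|arg (1 + S t)|] is at most
    [arcsin S = alpha / 2], which is why it lies on the arc. *)
Lemma arc_mapE t : cnorm t = 1 ->
  arc_map t = conjc (1 + Sc * t) ^+ 2 / real_complex R (cnorm (1 + Sc * t) ^+ 2).
Proof.
move=> t1; have d0 := arc_one_add_neq0 t1; have t0 : t != 0 by rewrite -cnorm_gt0 t1.
have tt : t * conjc t = 1 by rewrite mulcJ t1 expr1n rc1.
have E : t + Sc = t * conjc (1 + Sc * t).
  have c1 : conjc (1 : R[i]) = 1 by rewrite -rc1 conjcR.
  rewrite conjcD conjcM conjcR c1.
  by rewrite mulrDr mulr1 mulrCA tt mulr1.
rewrite /arc_map E -mulcJ; have c0 : conjc (1 + Sc * t) != 0.
  by apply: contraNneq d0 => h; rewrite -[1 + _]conjcK h; apply/eqP; exact: rmorph0.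
by move: (conjc (1 + Sc * t)) c0 => c c0; field; rewrite d0 t0 c0.
Qed.

Lemma arc_map_Gamma t : cnorm t = 1 -> Gamma alpha (arc_map t).
Proof.
move=> t1; have d0 := arc_one_add_neq0 t1; rewrite arc_mapE//.
have n0 : 0 < cnorm (1 + Sc * t) by rewrite cnorm_gt0.
apply/GammaP => //; split.
  rewrite cnormM cnormV cnorm_real cnormX cnormJ ger0_norm ?sqr_ge0// mulfV//.
  by rewrite expf_neq0// gt_eqF.
have a2 := congr1 (fun x => x ^+ 2) t1; rewrite cnorm_sqr expr1n in a2.
rewrite cos_half_chord -rcV [X in complex.Re X]mulrC.
have ReZ (x : R) (z : R[i]) : complex.Re (real_complex R x * z) = x * complex.Re z.
  by case: z => p q /=; rewrite mul0r subr0.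
rewrite ReZ [X in _ <= X]mulrC ler_pdivlMr ?exprn_gt0// cnorm_sqr.
move: a2; case: (t) => a b /= a2.
rewrite !(mul0r, mulr0, add0r, addr0, subr0) expr2 /=.
have : 0 <= S ^+ 2 * (a + S) ^+ 2 by rewrite mulr_ge0 ?sqr_ge0.
nra.
Qed.

(** For [x = y ^+ 2] and [t = tau * conjc y] the equation becomes
    [S tau ^ 2 + (y - conjc y) tau - S = 0], whose roots have modulus 1 when [|Im y| <= S]. *)
Lemma arc_map_surj (x : R[i]) : Gamma alpha x -> exists2 t, cnorm t = 1 & arc_map t = x.
Proof.
move=> /(GammaP halpha)[x1 xc]; pose y := sqrtc x.
have yx : y ^+ 2 = x by exact: sqr_sqrtc.
have y1 : cnorm y = 1.
  have : cnorm y ^+ 2 == 1 by rewrite -cnormX yx x1.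
  by rewrite sqrp_eq1 ?cnorm_ge0// => /eqP.
have yy : y * conjc y = 1 by rewrite mulcJ y1 expr1n rc1.
pose s := complex.Im y.
have sS : s ^+ 2 <= S ^+ 2.
  have := cnorm_sqr y; rewrite y1 expr1n; move: xc; rewrite -yx cos_half_chord /s.
  by case: (y) => a b /=; rewrite !expr2 /=; lra.
pose c := Num.sqrt (S ^+ 2 - s ^+ 2).
have c2 : c ^+ 2 = S ^+ 2 - s ^+ 2 by rewrite sqr_sqrtr// subr_ge0.
pose tau : R[i] := Complex (c / S) (- s / S).
have S00 : S != 0 by rewrite gt_eqF.
have tau1 : cnorm tau = 1.
  have : cnorm tau ^+ 2 == 1.
    rewrite cnorm_sqr /tau /= !exprMn c2 sqrrN exprVn -mulrDl subrK mulfV//.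
    by rewrite expf_neq0.
  by rewrite sqrp_eq1 ?cnorm_ge0// => /eqP.
have tauE : Sc * tau ^+ 2 + (y - conjc y) * tau - Sc = 0.
  have -> : y - conjc y = Complex 0 (2 * s).
    by rewrite /s; case: (y) => a b; apply/eqP; rewrite eq_complex /=; apply/andP; split; apply/eqP; ring.
  rewrite expr2 /tau; apply/eqP; rewrite eq_complex /=.
  apply/andP; split; apply/eqP; last by field.
  have -> : c / S * (c / S) - - s / S * (- s / S) = (c ^+ 2 - s ^+ 2) / S ^+ 2 by field.
  by rewrite c2; field.
have t1 : cnorm (tau * conjc y) = 1 by rewrite cnormM tau1 cnormJ y1 mulr1.
exists (tau * conjc y) => //; have := arc_den t1; rewrite /arc_map => d0.
apply: (mulIf d0); rewrite mulfVK// -yx.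
have -> : y ^+ 2 * (tau * conjc y * (1 + Sc * (tau * conjc y))) =
   (y * conjc y) * (y * tau) + Sc * tau ^+ 2 * (y * conjc y) ^+ 2 by ring.
rewrite yy expr1n mulr1 mul1r.
by apply/eqP; rewrite -subr_eq0 -oppr_eq0 -[X in _ == X]tauE; apply/eqP; ring.
Qed.

Lemma arc_factor w : w != 0 -> exists t1 t2 : R[i], t1 * t2 = - w^-1 /\
  forall t, t != 0 -> 1 + Sc * t != 0 ->
    arc_map t - w = - (w * Sc) * ((t - t1) * (t - t2)) / (t * (1 + Sc * t)).
Proof.
move=> w0; have Sc0 : Sc != 0 by rewrite rc_eq0 gt_eqF.
pose b := (1 - w) / (w * Sc); pose d := sqrtc (b ^+ 2 + 4 / w).
have d2 : d ^+ 2 = b ^+ 2 + 4 / w by exact: sqr_sqrtc.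
have t12 : (b + d) / 2 * ((b - d) / 2) = - w^-1.
  have -> : (b + d) / 2 * ((b - d) / 2) = (b ^+ 2 - d ^+ 2) / 4 by field.
  by rewrite d2 opprD addrA subrr add0r; field.
exists ((b + d) / 2), ((b - d) / 2); split => // t t0 d0.
have -> : (t - (b + d) / 2) * (t - (b - d) / 2) =
    t ^+ 2 - b * t + (b + d) / 2 * ((b - d) / 2) by field.
rewrite t12 /b /arc_map; clear -w0 Sc0 t0 d0.
by field; rewrite w0 Sc0 t0 d0.
Qed.

Definition arc_path (x : R) := arc_map (expi x).

Lemma cpath_arc_path : cpath arc_path.
Proof.
apply: cpathM; first by apply: cpathD; [exact: cpath_expi|exact: cpath_cst].
apply: cpathV; first by move=> x; exact: arc_den (cnorm_expi x).
apply: cpathM; first exact: cpath_expi.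
apply: cpathD; first exact: cpath_cst.
by apply: cpathM; [exact: cpath_cst|exact: cpath_expi].
Qed.

Lemma arc_path_Gamma x : Gamma alpha (arc_path x).
Proof. by apply: arc_map_Gamma; exact: cnorm_expi. Qed.

Local Notation mean f := (\int[@uniform_angle R]_x f x).

(** Here [p] and [q] are the moduli of the two roots of [arc_map t = w], and
    [Y = r * (max 1 p * max 1 q)] measures how far the potential at [w] exceeds [ln S]. If both are
    at least 1, [Y] is 1; otherwise, with [x] the larger and [y] the smaller, [Y - 1 = (1 - y) Y]
    and [Y - 1 <= x - 1]. *)
Lemma max_defect (p q r eta : R) : 0 <= p -> 0 <= q -> 0 < r < 1 -> r * (p * q) = 1 ->
  `|1 - p| * `|1 - q| <= eta ->
  1 <= r * (Num.max 1 p * Num.max 1 q) /\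
  (r * (Num.max 1 p * Num.max 1 q) - 1) ^+ 2 <= eta * (r * (Num.max 1 p * Num.max 1 q)).
Proof.
move=> p0 q0 /andP[r0 r1] pq.
have half (x y : R) : 0 <= x -> 0 <= y -> r * (x * y) = 1 -> 1 <= x -> y < 1 ->
    (x - 1) * (1 - y) <= eta -> 1 <= r * x /\ (r * x - 1) ^+ 2 <= eta * (r * x).
  move=> x0 y0 xy x1 y1 he; have rx0 : 0 < r * x by rewrite mulr_gt0//; lra.
  have h1 : 1 <= r * x by rewrite -xy mulrA ler_piMr// ltW.
  have h2 : r * x - 1 = (1 - y) * (r * x).
    by rewrite mulrBl mul1r -{1}xy; ring.
  split => //; have -> : (r * x - 1) ^+ 2 = (r * x - 1) * (1 - y) * (r * x).
    by rewrite expr2 -mulrA -h2.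
  rewrite ler_pM2r//.
  apply: le_trans he; apply: ler_wpM2r; first lra.
  by rewrite lerB// ler_piMl// ltW.
have [p1|p1] := leP 1 p; have [q1|q1] := leP 1 q.
- rewrite pq subrr expr0n mulr1 => h; split => //.
  by apply: le_trans h; rewrite mulr_ge0.
- have a1 : 0 <= 1 - q by rewrite subr_ge0 ltW.
  have a2 : 0 <= p - 1 by rewrite subr_ge0.
  rewrite mulr1 distrC (ger0_norm a1) (ger0_norm a2) => h.
  exact: half q0 pq p1 q1 h.
- have a1 : 0 <= 1 - p by rewrite subr_ge0 ltW.
  have a2 : 0 <= q - 1 by rewrite subr_ge0.
  rewrite mul1r [X in _ * X]distrC (ger0_norm a1) (ger0_norm a2) => h.
  apply: (half q p) => //; first by rewrite [q * p]mulrC.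
  by rewrite mulrC.
- move=> _; exfalso; have : p * q <= 1 by rewrite mulr_ile1// ltW.
  move=> h; have : r * (p * q) <= r * 1 by rewrite ler_wpM2l// ltW.
  by rewrite pq; lra.
Qed.

(** The radius [r < 1] keeps the point off the arc, hence the roots of [arc_factor] off the unit
    circle, and Jensen's formula gives the mean of each logarithm; the denominator [1 + S t]
    contributes 0. *)
Lemma arc_potential (r : R) (x : R[i]) : 0 < r < 1 -> cnorm x = 1 ->
  @bounded_measurable _ (measurableTypeR R) R (fun y => ln (cnorm (arc_path y - real_complex R r * x))) /\
  exists p q : R, [/\ 0 <= p, 0 <= q, r * (p * q) = 1,
    mean (fun y => ln (cnorm (arc_path y - real_complex R r * x))) =
      ln S + ln (r * (Num.max 1 p * Num.max 1 q)) &
    Gamma alpha x -> `|1 - p| * `|1 - q| <= 2 * (1 - r) / (r * S)].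
Proof.
move=> /andP[r0 r1] x1; pose w := real_complex R r * x.
have wr : cnorm w = r by rewrite cnormM cnorm_real x1 mulr1 gtr0_norm.
have w0 : w != 0 by rewrite -cnorm_gt0 wr.
have [t1 [t2 [t12 tE]]] := arc_factor w0.
have tE1 t : cnorm t = 1 ->
    arc_map t - w = - (w * Sc) * ((t - t1) * (t - t2)) / (t * (1 + Sc * t)).
  by move=> h; apply: tE; [rewrite -cnorm_gt0 h|exact: arc_one_add_neq0].
have tEn t : cnorm t = 1 -> cnorm (arc_map t - w) =
    r * S * (cnorm (t - t1) * cnorm (t - t2)) / cnorm (1 - - Sc * t).
  move=> h; rewrite tE1// cnormf !cnormM cnormN cnormM wr cnorm_real gtr0_norm// h mul1r.
  by rewrite mulNr opprK.
have off t : arc_map t = w -> cnorm t != 1.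
  move=> h; apply/eqP => ht; have := cnorm_Gamma halpha (arc_map_Gamma ht).
  by rewrite h wr; lra.
have n1 : cnorm t1 != 1.
  apply/eqP => h; have : arc_map t1 = w.
    by apply/eqP; rewrite -subr_eq0 tE1// subrr mul0r mulr0 mul0r.
  by move=> /off; rewrite h eqxx.
have n2 : cnorm t2 != 1.
  apply/eqP => h; have : arc_map t2 = w.
    by apply/eqP; rewrite -subr_eq0 tE1// subrr !mulr0 mul0r.
  by move=> /off; rewrite h eqxx.
have [b1 m1] := mean_ln_sub n1; have [b2 m2] := mean_ln_sub n2.
have S_lt1 : cnorm (- Sc) < 1 by rewrite cnormN cnorm_real gtr0_norm.
have m3 := mean_ln_one_sub S_lt1.
have b3 : @bounded_measurable _ (measurableTypeR R) R (fun x => ln (cnorm (1 - - Sc * expi x))).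
  apply: (@bm_ln_cnorm _ _ (1 - S) (1 + S)); last 1 first.
  - move=> y; have := lerB_cnorm 1 (- Sc * expi y); have := ler_cnormB 1 (- Sc * expi y).
    by rewrite cnormM cnormN cnorm_real cnorm_expi cnorm1 gtr0_norm// mulr1 => -> ->.
  - apply: cpathD; first exact: cpath_cst.
    under eq_fun do rewrite -mulNr.
    by apply: cpathM; [exact: cpath_cst|exact: cpath_expi].
  - by rewrite subr_gt0.
have fE : (fun y => ln (cnorm (arc_path y - w))) = (fun y => (ln (r * S) +
    (ln (cnorm (expi y - t1)) + ln (cnorm (expi y - t2)))) + -1 * ln (cnorm (1 - - Sc * expi y))).
  apply/funext => y; rewrite /arc_path tEn ?cnorm_expi//.
  have h1 : 0 < cnorm (expi y - t1).
    by rewrite cnorm_gt0 subr_eq0; apply: contraNneq n1 => <-; rewrite cnorm_expi.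
  have h2 : 0 < cnorm (expi y - t2).
    by rewrite cnorm_gt0 subr_eq0; apply: contraNneq n2 => <-; rewrite cnorm_expi.
  have h3 : 0 < cnorm (1 - - Sc * expi y).
    by rewrite cnorm_gt0 mulNr opprK arc_one_add_neq0// cnorm_expi.
  have rS : 0 < r * S by rewrite mulr_gt0.
  have h12 := mulr_gt0 h1 h2.
  by rewrite ln_div ?posrE ?mulr_gt0// lnM ?posrE// [ln (cnorm _ * _)]lnM ?posrE// mulN1r.
rewrite -/w fE; have b12 := bmD b1 b2.
have bc : @bounded_measurable _ (measurableTypeR R) R (fun=> ln (r * S)) by exact: bm_cst.
have b3' : @bounded_measurable _ (measurableTypeR R) R
    (fun y => -1 * ln (cnorm (1 - - Sc * expi y))) by apply: bmM => //; exact: bm_cst.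
have bs := bmD bc b12; split; first exact: bmD.
have mx (z : R) : 0 < Num.max 1 z by rewrite lt_max ltr01.
exists (cnorm t1), (cnorm t2); split; rewrite ?cnorm_ge0//.
- by rewrite -cnormM t12 cnormN cnormV wr mulfV// gt_eqF.
- rewrite meanD// meanD// meanD// meanZ// m3 mulr0 addr0 mean_cst m1 m2.
  rewrite !lnM ?posrE// ?mulr_gt0//; move: (ln _) (ln _) (ln _) (ln _) => *; ring.
(* If [x] is the image of [t], the distance [1 - r] from [x] to [r x] determines the product of the
   distances from [t] to the two roots. *)
- move=> /arc_map_surj[t ht tx].
  have : cnorm (arc_map t - w) = 1 - r.
    rewrite tx -[x in x - w]mul1r -mulrBl cnormM x1 mulr1 -rc1 -[real_complex R 1 - _]rmorphB.
    by rewrite cnorm_real ger0_norm// subr_ge0 ltW.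
  rewrite tEn// => E.
  have d1 : 0 < cnorm (1 - - Sc * t) by rewrite cnorm_gt0 mulNr opprK arc_one_add_neq0.
  have d2 : cnorm (1 - - Sc * t) <= 2.
    apply: le_trans (ler_cnormB _ _) _; rewrite cnormM cnormN cnorm_real ht cnorm1 gtr0_norm//.
    by have := S1; lra.
  have rS : 0 < r * S by rewrite mulr_gt0.
  rewrite ler_pdivlMr//.
  have -> : 2 * (1 - r) = 2 / cnorm (1 - - Sc * t) * ((cnorm (t - t1) * cnorm (t - t2)) * (r * S)).
    by rewrite -E; ring.
  have e1 : `|1 - cnorm t1| <= cnorm (t - t1) by have := ler_cnorm_dist t t1; rewrite ht.
  have e2 : `|1 - cnorm t2| <= cnorm (t - t2) by have := ler_cnorm_dist t t2; rewrite ht.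
  have h1 : `|1 - cnorm t1| * `|1 - cnorm t2| * (r * S) <= cnorm (t - t1) * cnorm (t - t2) * (r * S).
    by apply: ler_wpM2r; [exact: ltW|apply: ler_pM].
  apply: le_trans h1 _; rewrite ler_peMl//.
    by rewrite mulr_ge0 ?mulr_ge0 ?cnorm_ge0// ltW.
  by rewrite ler_pdivlMr// mul1r.
Qed.

Lemma arc_potential_ge (r : R) (x : R[i]) : 0 < r < 1 -> cnorm x = 1 -> Gamma alpha x ->
  ln S <= mean (fun y => ln (cnorm (arc_path y - real_complex R r * x))).
Proof.
move=> r01 x1 gx; have [_ [p [q [p0 q0 pq -> he]]]] := arc_potential r01 x1.
have [h1 _] := max_defect p0 q0 r01 pq (he gx).
by rewrite lerDl ln_ge0.
Qed.

Lemma arc_potential_le (eps : R) : 0 < eps -> exists2 r0 : R, r0 < 1 &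
  forall (r : R) (x : R[i]), 0 < r < 1 -> r0 < r -> Gamma alpha x ->
    mean (fun y => ln (cnorm (arc_path y - real_complex R r * x))) <= ln S + eps.
Proof.
move=> eps0; pose E := expR eps; have E1 : 1 < E by rewrite expR_gt1.
(* The function [(Y - 1) ^ 2 / Y] increases for [Y >= 1], so staying below its value at [E] forces
   [Y < E]. The radius chosen next solves [2 (1 - r) / (r S) = kappa]. *)
pose kappa := (E - 1) ^+ 2 / E.
have kappa0 : 0 < kappa by rewrite divr_gt0 ?exprn_gt0 ?subr_gt0 ?expR_gt0.
have d0 : 0 < 2 + kappa * S by rewrite addr_gt0// mulr_gt0.
exists (2 / (2 + kappa * S)); first by rewrite ltr_pdivrMr// mul1r ltrDl mulr_gt0.
move=> r x r01 rr gx; have x1 := cnorm_Gamma halpha gx.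
have [_ [p [q [p0 q0 pq -> he]]]] := arc_potential r01 x1.
have [h1 h2] := max_defect p0 q0 r01 pq (he gx).
move: (r * _) h1 h2 => Y h1 h2; have Y0 : 0 < Y by lra.
rewrite lerD2l -[leRHS]expRK ler_ln ?posrE ?expR_gt0// -/E leNgt; apply/negP => EY.
have /andP[r0 r1] := r01.
have eta_lt : 2 * (1 - r) / (r * S) < kappa.
  rewrite ltr_pdivrMr ?mulr_gt0//; move: rr; rewrite ltr_pdivrMr// => rr.
  by move: rr; rewrite mulrDr mulrCA; lra.
have h3 : (Y - 1) ^+ 2 < kappa * Y by apply: le_lt_trans h2 _; rewrite ltr_pM2r.
have : E * (Y - 1) ^+ 2 < (E - 1) ^+ 2 * Y.
  have E0 : 0 < E by lra.
  rewrite -(ltr_pM2l E0) in h3; apply: lt_le_trans h3 _.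
  by rewrite /kappa mulrA mulrCA mulfV ?mulr1 ?gt_eqF.
have : 0 < (Y - E) * (E * Y - 1).
  rewrite mulr_gt0 ?subr_gt0//; nra.
nra.
Qed.

End ArcMap.

(** * Lower bound for the energy of measures on the arc *)

Section Capacity.
Variables (R : realType) (alpha : R).
Hypothesis halpha : 0 < alpha < pi.
Implicit Types (a b z : R[i]) (x y : R * R).
Local Notation S := (half_chord alpha).
Local Notation Plane := (measurableTypeR R * measurableTypeR R)%type.

Let D : set (R * R) := @C_of R @^-1` Gamma alpha.

Local Notation mean f := (\int[@uniform_angle R]_x f x).

Definition harm (m : nat) (b : bool) z : R :=
  if b then complex.Im (z ^+ m.+1) else complex.Re (z ^+ m.+1).

(* A truncation of the positive definite kernel [- ln |1 - r a (conjc b)|]. *)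
Definition kern (r : R) (M : nat) a b : R :=
  \sum_(i : 'I_M * bool) (i.1.+1%:R^-1 * r ^+ i.1.+1) * (harm i.1 i.2 a * harm i.1 i.2 b).

Lemma kern_series r M a b : kern r M a b =
  \sum_(m < M) m.+1%:R^-1 * complex.Re ((real_complex R r * a * conjc b) ^+ m.+1).
Proof.
rewrite /kern -(pair_bigA _ (fun (m : 'I_M) (c : bool) =>
  (m.+1%:R^-1 * r ^+ m.+1) * (harm m c a * harm m c b))) /=.
apply: eq_bigr => m _; rewrite big_bool /= /harm -mulrDr -[LHS]mulrA; congr (_ * _).
rewrite !exprMn -conjcX -rcX; case: (a ^+ _) (b ^+ _) => p q [s t] /=; ring.
Qed.

Lemma kern_approx r M a b : 0 < r < 1 -> cnorm a = 1 -> cnorm b = 1 ->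
  `|ln (cnorm (b - real_complex R r * a)) + kern r M a b| <= r ^+ M.+1 / (1 - r).
Proof.
move=> /andP[r0 r1] a1 b1; rewrite kern_series.
have n1 : cnorm (real_complex R r * a * conjc b) = r.
  by rewrite !cnormM cnormJ a1 b1 !mulr1 cnorm_real gtr0_norm.
have -> : cnorm (b - real_complex R r * a) = cnorm (1 - real_complex R r * a * conjc b).
  rewrite -[LHS]mulr1 -b1 -(cnormJ b) -cnormM mulrBl.
  by rewrite mulcJ b1 expr1n rc1.
by rewrite -[in leRHS]n1; apply: ln_cnorm_series; rewrite n1.
Qed.

Lemma harm_le1 m c z : cnorm z = 1 -> `|harm m c z| <= 1.
Proof.
move=> z1; have E : 1 = cnorm (z ^+ m.+1) by rewrite cnormX z1 expr1n.
by rewrite E /harm; case: c; [exact: cnorm_Im|exact: cnorm_Re].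
Qed.

(** For unimodular [x] and [y], [|y - r x| ^ 2 = (1 - r) ^ 2 + r |x - y| ^ 2]. *)
Lemma log_kernel_ge r x y : 0 < r < 1 -> D x -> D y ->
  ((- ln (cnorm (C_of y - real_complex R r * C_of x)) + ln r / 2)%:E <= log_kernel x y)%E.
Proof.
move=> /andP[r0 r1] /(cnorm_Gamma halpha) x1 /(cnorm_Gamma halpha) y1.
rewrite /log_kernel; case: ifPn => [_|xy]; first exact: leey.
have d0 : 0 < cnorm (C_of x - C_of y).
  rewrite cnorm_gt0 subr_eq0; apply: contra xy; rewrite eq_complex /= => /andP[/eqP h1 /eqP h2].
  by case: (x) (y) h1 h2 => p q [s t] /= -> ->.
have r10 : 0 < cnorm (C_of y - real_complex R r * C_of x).
  have := lerB_cnorm (C_of y) (real_complex R r * C_of x).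
  by rewrite cnormM x1 y1 cnorm_real gtr0_norm// mulr1; lra.
have key : r * cnorm (C_of x - C_of y) ^+ 2 <= cnorm (C_of y - real_complex R r * C_of x) ^+ 2.
  have := congr1 (fun t => t ^+ 2) x1; have := congr1 (fun t => t ^+ 2) y1.
  rewrite !cnorm_sqr /= expr1n; case: (x) (y) => p q [s t] /=.
  rewrite !mul0r subr0 addr0 => h1 h2.
  have : 0 <= (1 - r) ^+ 2 by exact: sqr_ge0.
  nra.
have : ln (r * cnorm (C_of x - C_of y) ^+ 2) <= ln (cnorm (C_of y - real_complex R r * C_of x) ^+ 2).
  by rewrite ler_ln ?posrE ?mulr_gt0 ?exprn_gt0.
have ln2 (t : R) : 0 < t -> ln (t ^+ 2) = 2 * ln t by move=> t0; rewrite lnXn// mulr_natl.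
rewrite lnM ?posrE ?exprn_gt0// !ln2// lee_fin.
move: (ln r) (ln (cnorm _)) (ln (cnorm _)) => p s t; lra.
Qed.

Lemma measurable_cnorm_sub z : measurable_fun [set: Plane] (fun y => cnorm (C_of y - z)).
Proof.
have -> : (fun y : Plane => cnorm (C_of y - z)) = (fun y =>
    Num.sqrt ((y.1 - complex.Re z) ^+ 2 + (y.2 - complex.Im z) ^+ 2)).
  by apply/funext => y; rewrite /cnorm /C_of; case: z.
apply: measurableT_comp; first exact: continuous_measurable_fun (@sqrt_continuous R).
apply: measurable_funD; apply: measurable_funX; apply: measurable_funB;
  (exact: measurable_fst || exact: measurable_snd || exact: measurable_cst).
Qed.

Lemma measurable_arc : measurable (D : set Plane).
Proof.
have -> : (D : set Plane) = ((fun y : Plane => cnorm (C_of y - 0)) @^-1` [set 1]) `&`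
   (fst @^-1` `[cos alpha, +oo[).
  apply/seteqP; split => y /=; rewrite subr0 in_itv /= andbT.
    by move=> /(GammaP halpha).
  by move=> h; apply/(GammaP halpha).
apply: measurableI.
  by rewrite -[X in measurable X]setTI; apply: measurable_cnorm_sub => //; exact: measurable_set1.
by rewrite -[X in measurable X]setTI; apply: measurable_fst => //; exact: measurable_itv.
Qed.

Lemma measurable_harm m c : measurable_fun [set: Plane] (fun y => harm m c (C_of y)).
Proof.
rewrite /harm; elim: m c => [|m IH] c.
  under eq_fun do rewrite expr1.
  by case: c; [exact: measurable_snd|exact: measurable_fst].
have IHr := IH false; have IHi := IH true; rewrite /= in IHr IHi.
have m1 : measurable_fun [set: Plane] (fun y => y.1) by exact: measurable_fst.
have m2 : measurable_fun [set: Plane] (fun y => y.2) by exact: measurable_snd.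
case: c.
  have -> : (fun y : Plane => complex.Im (C_of y ^+ m.+2)) = (fun y =>
      y.1 * complex.Im (C_of y ^+ m.+1) + y.2 * complex.Re (C_of y ^+ m.+1)).
    by apply/funext => y; rewrite exprS; case: (C_of y ^+ _).
  by apply: measurable_funD; exact: measurable_funM.
have -> : (fun y : Plane => complex.Re (C_of y ^+ m.+2)) = (fun y =>
    y.1 * complex.Re (C_of y ^+ m.+1) - y.2 * complex.Im (C_of y ^+ m.+1)).
  by apply/funext => y; rewrite exprS; case: (C_of y ^+ _).
by apply: measurable_funB; exact: measurable_funM.
Qed.

(** Cut off to be bounded on the whole plane; for measures carried by the arc its moments are those
    of [harm]. *)
Definition arc_harm m c (y : Plane) : R := if y \in D then harm m c (C_of y) else 0.

Lemma bm_arc_harm m c : bounded_measurable (arc_harm m c).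
Proof.
split; last first.
  exists 1 => y; rewrite /arc_harm; case: ifPn => [|_]; last by rewrite normr0.
  by rewrite inE => /(cnorm_Gamma halpha); exact: harm_le1.
apply: measurable_fun_ifT.
- by apply: (measurable_fun_bool true); rewrite setTI preimage_mem_true; exact: measurable_arc.
- exact: measurable_harm.
- exact: measurable_cst.
Qed.

Lemma bm_harm_path m c :
  @bounded_measurable _ (measurableTypeR R) R (fun t => harm m c (arc_path alpha t)).
Proof.
have [h1 h2] := cpathX m.+1 (cpath_arc_path halpha).
apply: (@bm_continuous R (fun t => harm m c (arc_path alpha t)) 1).
  by rewrite /harm; case: c.
by move=> t; apply: harm_le1; apply: (cnorm_Gamma halpha); exact: arc_path_Gamma.
Qed.

(** Positive definiteness of the kernel: the difference of two measures with moments [c] and [d] has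
    nonnegative truncated energy. *)
Lemma weighted_square_ge (I : finType) (w c d : I -> R) : (forall i, 0 <= w i) ->
  2 * (\sum_i w i * (c i * d i)) - \sum_i w i * (d i * d i) <= \sum_i w i * (c i * c i).
Proof.
move=> w0; rewrite mulr_sumr -sumrB; apply: ler_sum => i _.
have := mulr_ge0 (w0 i) (sqr_ge0 (c i - d i)).
by move: (w i) (c i) (d i) => p q s; lra.
Qed.

Lemma exists_between_lt1 (a b : R) : a < 1 -> b < 1 -> exists r : R, [/\ r < 1, a < r & b < r].
Proof.
move=> a1 b1; have [ab|ab] := leP a b.
  by exists ((b + 1) / 2); split; lra.
by exists ((a + 1) / 2); split; lra.
Qed.

(** Let [c] and [d] be the moments of [nu] and of the image of the uniform measure. The potential
    [G] of the latter is nearly [- ln S] on the arc, so the mixed energy and the energy of [d] are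
    both nearly [- ln S], and positive definiteness bounds the energy of [c] from below. *)
Lemma energy_ge (nu : probability Plane R) : nu D = 1%E -> ((- ln S)%:E <= energy nu)%E.
Proof.
move=> nuD; apply/lee_subgt0Pr => eps0 eps00; rewrite -EFinB.
(* Twice the loss [2 eps] of the mixed energy, [eps] for the energy of [d], and [2 eps] for passing
   from [log_kernel] to its truncation. *)
have [eps e0 epsE] : exists2 eps : R, 0 < eps & eps0 = 7 * eps.
  by exists (eps0 / 7); [rewrite divr_gt0|field].
have [r0 r01 hr0] := arc_potential_le halpha e0.
have ex1 : expR (- 2 * eps) < 1 by rewrite -[X in _ < X]expR0 ltr_expR; lra.
have [r [r1 rr0 rr1]] := exists_between_lt1 r01 ex1.
have rp : 0 < r by apply: lt_trans rr1; exact: expR_gt0.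
have r01' : 0 < r < 1 by rewrite rp r1.
have lnr : - eps <= ln r / 2.
  have : - 2 * eps <= ln r by rewrite -[leLHS]expRK ler_ln ?posrE ?expR_gt0// ltW.
  lra.
have e1 : 0 < eps * (1 - r) by rewrite mulr_gt0// subr_gt0.
have [|N hN] := @expr_small R r _ _ e1; first by rewrite (ltW rp).
have tail : r ^+ N.+1 / (1 - r) <= eps by rewrite ler_pdivrMr ?subr_gt0//; exact: hN.
pose wt (i : 'I_N * bool) := i.1.+1%:R^-1 * r ^+ i.1.+1.
have wt0 i : 0 <= wt i by rewrite mulr_ge0 ?invr_ge0// exprn_ge0// ltW.
pose d (i : 'I_N * bool) := mean (fun t => harm i.1 i.2 (arc_path alpha t)).
pose G a := \sum_i wt i * (harm i.1 i.2 a * d i).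
have Gmean a : G a = mean (fun t => kern r N a (arc_path alpha t)).
  rewrite mean_sum; last by move=> i; do 2 apply: bmZ; exact: bm_harm_path.
  apply: eq_bigr => i _; rewrite meanZ; last by apply: bmZ; exact: bm_harm_path.
  by rewrite meanZ//; exact: bm_harm_path.
have bK a : @bounded_measurable _ (measurableTypeR R) R (fun t => kern r N a (arc_path alpha t)).
  by apply: bm_sum => i; do 2 apply: bmZ; exact: bm_harm_path.
have Gbounds a : Gamma alpha a -> - ln S - 2 * eps <= G a <= - ln S + eps.
  move=> ga; have a1 := cnorm_Gamma halpha ga.
  have [bp _] := arc_potential halpha r01' a1.
  have u1 := arc_potential_ge halpha r01' a1 ga; have u2 := hr0 r a r01' rr0 ga.
  have approx t : `|ln (cnorm (arc_path alpha t - real_complex R r * a)) +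
      kern r N a (arc_path alpha t)| <= eps.
    apply: le_trans tail; apply: kern_approx => //; apply: (cnorm_Gamma halpha).
    exact: arc_path_Gamma.
  have bsum := bmD bp (bK a).
  have : - eps <= mean (fun t => ln (cnorm (arc_path alpha t - real_complex R r * a)) +
      kern r N a (arc_path alpha t)).
    rewrite -[leLHS](@mean_cst _ _ _ (@uniform_angle R)); apply: mean_le => //; first exact: bm_cst.
    by move=> t; have := approx t; rewrite ler_norml => /andP[].
  have : mean (fun t => ln (cnorm (arc_path alpha t - real_complex R r * a)) +
      kern r N a (arc_path alpha t)) <= eps.
    rewrite -[leRHS](@mean_cst _ _ _ (@uniform_angle R)); apply: mean_le => //; first exact: bm_cst.
    by move=> t; have := approx t; rewrite ler_norml => /andP[].
  rewrite meanD// -Gmean; move: u1 u2; move: (G a) (Rintegral _ _ _) (ln S) => p q s u1 u2 u3 u4.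
  apply/andP; split; lra.
have Q : \sum_i wt i * (d i * d i) <= - ln S + eps.
  have -> : \sum_i wt i * (d i * d i) = mean (fun t => G (arc_path alpha t)).
    rewrite mean_sum; last by move=> i; apply: bmZ; apply: bmZr; exact: bm_harm_path.
    apply: eq_bigr => i _; rewrite meanZ; last by apply: bmZr; exact: bm_harm_path.
    under eq_Rintegral do rewrite mulrC.
    by rewrite meanZ//; exact: bm_harm_path.
  rewrite -[leRHS](@mean_cst _ _ _ (@uniform_angle R)); apply: mean_le.
  - by apply: bm_sum => i; apply: bmZ; apply: bmZr; exact: bm_harm_path.
  - exact: bm_cst.
  - by move=> t; have /andP[] := Gbounds _ (arc_path_Gamma halpha t).
pose c (i : 'I_N * bool) := \int[nu]_y arc_harm i.1 i.2 y.
have bA (i : 'I_N * bool) := bm_arc_harm i.1 i.2.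
have L1 : - ln S - 2 * eps <= \sum_i wt i * (c i * d i).
  have bG : bounded_measurable (fun y : Plane => \sum_i wt i * (arc_harm i.1 i.2 y * d i)).
    by apply: bm_sum => i; apply: bmZ; apply: bmZr; exact: bA.
  have -> : \sum_i wt i * (c i * d i) = \int[nu]_y (\sum_i wt i * (arc_harm i.1 i.2 y * d i)).
    rewrite mean_sum; last by move=> i; apply: bmZ; apply: bmZr; exact: bA.
    apply: eq_bigr => i _; rewrite meanZ; last by apply: bmZr; exact: bA.
    under eq_Rintegral do rewrite mulrC.
    by rewrite meanZ// [d i * _]mulrC.
  rewrite -lee_fin -mean_EFin// -[X in X%:E](@mean_cst _ _ _ nu).
  apply: (integral_ge_on measurable_arc nuD) => //; first exact: bm_cst.
  move=> y Dy; rewrite lee_fin; have /andP[] := Gbounds _ Dy.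
  by under eq_bigr do rewrite /arc_harm mem_set//.
have L2 := weighted_square_ge c d wt0.
pose H (x : Plane) := \sum_i wt i * (arc_harm i.1 i.2 x * c i).
have bH : bounded_measurable H.
  by apply: bm_sum => i; apply: bmZ; apply: bmZr; exact: bA.
have EH : \int[nu]_x (H x + - (2 * eps)) = \sum_i wt i * (c i * c i) - 2 * eps.
  rewrite meanD// ?mean_cst; last exact: bm_cst.
  congr (_ - _); rewrite mean_sum; last by move=> i; apply: bmZ; apply: bmZr; exact: bA.
  apply: eq_bigr => i _; rewrite meanZ; last by apply: bmZr; exact: bA.
  under eq_Rintegral do rewrite mulrC.
  by rewrite meanZ.
apply: (@le_trans _ _ (\int[nu]_x (H x + - (2 * eps)))%:E).
  rewrite EH lee_fin; move: L1 L2 Q; rewrite -/(wt _).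
  move: (\sum_i _) (\sum_i _) (\sum_i _) => p q s; rewrite epsE.
  by move: (ln S) => t; lra.
apply: (integral_ge_on measurable_arc nuD).
  by apply: bmD => //; exact: bm_cst.
move=> x Dx; have bKx : bounded_measurable (fun y : Plane =>
    (\sum_i wt i * (arc_harm i.1 i.2 x * arc_harm i.1 i.2 y)) + - (2 * eps)).
  apply: bmD; last exact: bm_cst.
  by apply: bm_sum => i; do 2 apply: bmZ; exact: bA.
have -> : H x + - (2 * eps) = \int[nu]_y ((\sum_i wt i * (arc_harm i.1 i.2 x *
    arc_harm i.1 i.2 y)) + - (2 * eps)).
  rewrite meanD ?mean_cst//; last 2 first.
  - by apply: bm_sum => i; do 2 apply: bmZ; exact: bA.
  - exact: bm_cst.
  congr (_ + _); rewrite mean_sum; last by move=> i; do 2 apply: bmZ; exact: bA.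
  apply: eq_bigr => i _; rewrite meanZ; last by apply: bmZ; exact: bA.
  by rewrite meanZ.
apply: (integral_ge_on measurable_arc nuD) => // y Dy.
apply: le_trans (log_kernel_ge r01' Dx Dy); rewrite lee_fin.
have x1 := cnorm_Gamma halpha Dx; have y1 := cnorm_Gamma halpha Dy.
have := le_trans (kern_approx N r01' x1 y1) tail; rewrite /kern.
under [X in X + - (2 * eps)]eq_bigr do rewrite /arc_harm !mem_set//.
rewrite -/(wt _) ler_norml => /andP[_]; move: lnr; move: (\sum_i _) (ln (cnorm _)) (ln r).
by move=> p q s; lra.
Qed.

End Capacity.

(** * The equilibrium measure and the value of the capacity *)

Section CapacityValue.
Variables (R : realType) (alpha : R).
Hypothesis halpha : 0 < alpha < pi.
Implicit Types (a b z : R[i]) (x y : R * R).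
Local Notation S := (half_chord alpha).
Local Notation Plane := (measurableTypeR R * measurableTypeR R)%type.

Let D : set (R * R) := @C_of R @^-1` Gamma alpha.

Local Notation mean f := (\int[@uniform_angle R]_x f x).

Definition arc_point (t : measurableTypeR R) : Plane :=
  (complex.Re (arc_path alpha t), complex.Im (arc_path alpha t)).

Lemma C_of_arc_point t : C_of (arc_point t) = arc_path alpha t.
Proof. exact: C_of_surj. Qed.

Lemma C_of_inj : injective (@C_of R).
Proof. by move=> [? ?] [? ?] [-> ->]. Qed.

Lemma measurable_arc_point : measurable_fun [set: measurableTypeR R] arc_point.
Proof.
have [h1 h2] := cpath_arc_path halpha.
by apply: measurable_fun_pair; exact: continuous_measurable_fun.
Qed.

Lemma measurable_log_kernel x : measurable_fun [set: Plane] (log_kernel x).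
Proof.
apply: measurable_fun_ifT.
- apply: (measurable_fun_bool true); rewrite setTI.
  have -> : (fun y => x == y) @^-1` [set true] = (fun y : Plane => cnorm (C_of y - C_of x)) @^-1` [set 0].
    apply/seteqP; split => y /=; first by move=> /eqP ->; rewrite subrr cnorm0.
    by move=> /eqP; rewrite cnorm_eq0 subr_eq0 => /eqP /C_of_inj ->; rewrite eqxx.
  by rewrite -[X in measurable X]setTI; apply: measurable_cnorm_sub => //; exact: measurable_set1.
- exact: measurable_cst.
- apply/measurable_EFinP; apply: measurable_funN.
  apply: measurableT_comp; first exact: measurable_ln.
  under eq_fun do rewrite -cnormN opprB.
  exact: measurable_cnorm_sub.
Qed.

(** Distances on the arc are at most 2, so there the maximum changes nothing; truncation and shift
    make the kernel nonnegative, as Fatou's lemma and the image measure formula need. *)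
Let pos_kernel x y : \bar R := (maxe (log_kernel x y) (- ln 2)%:E + (ln 2)%:E)%E.

Let pos_kernel_ge0 x y : (0 <= pos_kernel x y)%E.
Proof.
by rewrite /pos_kernel -leeBlDr// sub0e -EFinN le_max lexx orbT.
Qed.

Let measurable_pos_kernel x : measurable_fun [set: Plane] (pos_kernel x).
Proof.
apply: emeasurable_funD; last exact: measurable_cst.
by apply: measurable_maxe; [exact: measurable_log_kernel|exact: measurable_cst].
Qed.

Let rn (n : nat) : R := 1 - expR (- 1) ^+ n.+1.

Let rn01 n : 0 < rn n < 1.
Proof.
have e0 := expR_gt0 (- 1 : R); have e1 : expR (- 1 : R) < 1.
  by rewrite -[X in _ < X]expR0 ltr_expR; lra.
by rewrite /rn subr_gt0 exprn_ilt1// ?(ltW e0)//= ltrBlDr ltrDl exprn_gt0.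
Qed.

Let near_kernel n x t : R := - ln (cnorm (arc_path alpha t - real_complex R (rn n) * C_of x)) + ln 2.

Let bm_near_kernel n x : D x ->
  @bounded_measurable _ (measurableTypeR R) R (near_kernel n x).
Proof.
move=> Dx; have x1 := cnorm_Gamma halpha Dx.
have [b _] := arc_potential halpha (rn01 n) x1.
apply: bmD; last exact: bm_cst.
by under eq_fun do rewrite -mulN1r; exact: bmZ.
Qed.

Let mean_near_kernel n x : D x -> mean (near_kernel n x) <= - ln S + ln 2.
Proof.
move=> Dx; have x1 := cnorm_Gamma halpha Dx.
have [b _] := arc_potential halpha (rn01 n) x1.
rewrite meanD; last 2 first.
- by under eq_fun do rewrite -mulN1r; exact: bmZ.
- exact: bm_cst.
rewrite mean_cst lerD2r; under eq_Rintegral do rewrite -mulN1r.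
by rewrite meanZ// mulN1r lerN2; exact: arc_potential_ge.
Qed.

Let near_kernel_cvg x t : D x ->
  (near_kernel n x t)%:E @[n --> \oo] --> pos_kernel x (arc_point t).
Proof.
move=> Dx; have x1 := cnorm_Gamma halpha Dx.
have t1 := cnorm_Gamma halpha (arc_path_Gamma halpha t).
have e0 := expR_gt0 (- 1 : R); have e1 : expR (- 1 : R) < 1.
  by rewrite -[X in _ < X]expR0 ltr_expR; lra.
have e01 : 0 <= expR (- 1 : R) < 1 by rewrite ltW.
have dE n : arc_path alpha t - real_complex R (rn n) * C_of x =
    (arc_path alpha t - C_of x) + real_complex R (expR (- 1) ^+ n.+1) * C_of x.
  by rewrite /rn rmorphB rmorph1 mulrBl mul1r opprB addrA addrAC.
rewrite /pos_kernel /log_kernel; case: ifPn => [/eqP xt|xt].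
- rewrite maxye addye//; apply/cvgeyPge => A.
  have ct : arc_path alpha t = C_of x by rewrite xt C_of_arc_point.
  have [N hN] := expr_small e01 (expR_gt0 (- (A - ln 2))).
  exists N => // n /= Nn; rewrite lee_fin /near_kernel dE ct subrr add0r cnormM x1 mulr1.
  rewrite cnorm_real gtr0_norm ?exprn_gt0// -lerBlDr lerNr.
  rewrite -[leRHS]expRK ler_ln ?posrE ?exprn_gt0 ?expR_gt0//.
  by apply: hN; exact: leq_trans Nn (leqnSn n).
- set d := cnorm (C_of x - C_of (arc_point t)).
  have dd : cnorm (arc_path alpha t - C_of x) = d by rewrite /d C_of_arc_point -cnormN opprB.
  have d0 : 0 < d.
    by rewrite /d cnorm_gt0 subr_eq0; apply: contra xt => /eqP /C_of_inj ->.
  have d2 : d <= 2.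
    apply: le_trans (ler_cnormB _ _) _; rewrite C_of_arc_point x1 t1; lra.
  have -> : maxe (- ln d)%:E (- ln 2)%:E = (- ln d)%:E.
    by rewrite max_l// lee_fin lerN2 ler_ln ?posrE.
  rewrite -EFinD; apply: cvg_EFin; first exact: nearW.
  apply: cvgD; last exact: cvg_cst.
  apply: cvgN; apply: (@cvg_comp _ _ _ (fun n => cnorm (arc_path alpha t -
    real_complex R (rn n) * C_of x)) (@ln R) _ (nbhs d)); last exact: continuous_ln.
  apply/cvgrPdist_le => eps eps0; have [N hN] := expr_small e01 eps0.
  exists N => // n /= Nn; rewrite dE -dd -normrN opprB.
  have h : cnorm (real_complex R (expR (- 1) ^+ n.+1) * C_of x) <= eps.
    rewrite cnormM x1 mulr1 cnorm_real gtr0_norm ?exprn_gt0//.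
    by apply: hN; exact: leq_trans Nn (leqnSn n).
  apply: le_trans h; move: (real_complex R _ * _) => v.
  move: (arc_path alpha t - C_of x) => a; have := ler_cnorm_dist (a + v) a.
  by rewrite addrAC subrr add0r.
Qed.

(** At the points [r x] with [r < 1] the bound is [arc_potential_ge], uniform in [r]; Fatou's lemma
    carries it to [x] itself, where the logarithm is singular. *)
Lemma arc_kernel_mean x : D x ->
  (\int[@uniform_angle R]_t pos_kernel x (arc_point t) <= (- ln S + ln 2)%:E)%E.
Proof.
move=> Dx; have x1 := cnorm_Gamma halpha Dx.
have f0 n t : [set: measurableTypeR R] t -> (0 <= (near_kernel n x t)%:E)%E.
  move=> _; rewrite lee_fin /near_kernel addrC subr_ge0.
  have t1 := cnorm_Gamma halpha (arc_path_Gamma halpha t).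
  have /andP[r0 r1] := rn01 n.
  have c1 : cnorm (real_complex R (rn n) * C_of x) = rn n.
    by rewrite cnormM x1 mulr1 cnorm_real gtr0_norm.
  have l1 := lerB_cnorm (arc_path alpha t) (real_complex R (rn n) * C_of x).
  have l2 := ler_cnormB (arc_path alpha t) (real_complex R (rn n) * C_of x).
  rewrite c1 t1 in l1 l2; move: l1 l2 r1; move: (rn n) (cnorm _) => p q l1 l2 r1.
  by rewrite ler_ln ?posrE//; lra.
have mf n : measurable_fun [set: measurableTypeR R] (fun t => (near_kernel n x t)%:E).
  by apply/measurable_EFinP; have [] := bm_near_kernel n Dx.
have := @fatou _ _ _ (@uniform_angle R) setT measurableT (fun n t => (near_kernel n x t)%:E) mf f0.
have -> : (\int[@uniform_angle R]_t pos_kernel x (arc_point t) =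
    \int[@uniform_angle R]_t limn_einf (fun n => (near_kernel n x t)%:E))%E.
  apply: eq_integral => t _.
  by have [-> _] := cvg_limn_einf_sup (near_kernel_cvg (t := t) Dx).
move=> h; apply: le_trans h _; rewrite limn_einf_lim; apply: lime_le; first exact: is_cvg_einfs.
apply: nearW => n; apply: (@le_trans _ _ (\int[@uniform_angle R]_t (near_kernel n x t)%:E)%E).
  by apply: ereal_inf_lbound; exists n => /=.
by rewrite mean_EFin ?lee_fin; [exact: mean_near_kernel|exact: bm_near_kernel].
Qed.

Lemma arc_equilibrium : exists mu : probability Plane R,
  mu D = 1%E /\ (energy mu <= (- ln S)%:E)%E.
Proof.
pose g : {mfun measurableTypeR R >-> Plane} :=
  HB.pack arc_point (isMeasurableFun.Build _ _ _ _ _ measurable_arc_point).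
exists (distribution (@uniform_angle R) g : probability Plane R).
have muD : distribution (@uniform_angle R) g D = 1%E.
  rewrite /distribution /pushforward.
  have -> : g @^-1` D = setT.
    by apply/seteqP; split => // t _ /=; rewrite /D /= C_of_arc_point; exact: arc_path_Gamma.
  exact: probability_setT.
split => //; apply: (integral_le_on (measurable_arc halpha) muD) => x Dx.
have pushE : (\int[distribution (@uniform_angle R) g]_y pos_kernel x y =
   \int[@uniform_angle R]_t pos_kernel x (arc_point t))%E.
  by rewrite ge0_integral_pushforward.
have le1 : (\int[distribution (@uniform_angle R) g]_y pos_kernel x y <= (- ln S + ln 2)%:E)%E.
  by rewrite pushE; exact: arc_kernel_mean.
have ip : (distribution (@uniform_angle R) g).-integrable setT (pos_kernel x).
  apply/integrableP; split; first exact: measurable_pos_kernel.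
  under eq_integral do rewrite gee0_abs//.
  by apply: le_lt_trans le1 _; exact: ltry.
apply: (@le_trans _ _ (\int[distribution (@uniform_angle R) g]_y
    (pos_kernel x y + (- ln 2)%:E))%E).
  apply: integral_monotone => y; rewrite /pos_kernel -addeA -EFinD subrr adde0.
  by rewrite le_max lexx.
rewrite integralD//; last by apply: bm_integrable; exact: bm_cst.
have c1 : (\int[distribution (@uniform_angle R) g]_y (- ln 2)%:E <= (- ln 2)%:E)%E.
  by rewrite mean_EFin ?mean_cst//; exact: bm_cst.
apply: le_trans (leeD le1 c1) _.
by rewrite -EFinD addrK.
Qed.

Lemma cap_arc : cap (Gamma alpha) = S.
Proof.
have S0 := half_chord_gt0 halpha.
rewrite /cap; set I := ereal_inf _.
have -> : I = (- ln S)%:E.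
  apply/eqP; rewrite eq_le; apply/andP; split.
    have [mu [muD muE]] := arc_equilibrium.
    by apply: ge_ereal_inf; exists (energy mu) => //; exists mu.
  by apply: le_ereal_inf_tmp => _ [nu nuD <-]; exact: energy_ge.
by rewrite -EFinN opprK /= lnK.
Qed.

End CapacityValue.

(** * Proof of the theorem *)

Section Kernel.
Variables (R : realType) (alpha : R).
Implicit Types (M s z : R[i]).

Lemma Arg_polar M : M != 0 -> real_complex R (cnorm M) * expi (Arg M) = M.
Proof.
move=> M0; have n0 : 0 < cnorm M by rewrite cnorm_gt0.
have n2 := cnorm_sqr M.
have x1 : -1 <= complex.Re M / cnorm M <= 1.
  rewrite ler_pdivlMr// ler_pdivrMr// mulN1r mul1r -ler_norml; exact: cnorm_Re.
have s1 : Num.sqrt (1 - (complex.Re M / cnorm M) ^+ 2) = `|complex.Im M| / cnorm M.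
  have -> : 1 - (complex.Re M / cnorm M) ^+ 2 = (complex.Im M / cnorm M) ^+ 2.
    rewrite !expr_div_n; have -> : complex.Im M ^+ 2 = cnorm M ^+ 2 - complex.Re M ^+ 2.
      by rewrite n2 addrAC subrr add0r.
    by rewrite mulrBl mulfV// expf_neq0// gt_eqF.
  by rewrite sqrtr_sqr normrM normfV (ger0_norm (ltW n0)).
have cA : cos (Arg M) = complex.Re M / cnorm M.
  by rewrite /Arg; case: ifP => _; rewrite ?cosN acosK.
have sA : sin (Arg M) = complex.Im M / cnorm M.
  rewrite /Arg; case: ifPn => h; first by rewrite sin_acos// s1 ger0_norm.
  by rewrite sinN sin_acos// s1 ltr0_norm ?ltNge// mulNr opprK.
rewrite /expi cA sA; move: (cnorm M) n0 => n n0; have nn : n != 0 by rewrite gt_eqF.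
by case: (M) => p q /=; apply/eqP; rewrite eq_complex /=; apply/andP; split; apply/eqP; field.
Qed.

(** Both sides are square roots of [M] with positive real part: [M] is not on the negative ray, so
    the left side has argument [Arg M / 2] strictly between [- pi / 2] and [pi / 2]. *)
Lemma powC_quarter_sqr M s : s ^+ 2 = M -> 0 < complex.Re s -> powC M 4^-1 ^+ 2 = s.
Proof.
move=> sM s0; have sn0 : s != 0 by apply: contraTneq s0 => ->; rewrite ltxx.
have M0 : M != 0 by rewrite -sM expf_neq0.
have n0 : 0 < cnorm M by rewrite cnorm_gt0.
set l := powC M 4^-1 ^+ 2.
have l2 : l ^+ 2 = M.
  rewrite /l -exprM /powC exprMn -rcX expiX -[RHS](Arg_polar M0); congr (real_complex R _ * expi _).
    by rewrite -powR_mulrn ?powR_ge0// -powRrM mulVf ?powRr1// ltW.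
  by rewrite mulrA mulfV ?mul1r.
have lRe : 0 < complex.Re l.
  rewrite /l /powC exprMn -rcX expiX.
  have -> : complex.Re (real_complex R ((cnorm M `^ 4^-1) ^+ 2) * expi (2%:R * (4^-1 * Arg M))) =
      (cnorm M `^ 4^-1) ^+ 2 * cos (Arg M / 2).
    have -> : 2%:R * (4^-1 * Arg M) = Arg M / 2 :> R by field.
    by rewrite /= mul0r subr0.
  rewrite mulr_gt0 ?exprn_gt0 ?powR_gt0//.
  have x1 : -1 <= complex.Re M / cnorm M <= 1.
    rewrite ler_pdivlMr// ler_pdivrMr// mulN1r mul1r -ler_norml; exact: cnorm_Re.
  have xn : complex.Re M / cnorm M != -1.
    apply/eqP => h; have : complex.Re M + cnorm M = 0.
      by rewrite -[complex.Re M](@mulfVK _ (cnorm M)) ?gt_eqF// h mulN1r addNr.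
    have -> : complex.Re M + cnorm M = 2 * complex.Re s ^+ 2.
      by rewrite -sM cnormX cnorm_sqr; case: (s) => p q /=; rewrite !expr2; ring.
    by move/eqP; rewrite gt_eqF// mulr_gt0// exprn_gt0.
  have api : acos (complex.Re M / cnorm M) < pi.
    rewrite lt_neqAle acos_lepi// andbT; apply: contra xn => /eqP h.
    by rewrite -(acosK x1) h cospi.
  have a0 := acos_ge0 x1.
  by apply: cos_gt0_pihalf; rewrite /Arg; case: ifP => _; apply/andP; split; lra.
have : (l - s) * (l + s) = 0 by rewrite -subr_sqr l2 sM subrr.
move=> /eqP; rewrite mulf_eq0 => /orP[|]; first by rewrite subr_eq0 => /eqP.
rewrite addr_eq0 => /eqP ls; move: lRe; rewrite ls; case: (s) s0 => p q /= p0.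
by rewrite oppr_gt0 ltNge ltW.
Qed.

Hypothesis halpha : 0 < alpha < pi.

(** With [l ^+ 2 = s], the numerator is [2 |s|] and the denominator [(2 Re l) ^ 2] is
    [2 Re s + 2 |s|]. *)
Lemma kernel_Omega_sphere_sqrt u0 : Omega alpha u0 ->
  (complex.Re (kernel_Omega alpha u0 u0))^-1 =
  1 + complex.Re (sphere_sqrt alpha u0) / cnorm (sphere_sqrt alpha u0).
Proof.
move=> Ou0; have s0 := Re_sphere_sqrt halpha Ou0.
have l2 : lambda alpha u0 ^+ 2 = sphere_sqrt alpha u0.
  apply: powC_quarter_sqr => //; case: u0 {Ou0 s0} => [z|] /=; last exact: sinf_sqr.
  exact: sqrt_mob_sqr.
move: (sphere_sqrt alpha u0) s0 l2 => s s0 l2.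
have n0 : 0 < cnorm s by rewrite cnorm_gt0; apply: contraTneq s0 => ->; rewrite ltxx.
rewrite /kernel_Omega; move: (lambda alpha u0) l2 => l l2.
have -> : 2 * l * conjc l / (l + conjc l) ^+ 2 =
    real_complex R (2 * cnorm s / (2 * complex.Re s + 2 * cnorm s)).
  have -> : (l + conjc l) ^+ 2 = real_complex R (2 * complex.Re s + 2 * cnorm s).
    rewrite -l2 cnormX cnorm_sqr; case: (l) => p q /=.
    by apply/eqP; rewrite eq_complex !expr2 /=; apply/andP; split; apply/eqP; ring.
  rewrite -(mulrA 2) mulcJ -cnormX l2 rcM rcV rcM; congr (_ * _ / _).
  by rewrite rc_nat.
by rewrite /=; field; rewrite !gt_eqF//; lra.
Qed.

End Kernel.

(** * The normalizing factors and the theorem *)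

Section Assembly.
Variables (R : realType) (alpha beta : R) (k : nat) (u : 'I_k -> R[i]).
Hypothesis halpha : 0 < alpha < pi.
Hypothesis hu : forall j, 1 < cnorm (u j).
Variable s0 : R[i].
Hypothesis s0_gt0 : 0 < complex.Re s0.
Implicit Types z s : R[i].

Let e : R[i] := expi alpha.
Let b : R[i] := sinf alpha.
Let rc := real_complex R (cnorm s0).
Let a := cayley s0 b.
Let z0 := cayley s0 s0.

Lemma one_sub_cayley s : 0 < complex.Re s ->
  1 - cayley s0 s * z0 = 2 * rc * (s + s0) / ((s + rc) * (s0 + rc)).
Proof.
move=> h; have h1 : s + rc != 0 := rhp_add_neq0 s0_gt0 (ltW h).
have h2 : s0 + rc != 0 := rhp_add_neq0 s0_gt0 (ltW s0_gt0).
by rewrite /z0 /cayley -/rc; move: (rc) h1 h2 => r h1 h2; field; rewrite h1 h2.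
Qed.

Lemma cayley_sub s : 0 < complex.Re s ->
  z0 - cayley s0 s = 2 * rc * (s0 - s) / ((s0 + rc) * (s + rc)).
Proof.
move=> h; have h1 : s + rc != 0 := rhp_add_neq0 s0_gt0 (ltW h).
have h2 : s0 + rc != 0 := rhp_add_neq0 s0_gt0 (ltW s0_gt0).
by rewrite /z0 /cayley -/rc; move: (rc) h1 h2 => r h1 h2; field; rewrite h1 h2.
Qed.

Let c2 := cnorm (2 * rc) / cnorm (s0 + rc).

Let c2_gt0 : 0 < c2.
Proof.
rewrite divr_gt0 ?cnorm_gt0 ?(rhp_add_neq0 s0_gt0 (ltW s0_gt0))// mulf_neq0//.
by rewrite rc_eq0 cnorm_eq0; apply: contraTneq s0_gt0 => ->; rewrite ltxx.
Qed.

Let cnorm_pair s : 0 < complex.Re s ->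
  cnorm (rc + s) ^+ 2 * (cnorm (1 - cayley s0 s * z0) * cnorm (1 - conjc (cayley s0 s) * z0)) =
  c2 ^+ 2 * (cnorm (s0 + s) * cnorm (s0 + conjc s)).
Proof.
move=> h; have hJ : 0 < complex.Re (conjc s) by move: h; case: (s).
have E : cnorm (conjc s + rc) = cnorm (s + rc) by rewrite -cnormJ conjcD conjcK conjcR.
rewrite cayleyJ (one_sub_cayley h) (one_sub_cayley hJ) ![cnorm (_ / _)]cnormf.
rewrite ![cnorm (2 * rc * _)]cnormM [cnorm ((s + rc) * _)]cnormM [cnorm ((conjc s + rc) * _)]cnormM.
rewrite E /c2 (addrC rc) (addrC s0 s) (addrC s0 (conjc s)).
have n1 : cnorm (s + rc) != 0 by rewrite cnorm_eq0; exact: (rhp_add_neq0 s0_gt0 (ltW h)).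
have n2 : cnorm (s0 + rc) != 0 by rewrite cnorm_eq0; exact: (rhp_add_neq0 s0_gt0 (ltW s0_gt0)).
move: (cnorm (s + rc)) (cnorm (s0 + rc)) (cnorm (2 * rc)) n1 n2 => p q t n1 n2.
by field; rewrite n1 n2.
Qed.

Let E := c2 ^+ 2 * (cnorm (s0 + b) * cnorm (s0 + conjc b)).

(** Separates the exponential growth, with rate [E] for every base point, from the product of
    [pole_factor], whose inverse is the geometric mean of [|w|] for harmonic measure. *)
Lemma scale_outer m : weight_scale alpha u s0 m * cnorm (outer a (weight_outer alpha u s0) m z0) =
  E ^+ (m + k) * \prod_j cnorm (pole_factor alpha u j s0).
Proof.
rewrite /weight_scale /outer cnormM cnormX weight_outerE cnorm_prod cnormM.
set P1 := \prod_(j < k) _; set P2 := \prod_i _.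
have P12 : P1 * P2 = E ^+ k * \prod_j cnorm (pole_factor alpha u j s0).
  have -> : E ^+ k = \prod_(j < k) E by rewrite prodr_const card_ord.
  rewrite /P1 /P2 -!big_split /=; apply: eq_bigr => j _.
  have sj0 : 0 < complex.Re (sqrt_mob alpha (u j)).
    apply: (Re_sqrt_mob halpha) => /(cnorm_Gamma halpha) h; have := hu j.
    by rewrite h ltxx.
  rewrite cnormM -mulrA cnorm_pair// /pole_factor -/e -/b !cnormM cnormV cnormM /E.
  have := pole_factor_den halpha s0_gt0; rewrite -/b mulf_eq0 negb_or => /andP[n1 n2].
  by field; rewrite !cnorm_eq0 n1 n2.
have hE : cnorm (rc + b) ^+ 2 * (cnorm (1 - a * z0) * cnorm (1 - conjc a * z0)) = E.
  by apply: cnorm_pair; exact: Re_sinf.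
rewrite exprD mulrACA P12 -/rc -/b exprM -exprMn hE.
by rewrite mulrA.
Qed.

Lemma residual_growth_cvg (c0 : R[i]) (gam : R) (val : nat -> {poly R[i]} -> R[i])
    (T : nat -> {poly R[i]}) :
  c0 != 0 -> gam * cnorm c0 = E ->
  (forall n (P : {poly R[i]}), (size P <= n.+1)%N ->
    (hom_poly (num_poly alpha s0) (den_poly alpha s0) n P).[z0] = val n P * c0 ^+ n) ->
  (forall n (P : {poly R[i]}) c, val n (c *: P) = c * val n P) ->
  (forall n, (size (T n) <= n.+1)%N) -> (forall n, val n (T n) = 1) ->
  (forall n (P : {poly R[i]}), (size P <= n.+1)%N -> val n P = 1 ->
    sup_norm (Gamma alpha) (fun z => weight beta u z * (T n).[z]) <=
    sup_norm (Gamma alpha) (fun z => weight beta u z * P.[z])) ->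
  gam ^+ n * sup_norm (Gamma alpha) (fun z => weight beta u z * (T n).[z]) @[n --> \oo] -->
  (1 + complex.Re s0 / cnorm s0) * (\prod_j cnorm (pole_factor alpha u j s0))^-1.
Proof.
move=> c00 gE hv hZ hs hT hm.
have h := residual_cvg (beta := beta) halpha hu s0_gt0 c00 hv hZ hs hT hm.
rewrite -(cayley_s0_norm s0_gt0); set Pi := \prod_j _.
have Pi0 : 0 < Pi.
  by apply: prodr_gt0 => j _; rewrite cnorm_gt0 (pole_factor_neq0 halpha hu).
have E0 : 0 < E.
  have := pole_factor_den halpha s0_gt0; rewrite -/b mulf_eq0 negb_or => /andP[n1 n2].
  by rewrite mulr_gt0 ?exprn_gt0 ?c2_gt0// mulr_gt0 ?cnorm_gt0.
have c0p : 0 < cnorm c0 by rewrite cnorm_gt0.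
have X_gam (m : nat) : (cnorm c0 ^+ (m + k) / (E ^+ (m + k) * Pi))^-1 * Pi^-1 = gam ^+ (m + k).
  have -> : E ^+ (m + k) = gam ^+ (m + k) * cnorm c0 ^+ (m + k) by rewrite -exprMn gE.
  have n1 : cnorm c0 ^+ (m + k) != 0 by rewrite gt_eqF// exprn_gt0.
  have n2 : gam ^+ (m + k) != 0.
    by rewrite expf_neq0//; apply: contraTneq E0 => g0; rewrite -gE g0 mul0r ltxx.
  have n3 : Pi != 0 by rewrite gt_eqF.
  move: (cnorm c0 ^+ _) (gam ^+ _) (Pi) n1 n2 n3 => p q t n1 n2 n3.
  by field; rewrite n1 n2 n3.
have lim : (fun m => gam ^+ (m + k) *
    sup_norm (Gamma alpha) (fun z => weight beta u z * (T (m + k)%N).[z])) @ \oo -->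
    2 / (1 + cnorm z0 ^+ 2) * Pi^-1.
  have -> : (fun m => gam ^+ (m + k) *
      sup_norm (Gamma alpha) (fun z => weight beta u z * (T (m + k)%N).[z])) =
    (fun m => sup_norm (Gamma alpha) (fun z => weight beta u z * (T (m + k)%N).[z]) /
      (cnorm c0 ^+ (m + k) / (weight_scale alpha u s0 m *
        cnorm (outer a (weight_outer alpha u s0) m z0))) * Pi^-1).
    by apply/funext => m; rewrite scale_outer -/Pi -mulrA X_gam mulrC.
  exact: cvgM h (cvg_cst _).
(* The limit was obtained along degrees [n = m + k]. *)
by rewrite -(@cvg_shiftn k _ (fun n => gam ^+ n *
  sup_norm (Gamma alpha) (fun z => weight beta u z * (T n).[z]))).
Qed.

Lemma hom_val z n (P : {poly R[i]}) : sqrt_mob alpha z = s0 -> ~ Gamma alpha z ->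
  (size P <= n.+1)%N -> (den_poly alpha s0).[z0] != 0 ->
  (hom_poly (num_poly alpha s0) (den_poly alpha s0) n P).[z0] =
  P.[z] * (den_poly alpha s0).[z0] ^+ n.
Proof.
move=> sz gz Ps D0; rewrite hom_polyE// mulrC; congr (_.[_] * _).
have [ze _] := mob_off halpha gz.
have s2 : s0 ^+ 2 = mob alpha z by rewrite -sz sqrt_mob_sqr.
have := cayley_factor s0_gt0 z0 ze s2 s0_gt0; rewrite subrr mul0r mulr0 => /eqP.
by rewrite subr_eq0 => /eqP ->; rewrite mulfK.
Qed.

(** Finite base point: the first factor is the exponential of the Green function. *)
Lemma den_growth : s0 != b ->
  cnorm ((s0 + conjc b) / (s0 - b)) * cnorm (den_poly alpha s0).[z0] = E /\
  (den_poly alpha s0).[z0] != 0.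
Proof.
move=> sb; have b0 : 0 < complex.Re b by exact: Re_sinf.
have bJ0 : 0 < complex.Re (conjc b) by move: b0; rewrite /b; case: sinf.
have h1 : b + rc != 0 := rhp_add_neq0 s0_gt0 (ltW b0).
have h2 : s0 + rc != 0 := rhp_add_neq0 s0_gt0 (ltW s0_gt0).
have sb0 : s0 - b != 0 by rewrite subr_eq0.
have DE : (den_poly alpha s0).[z0] = (2 * rc) ^+ 2 / (s0 + rc) ^+ 2 * ((s0 - b) * (s0 + b)).
  rewrite (cayley_den_factor halpha s0_gt0) -/rc -/b (cayley_sub b0) (one_sub_cayley b0).
  by move: (rc) h1 h2 => r h1 h2; field; rewrite h1 h2.
have nz : (den_poly alpha s0).[z0] != 0.
  have rcn : rc != 0.
    by rewrite rc_eq0 cnorm_eq0; apply: contraTneq s0_gt0 => ->; rewrite ltxx.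
  have [sb1 _] : s0 + b != 0 /\ s0 + conjc b != 0.
    by have := pole_factor_den halpha s0_gt0; rewrite mulf_eq0 negb_or => /andP[].
  by rewrite DE mulf_neq0 ?mulf_neq0 ?invr_eq0 ?expf_neq0// mulf_neq0 ?pnatr_eq0.
split => //; rewrite DE /E /c2 cnormf !(cnormX, cnormM) cnormV cnormX.
have n1 : cnorm (s0 - b) != 0 by rewrite cnorm_eq0.
have n2 : cnorm (s0 + rc) != 0 by rewrite cnorm_eq0.
by move: (cnorm (s0 - b)) (cnorm (s0 + rc)) n1 n2 => p q n1 n2; field; rewrite n1 n2.
Qed.

(** Base point at infinity, where [|s0| = 1]. The capacity enters through [|e ^ 2 - 1| = 2 sin alpha
    = 4 sin (alpha / 2) cos (alpha / 2)]. *)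
Lemma num_growth : s0 = b -> (half_chord alpha)^-1 * cnorm (num_poly alpha s0).[z0] = E /\
  (num_poly alpha s0).[z0] != 0 /\ (den_poly alpha s0).[z0] = 0.
Proof.
move=> sb; have b0 : 0 < complex.Re b by exact: Re_sinf.
have S0 := half_chord_gt0 halpha.
have rc1' : rc = 1 by rewrite /rc sb cnorm_sinf rc1.
have h2 : s0 + rc != 0 := rhp_add_neq0 s0_gt0 (ltW s0_gt0).
have h2' : b + 1 != 0 by rewrite -rc1' -sb.
have D0 : (den_poly alpha s0).[z0] = 0.
  by rewrite (cayley_den_factor halpha s0_gt0) /z0 -/b sb subrr mul0r mulr0.
have AE : (num_poly alpha s0).[z0] = 4 / (b + 1) ^+ 2 * (b ^+ 4 - 1).
  rewrite num_polyE -/e -/rc rc1' /z0 /cayley -/rc rc1' sb.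
  have -> : e = b ^+ 2 by rewrite /b sinf_sqr.
  by field.
have bE : cnorm (b ^+ 4 - 1) = 4 * half_chord alpha * complex.Re b.
  have bb : b * conjc b = 1 by rewrite mulcJ cnorm_sinf expr1n rc1.
  have -> : b ^+ 4 - 1 = b ^+ 2 * ((b - conjc b) * (b + conjc b)).
    by rewrite -subr_sqr mulrBr -exprD -exprMn bb expr1n.
  rewrite !(cnormX, cnormM) cnorm_sinf expr1n mul1r.
  have -> : b - conjc b = Complex 0 (2 * half_chord alpha).
    by rewrite /b /sinf /expi /half_chord; apply/eqP; rewrite eq_complex /=; apply/andP; split; apply/eqP; ring.
  have -> : b + conjc b = real_complex R (2 * complex.Re b).
    by rewrite /b /sinf /expi; apply/eqP; rewrite eq_complex /=; apply/andP; split; apply/eqP; ring.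
  rewrite cnorm_real gtr0_norm ?mulr_gt0//.
  have -> : cnorm (Complex 0 (2 * half_chord alpha)) = 2 * half_chord alpha.
    rewrite /cnorm /= expr0n add0r sqrtr_sqr gtr0_norm// mulr_gt0//.
  by ring.
have n1 : 0 < cnorm (b + 1) by rewrite cnorm_gt0.
have cA : cnorm (num_poly alpha s0).[z0] =
    16 * half_chord alpha * complex.Re b / cnorm (b + 1) ^+ 2.
  rewrite AE cnormM bE cnormf cnormX -[4]rc_nat cnorm_real ger0_norm//.
  by field; rewrite gt_eqF.
have nz : (num_poly alpha s0).[z0] != 0.
  rewrite -cnorm_gt0 cA divr_gt0 ?exprn_gt0// !mulr_gt0//.
split; last by split.
rewrite cA /E /c2 sb rc1' mulr1 -[2]rc_nat cnorm_real ger0_norm//.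
have -> : b + b = real_complex R 2 * b by rewrite rc_nat; ring.
have -> : b + conjc b = real_complex R (2 * complex.Re b).
  by rewrite /b /sinf /expi; apply/eqP; rewrite eq_complex /=; apply/andP; split; apply/eqP; ring.
rewrite cnormM cnorm_sinf !cnorm_real !ger0_norm// ?mulr_ge0// ?(ltW b0)//.
by field; rewrite !gt_eqF.
Qed.

End Assembly.

Theorem theorem3p10 (R : realType) (alpha beta : R)
    (k : nat) (u : 'I_k -> R[i])
    (halpha : 0 < alpha < pi)
    (hu : forall j, 1 < cnorm (u j))
    (hbeta : 0 <= beta < 2 * pi)
    (hw0 : 0 < weight beta u 0)
    (u0 : sphere R) (hu0 : Omega alpha u0)
    (g : R[i] -> R) (hg : is_green_infty (Omega alpha) g)
    (omega : probability (measurableTypeR R * measurableTypeR R)%type R)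
    (homega : is_harmonic_measure (Omega alpha) u0 omega)
    (T : nat -> {poly R[i]})
    (hT : forall n,
       is_residual_poly (Gamma alpha) (weight beta u) n u0 (T n)) :
  growth alpha g u0 n *
      sup_norm (Gamma alpha) (fun z => weight beta u z * (T n).[z])
    @[n --> \oo] -->
  (complex.Re (kernel_Omega alpha u0 u0))^-1 *
    expR (\int[omega]_(x in @C_of R @^-1` Gamma alpha)
            ln (cnorm (weight beta u (C_of x)))).
Proof.
have s0_gt0 := Re_sphere_sqrt halpha hu0.
rewrite (expR_integral_ln_weight beta halpha hu hu0 homega).
rewrite (kernel_Omega_sphere_sqrt halpha hu0).
have hs n : (size (T n) <= n.+1)%N by have [] := hT n.
have hv n : value_at n (T n) u0 = 1 by have [] := hT n.
have hm n (P : {poly R[i]}) : (size P <= n.+1)%N -> value_at n P u0 = 1 ->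
    sup_norm (Gamma alpha) (fun z => weight beta u z * (T n).[z]) <=
    sup_norm (Gamma alpha) (fun z => weight beta u z * P.[z]).
  by have [_ _] := hT n; exact.
have hZ n (P : {poly R[i]}) c : value_at n (c *: P) u0 = c * value_at n P u0.
  by rewrite /value_at; case: (u0) => [z|]; rewrite ?hornerZ ?coefZ.
case: u0 hu0 homega hT s0_gt0 hv hm hZ => [z|] hu0 homega hT s0_gt0 hv hm hZ.
- have gz : ~ Gamma alpha z by move=> h; apply: hu0; exists z.
  have sb : sphere_sqrt alpha (Some z) != sinf alpha.
    by rewrite -subr_eq0; exact: (sqrt_mob_neq_sinf halpha).
  have [gE D0] := den_growth halpha s0_gt0 sb.
  have gr n : growth alpha g (Some z) n = cnorm ((sphere_sqrt alpha (Some z) + conjc (sinf alpha)) /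
      (sphere_sqrt alpha (Some z) - sinf alpha)) ^+ n.
    rewrite /growth expRM_natl (green_arc_unique halpha hg gz) /green_arc lnK//.
    rewrite posrE cnorm_gt0 mulf_neq0 ?invr_eq0 ?subr_eq0//.
    exact: (sqrt_mob_add_conj halpha gz (Re_sinf halpha)).
  under eq_fun do rewrite gr.
  apply: (residual_growth_cvg halpha hu s0_gt0 D0 gE _ hZ hs hv hm).
  by move=> n P Ps; exact: (hom_val halpha s0_gt0).
- have [gE [A0 D0]] := num_growth halpha s0_gt0 erefl.
  have gr n : growth alpha g None n = (half_chord alpha)^-1 ^+ n.
    by rewrite /growth (cap_arc halpha) exprVn.
  under eq_fun do rewrite gr.
  apply: (residual_growth_cvg halpha hu s0_gt0 A0 gE _ hZ hs hv hm).
  by move=> n P Ps; rewrite hom_polyE0.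
Qed.
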